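(* There exists a Borel map $\varphi:\mathrm{Tr}\to\mathrm{SB}$ such that $\ell_1$ embeds isomorphically into $\varphi(\theta)$ for every ill-founded tree $\theta$, and $\varphi(\theta)$ is hereditarily indecomposable for every infinite well-founded tree $\theta$. In particular, $\mathrm{HI}$ is $\Pi^1_1$-hard, and the set $\mathrm{C}_{\ell_1}$ of spaces in $\mathrm{SB}$ containing $\ell_1$ cannot be Borel separated from $\mathrm{HI}$.
   Context: $\mathrm{Tr}$ is the standard Borel space of trees on $\mathbb{N}$ (subsets of $\mathbb{N}^{<\mathbb{N}}$ closed under initial segments), a Borel subset of $2^{\mathbb{N}^{<\mathbb{N}}}$; a tree is well-founded if it has no infinite branch, ill-founded otherwise. $\mathrm{SB}$ is the standard Borel space of closed linear subspaces of $C(\Delta)$ with the Effros–Borel structure. $\mathrm{HI}\subset\mathrm{SB}$ is the set of hereditarily indecomposable spaces (infinite dimensional spaces none of whose closed subspaces is a direct sum of two infinite dimensional closed subspaces). $\Pi^1_1$-hard: every coanalytic subset of any standard Borel space Borel-reduces to the set. Two sets $A,C$ cannot be Borel separated if there is no Borel $B$ with $A\subset B$ and $B\cap C=\emptyset$. *)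

(* Defs.v *)
From Stdlib Require Import Reals List.
From Coquelicot Require Import Coquelicot.
Open Scope R_scope.

Definition sigma_algebra {X : Type} (S : (X -> Prop) -> Prop) : Prop :=
  (forall A B : X -> Prop, (forall x, A x <-> B x) -> S A -> S B) /\
  S (fun _ => True) /\
  (forall A, S A -> S (fun x => ~ A x)) /\
  (forall F : nat -> X -> Prop, (forall n, S (F n)) -> S (fun x => exists n, F n x)).

Definition sigma_gen {X : Type} (G : (X -> Prop) -> Prop) (A : X -> Prop) : Prop :=
  forall S, sigma_algebra S -> (forall B, G B -> S B) -> S A.

Definition Cantor := nat -> bool.

Definition agree_upto (n : nat) (x y : Cantor) : Prop :=
  forall i, (i < n)%nat -> x i = y i.

Definition cont (f : Cantor -> R) : Prop :=
  forall x eps, 0 < eps -> exists n, forall y, agree_upto n x y -> Rabs (f y - f x) < eps.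

Definition supnorm (f : Cantor -> R) : R :=
  real (Lub_Rbar (fun r => exists t, r = Rabs (f t))).

Definition is_subspace (X : (Cantor -> R) -> Prop) : Prop :=
  (forall f, X f -> cont f) /\
  X (fun _ => 0) /\
  (forall f g, X f -> X g -> X (fun t => f t + g t)) /\
  (forall (a : R) f, X f -> X (fun t => a * f t)).

Definition is_normclosed (X : (Cantor -> R) -> Prop) : Prop :=
  forall (u : nat -> Cantor -> R) (f : Cantor -> R),
    (forall n, X (u n)) -> cont f ->
    is_lim_seq (fun n => supnorm (fun t => u n t - f t)) 0 -> X f.

Definition closed_subspace (X : (Cantor -> R) -> Prop) : Prop :=
  is_subspace X /\ is_normclosed X.

Definition SB : Type := { X : (Cantor -> R) -> Prop | closed_subspace X }.

Definition elts (X : SB) : (Cantor -> R) -> Prop := proj1_sig X.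

Definition cd_open (U : (Cantor -> R) -> Prop) : Prop :=
  forall f, U f -> cont f /\
    exists eps, 0 < eps /\
      forall g, cont g -> supnorm (fun t => g t - f t) < eps -> U g.

Definition effros_gen (B : SB -> Prop) : Prop :=
  exists U, cd_open U /\ forall X : SB, B X <-> exists f, elts X f /\ U f.

Definition effros_borel : (SB -> Prop) -> Prop := sigma_gen effros_gen.

(* points of 2^(N^{<N}); sequences are lists, s is an initial segment of s ++ u *)
Definition TrSpace := list nat -> bool.

Definition is_tree (T : TrSpace) : Prop :=
  forall s u : list nat, T (s ++ u) = true -> T s = true.

Definition ill_founded (T : TrSpace) : Prop :=
  exists x : nat -> nat, forall n, T (map x (seq 0 n)) = true.

Definition well_founded_tree (T : TrSpace) : Prop := ~ ill_founded T.

Definition infinite_tree (T : TrSpace) : Prop :=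
  ~ exists l : list (list nat), forall s, T s = true -> In s l.

Definition tr_borel : (TrSpace -> Prop) -> Prop :=
  sigma_gen (fun B => exists s, forall T, B T <-> T s = true).

(* Borel map Tr -> SB (Tr carries the relative Borel structure) *)
Definition borel_on_trees (phi : TrSpace -> SB) : Prop :=
  forall B, effros_borel B ->
    exists C, tr_borel C /\ forall T, is_tree T -> (B (phi T) <-> C T).

Definition span_of (l : list (Cantor -> R)) (g : Cantor -> R) : Prop :=
  exists a : nat -> R, forall t,
    g t = fold_right Rplus 0
            (map (fun i => a i * nth i l (fun _ => 0) t) (seq 0 (length l))).

Definition finite_dim (Y : (Cantor -> R) -> Prop) : Prop :=
  exists l : list (Cantor -> R), (forall f, In f l -> Y f) /\ forall g, Y g -> span_of l g.

Definition infinite_dim (Y : (Cantor -> R) -> Prop) : Prop := ~ finite_dim Y.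

Definition HI (Xs : SB) : Prop :=
  infinite_dim (elts Xs) /\
  forall Y, closed_subspace Y -> (forall f, Y f -> elts Xs f) ->
    ~ exists Z W,
        closed_subspace Z /\ closed_subspace W /\
        infinite_dim Z /\ infinite_dim W /\
        (forall f, Z f -> W f -> forall t, f t = 0) /\
        (forall f, Y f <-> exists g h, Z g /\ W h /\ forall t, f t = g t + h t).

Definition l1 (a : nat -> R) : Prop := ex_series (fun n => Rabs (a n)).
Definition l1norm (a : nat -> R) : R := Series (fun n => Rabs (a n)).

Definition embeds_l1 (Xs : SB) : Prop :=
  exists T : (nat -> R) -> (Cantor -> R),
    (forall a, l1 a -> elts Xs (T a)) /\
    (forall a b, l1 a -> l1 b -> forall t, T (fun n => a n + b n) t = T a t + T b t) /\
    (forall (c : R) a, l1 a -> forall t, T (fun n => c * a n) t = c * T a t) /\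
    exists c C, 0 < c /\ 0 < C /\
      forall a, l1 a -> c * l1norm a <= supnorm (T a) /\ supnorm (T a) <= C * l1norm a.

Definition is_metric {X : Type} (d : X -> X -> R) : Prop :=
  (forall x y, 0 <= d x y) /\ (forall x y, d x y = 0 <-> x = y) /\
  (forall x y, d x y = d y x) /\ (forall x y z, d x z <= d x y + d y z).

Definition complete_metric {X : Type} (d : X -> X -> R) : Prop :=
  forall u : nat -> X,
    (forall eps, 0 < eps -> exists N, forall m n, (N <= m)%nat -> (N <= n)%nat -> d (u m) (u n) < eps) ->
    exists x, forall eps, 0 < eps -> exists N, forall n, (N <= n)%nat -> d (u n) x < eps.

Definition separable_metric {X : Type} (d : X -> X -> R) : Prop :=
  exists D : nat -> option X, forall x eps, 0 < eps -> exists n y, D n = Some y /\ d x y < eps.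

Definition metric_open {X : Type} (d : X -> X -> R) (U : X -> Prop) : Prop :=
  forall x, U x -> exists eps, 0 < eps /\ forall y, d x y < eps -> U y.

Definition standard_borel {X : Type} (Sig : (X -> Prop) -> Prop) : Prop :=
  exists d : X -> X -> R, is_metric d /\ complete_metric d /\ separable_metric d /\
    forall A, Sig A <-> sigma_gen (metric_open d) A.

Definition baire_borel : ((nat -> nat) -> Prop) -> Prop :=
  sigma_gen (fun B => exists s : list nat,
    forall y, B y <-> forall i, (i < length s)%nat -> y i = nth i s 0%nat).

Definition prod_sigma {X Y : Type} (SX : (X -> Prop) -> Prop) (SY : (Y -> Prop) -> Prop)
  : (X * Y -> Prop) -> Prop :=
  sigma_gen (fun C => exists A B, SX A /\ SY B /\ forall p, C p <-> A (fst p) /\ B (snd p)).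

Definition analytic {X : Type} (Sig : (X -> Prop) -> Prop) (A : X -> Prop) : Prop :=
  exists C, prod_sigma Sig baire_borel C /\ forall x, A x <-> exists y : nat -> nat, C (x, y).

Definition coanalytic {X : Type} (Sig : (X -> Prop) -> Prop) (A : X -> Prop) : Prop :=
  analytic Sig (fun x => ~ A x).

Definition borel_to_SB {X : Type} (Sig : (X -> Prop) -> Prop) (f : X -> SB) : Prop :=
  forall B, effros_borel B -> Sig (fun x => B (f x)).

Definition pi11_hard (P : SB -> Prop) : Prop :=
  forall (X : Type) (Sig : (X -> Prop) -> Prop), standard_borel Sig ->
    forall A : X -> Prop, coanalytic Sig A ->
      exists f : X -> SB, borel_to_SB Sig f /\ forall x, A x <-> P (f x).

Definition not_borel_separable (P Q : SB -> Prop) : Prop :=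
  ~ exists B, effros_borel B /\ (forall X, P X -> B X) /\ (forall X, B X -> ~ Q X).

(* Main.v *)
Require Import Defs.
From Stdlib Require Import Reals List Lra Lia Psatz Arith Classical ClassicalEpsilon FunctionalExtensionality.
From Stdlib Require Cantor FinFun.
From Coquelicot Require Import Coquelicot.
Open Scope R_scope.

(* One Banach space serves all trees: a mixed-Tsirelson norm on the finitely supported vectors over the
   nodes of N^{<N}, and phi(theta) is the closed span of the unit vectors at the nodes of theta.  The norming
   functionals contain all sign functions on chains of nodes, so a branch of theta spans l_1, and they are
   closed under the weighted averages (1/m_j)(f_1 + ... + f_d), d <= n_j, of successive functionals, where
   for odd j the sequence must be special in the sense of Gowers and Maurey: a code of (f_1, ..., f_i)
   prescribes the weight of f_{i+1}.
   If theta is well founded, the chain functionals are small on some block subspace of every block subspace,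
   since otherwise one could descend in theta forever.  In such subspaces there are rapidly increasing
   sequences of l_1-averages, and a special sequence alternating between two subspaces yields u and v in them
   with |u - v| much smaller than |u + v|; this contradicts the bound on projections that the open mapping
   theorem gives for a closed direct sum.
   Coanalytic sets reduce to well-founded trees by Suslin schemes, and a Borel separation of the two classes
   of trees would be refuted by a diagonal argument. *)

(** The tree theta enters only through the choice of basis vectors, so whether phi(theta) meets an
    open set is a countable condition on theta; this is the gain of one fixed norm. The price is
    that the whole space contains l_1 along every branch of N^{<N}, so indecomposability cannot come
    from the norm alone. The chain functionals are the only ones without a weight; once they are
    small, the Gowers-Maurey scheme applies. Even weights are free, which gives n_j normalized
    blocks a sum of norm at least n_j / (2 m_j). From this come the l_1-averages and the
    contradiction that drives the descent in theta. Odd weights are special: along a special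
    sequence the functionals of the sequence itself norm the sum to n_j / m_j, while any other
    special functional shares an initial part, where alternating signs cancel, and later has only
    wrong weights. So the alternating sum is of order n_j / m_j^2, and the quotient 1 / m_j is as
    small as required. Hardness also needs that ill-founded trees leave HI; the span of a branch is
    split directly into its even and odd levels. *)

Lemma dep_choice {A : Type} (P : A -> Prop) (Q : A -> A -> Prop) :
  (forall a, P a -> exists b, P b /\ Q a b) ->
  forall a0, P a0 -> exists u : nat -> A, u 0%nat = a0 /\ (forall n, P (u n)) /\ forall n, Q (u n) (u (S n)).
Proof.
  intros H a0 Ha0.
  assert (H' : forall a, exists b, P a -> P b /\ Q a b).
  { intro a. destruct (classic (P a)) as [Ha|Ha].
    - destruct (H a Ha) as [b Hb]. exists b. auto.
    - exists a. tauto. }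
  destruct (choice _ H') as [g Hg].
  exists (fun n => Nat.iter n g a0).
  assert (HP : forall n, P (Nat.iter n g a0)).
  { induction n as [|n IH]; simpl; auto. apply Hg; auto. }
  split; [reflexivity|]. split; [exact HP|].
  intro n. simpl. apply Hg. apply HP.
Qed.

(** * Finite sums over initial segments, intervals and lists *)

Fixpoint bsum (n : nat) (F : nat -> R) : R :=
  match n with O => 0 | S n => bsum n F + F n end.

(** As a difference it splits at any index without order conditions. *)
Definition isum (p q : nat) (F : nat -> R) : R := bsum q F - bsum p F.

Definition lsum {A : Type} (l : list A) (F : A -> R) : R :=
  fold_right (fun a s => F a + s) 0 l.
Arguments lsum : simpl never.

Lemma bsum_ext n F G : (forall k, (k < n)%nat -> F k = G k) -> bsum n F = bsum n G.
Proof. induction n as [|n IH]; simpl; intro H; [reflexivity|]. rewrite IH, H by auto with arith. reflexivity. Qed.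

Lemma bsum_plus n F G : bsum n (fun k => F k + G k) = bsum n F + bsum n G.
Proof. induction n as [|n IH]; simpl; [ring|]. rewrite IH; ring. Qed.

Lemma bsum_scal n c F : bsum n (fun k => c * F k) = c * bsum n F.
Proof. induction n as [|n IH]; simpl; [ring|]. rewrite IH; ring. Qed.

Lemma bsum_le n F G : (forall k, (k < n)%nat -> F k <= G k) -> bsum n F <= bsum n G.
Proof. induction n as [|n IH]; simpl; intro H; [lra|]. apply Rplus_le_compat; auto. Qed.

Lemma bsum_abs n F : Rabs (bsum n F) <= bsum n (fun k => Rabs (F k)).
Proof. induction n as [|n IH]; simpl. rewrite Rabs_R0; lra. eapply Rle_trans; [apply Rabs_triang|]. lra. Qed.

Lemma bsum_const n c : bsum n (fun _ => c) = INR n * c.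
Proof. induction n as [|n IH]; [simpl; ring|]. rewrite S_INR. simpl bsum. rewrite IH; ring. Qed.

Lemma bsum_0 n F : (forall k, (k < n)%nat -> F k = 0) -> bsum n F = 0.
Proof. intro H. rewrite (bsum_ext n F (fun _ => 0)) by auto. rewrite bsum_const; ring. Qed.

Lemma bsum_ge0 n F : (forall k, (k < n)%nat -> 0 <= F k) -> 0 <= bsum n F.
Proof. intro H. rewrite <- (bsum_0 n (fun _ => 0)) by auto. apply bsum_le; auto. Qed.

Lemma bsum_tail n m F : (n <= m)%nat -> (forall k, (n <= k < m)%nat -> F k = 0) -> bsum m F = bsum n F.
Proof.
  intros Hnm H. induction Hnm as [|m Hm IH]; [reflexivity|]. simpl. rewrite IH by (intros; apply H; lia).
  rewrite H by lia. ring.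
Qed.

Lemma bsum_swap n m (F : nat -> nat -> R) :
  bsum n (fun i => bsum m (fun k => F i k)) = bsum m (fun k => bsum n (fun i => F i k)).
Proof.
  induction n as [|n IH]; simpl. now rewrite bsum_0.
  rewrite IH. rewrite <- bsum_plus. reflexivity.
Qed.

Lemma bsum_single n i F : (i < n)%nat -> (forall k, (k < n)%nat -> k <> i -> F k = 0) -> bsum n F = F i.
Proof.
  induction n as [|n IH]; [lia|]. intros Hi H. simpl. destruct (Nat.eq_dec i n) as [->|Hne].
  - rewrite bsum_0; [ring|]. intros; apply H; lia.
  - rewrite IH, (H n) by (intros; try apply H; lia). ring.
Qed.

Lemma bsum_add n m F : bsum (n + m) F = bsum n F + bsum m (fun k => F (n + k)%nat).
Proof.
  induction m as [|m IH]; simpl. rewrite Nat.add_0_r; ring.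
  rewrite Nat.add_succ_r. simpl. rewrite IH. ring.
Qed.

Lemma isum_split p r q F : isum p q F = isum p r F + isum r q F.
Proof. unfold isum; ring. Qed.

Lemma isum_S p q F : isum p (S q) F = isum p q F + F q.
Proof. unfold isum; simpl; ring. Qed.

Lemma isum_nil p F : isum p p F = 0.
Proof. unfold isum; ring. Qed.

Lemma isum_ext p q F G : (p <= q)%nat -> (forall k, (p <= k < q)%nat -> F k = G k) -> isum p q F = isum p q G.
Proof.
  intros Hpq. induction Hpq as [|q Hq IH]; intro H. now rewrite !isum_nil.
  rewrite !isum_S, IH, H by (intros; try apply H; lia). reflexivity.
Qed.

Lemma isum_0 p q F : (p <= q)%nat -> (forall k, (p <= k < q)%nat -> F k = 0) -> isum p q F = 0.
Proof.
  intros Hpq. induction Hpq as [|q Hq IH]; intro H. now rewrite !isum_nil.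
  rewrite !isum_S, IH, H by (intros; try apply H; lia). ring.
Qed.

Lemma isum_abs_le p q F B : (p <= q)%nat -> (forall k, (p <= k < q)%nat -> Rabs (F k) <= B) ->
  Rabs (isum p q F) <= B * (INR q - INR p).
Proof.
  intros Hpq. induction Hpq as [|q Hq IH]; intro H. rewrite isum_nil, Rabs_R0; lra.
  rewrite isum_S, S_INR. eapply Rle_trans; [apply Rabs_triang|].
  assert (Rabs (isum p q F) <= B * (INR q - INR p)) by (apply IH; intros; apply H; lia).
  assert (Rabs (F q) <= B) by (apply H; lia). lra.
Qed.

Lemma isum_scal p q c F : isum p q (fun k => c * F k) = c * isum p q F.
Proof. unfold isum. rewrite !bsum_scal; ring. Qed.

Lemma isum_plus p q F G : isum p q (fun k => F k + G k) = isum p q F + isum p q G.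
Proof. unfold isum. rewrite !bsum_plus; ring. Qed.

Lemma isum_0n n F : isum 0 n F = bsum n F.
Proof. unfold isum; simpl; ring. Qed.

Lemma lsum_ext {A} (l : list A) F G : (forall a, In a l -> F a = G a) -> lsum l F = lsum l G.
Proof. induction l as [|a l IH]; simpl; intro H; [reflexivity|]. unfold lsum in *; simpl. rewrite IH, H; auto. Qed.

Lemma lsum_cons {A} (a : A) l F : lsum (a :: l) F = F a + lsum l F.
Proof. reflexivity. Qed.

Lemma lsum_app {A} (l1 l2 : list A) F : lsum (l1 ++ l2) F = lsum l1 F + lsum l2 F.
Proof. induction l1 as [|a l IH]; simpl. change (lsum nil F) with 0; ring. rewrite !lsum_cons, IH; ring. Qed.

Lemma lsum_le {A} (l : list A) F G : (forall a, In a l -> F a <= G a) -> lsum l F <= lsum l G.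
Proof. induction l as [|a l IH]; intro H. unfold lsum; simpl; lra. rewrite !lsum_cons.
  apply Rplus_le_compat; [apply H; left; auto|apply IH; intros; apply H; right; auto]. Qed.

Lemma lsum_abs {A} (l : list A) F : Rabs (lsum l F) <= lsum l (fun a => Rabs (F a)).
Proof. induction l as [|a l IH]. unfold lsum; simpl; rewrite Rabs_R0; lra. rewrite !lsum_cons.
  eapply Rle_trans; [apply Rabs_triang|]. lra. Qed.

Lemma lsum_const {A} (l : list A) c : lsum l (fun _ => c) = INR (length l) * c.
Proof. induction l as [|a l IH]. unfold lsum; simpl; ring. rewrite lsum_cons, IH. simpl length. rewrite S_INR; ring. Qed.

Lemma lsum_scal {A} (l : list A) c F : lsum l (fun a => c * F a) = c * lsum l F.
Proof. induction l as [|a l IH]. unfold lsum; simpl; ring. rewrite !lsum_cons, IH; ring. Qed.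

Lemma lsum_plus {A} (l : list A) F G : lsum l (fun a => F a + G a) = lsum l F + lsum l G.
Proof. induction l as [|a l IH]. unfold lsum; simpl; ring. rewrite !lsum_cons, IH; ring. Qed.

Lemma lsum_map {A B} (h : A -> B) (l : list A) F : lsum (map h l) F = lsum l (fun a => F (h a)).
Proof. induction l as [|a l IH]. reflexivity. simpl. rewrite !lsum_cons, IH; reflexivity. Qed.

Lemma lsum_0 {A} (l : list A) F : (forall a, In a l -> F a = 0) -> lsum l F = 0.
Proof. intro H. rewrite (lsum_ext l F (fun _ => 0)) by auto. rewrite lsum_const; ring. Qed.

Lemma lsum_bsum {A} (l : list A) n (F : A -> nat -> R) :
  lsum l (fun a => bsum n (F a)) = bsum n (fun k => lsum l (fun a => F a k)).
Proof. induction l as [|a l IH]. unfold lsum; simpl. now rewrite bsum_0.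
  rewrite lsum_cons, IH, <- bsum_plus. apply bsum_ext. intros; reflexivity. Qed.

Lemma lsum_isum {A} (l : list A) p q (F : A -> nat -> R) :
  lsum l (fun a => isum p q (F a)) = isum p q (fun k => lsum l (fun a => F a k)).
Proof. unfold isum, Rminus. rewrite lsum_plus, !lsum_bsum.
  rewrite (lsum_ext l (fun a => - bsum p (F a)) (fun a => (-1) * bsum p (F a))) by (intros; ring).
  rewrite lsum_scal, lsum_bsum. ring. Qed.

Lemma nth_map_seq {A} (f : nat -> A) d n i : (i < n)%nat -> nth i (map f (seq 0 n)) d = f i.
Proof.
  intro H. rewrite (nth_indep _ d (f 0%nat)) by (rewrite length_map, length_seq; auto).
  rewrite map_nth, seq_nth by auto. reflexivity.
Qed.

Lemma map_seq_S {A} (f : nat -> A) n : map f (seq 0 (S n)) = f 0%nat :: map (fun k => f (S k)) (seq 0 n).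
Proof. rewrite <- cons_seq, <- seq_shift. simpl. rewrite map_map. reflexivity. Qed.

Lemma firstn_map_seq {A} (f : nat -> A) m n : (m <= n)%nat -> firstn m (map f (seq 0 n)) = map f (seq 0 m).
Proof.
  intro H. rewrite firstn_map. f_equal. replace n with (m + (n - m))%nat by lia.
  rewrite seq_app, firstn_app, length_seq, Nat.sub_diag. simpl. rewrite app_nil_r.
  apply firstn_all2. rewrite length_seq; auto.
Qed.

Lemma lsum_map_seq (f : nat -> R) n : lsum (seq 0 n) f = bsum n f.
Proof. induction n as [|n IH]; [reflexivity|]. rewrite seq_S, lsum_app, IH. unfold lsum; simpl; ring. Qed.

(** * Nodes of the tree, indexed by natural numbers *)

Arguments Cantor.to_nat : simpl never.

Fixpoint rcode (l : list nat) : nat :=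
  match l with nil => O | x :: l => S (Cantor.to_nat (rcode l, x)) end.

(** Reversal puts the last entry outermost in the code, so appending entries increases the index. A
    descent in the tree thus moves supports to the right. *)
Definition idx (l : list nat) : nat := rcode (rev l).

Lemma to_nat_ge x y : (x <= Cantor.to_nat (x, y))%nat /\ (y <= Cantor.to_nat (x, y))%nat.
Proof. pose proof (Cantor.to_nat_non_decreasing x y). lia. Qed.

Lemma rcode_surj n : exists l, rcode l = n.
Proof.
  induction n as [n IH] using lt_wf_ind. destruct n as [|k]. now exists nil.
  destruct (Cantor.of_nat k) as [a x] eqn:E.
  assert (Hk : Cantor.to_nat (a, x) = k) by (rewrite <- E; apply Cantor.cancel_to_of).
  destruct (to_nat_ge a x) as [H1 _]. destruct (IH a) as [l Hl]; [lia|].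
  exists (x :: l). simpl. rewrite Hl, Hk. reflexivity.
Qed.

Lemma rcode_inj l l' : rcode l = rcode l' -> l = l'.
Proof.
  revert l'. induction l as [|x l IH]; intros [|y l']; simpl; try congruence.
  intro H. injection H as H. apply Cantor.to_nat_inj in H. injection H as H1 H2.
  subst. f_equal. auto.
Qed.

Definition node (n : nat) : list nat :=
  rev (proj1_sig (constructive_indefinite_description _ (rcode_surj n))).

Lemma idx_node n : idx (node n) = n.
Proof.
  unfold idx, node. rewrite rev_involutive.
  apply (proj2_sig (constructive_indefinite_description _ (rcode_surj n))).
Qed.

Lemma idx_inj l l' : idx l = idx l' -> l = l'.
Proof. unfold idx. intro H. apply rcode_inj in H. rewrite <- (rev_involutive l), H, rev_involutive. reflexivity. Qed.

Lemma node_idx l : node (idx l) = l.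
Proof. apply idx_inj, idx_node. Qed.

Lemma idx_app l u : (idx l <= idx (l ++ u))%nat.
Proof.
  unfold idx. rewrite rev_app_distr. induction (rev u) as [|x w IH]; simpl; [lia|].
  destruct (to_nat_ge (rcode (w ++ rev l)) x). lia.
Qed.

Definition pre (a b : nat) : bool :=
  if list_eq_dec Nat.eq_dec (firstn (length (node a)) (node b)) (node a) then true else false.

Lemma pre_iff a b : pre a b = true <-> exists u, node b = node a ++ u.
Proof.
  unfold pre. destruct (list_eq_dec _ _ _) as [e|e]; split; intro H; try congruence; auto.
  - exists (skipn (length (node a)) (node b)). rewrite <- e at 1. symmetry; apply firstn_skipn.
  - destruct H as [u Hu]. exfalso; apply e. rewrite Hu, firstn_app, firstn_all, Nat.sub_diag. apply app_nil_r.
Qed.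

Lemma pre_le a b : pre a b = true -> (a <= b)%nat.
Proof.
  rewrite pre_iff. intros [u Hu]. rewrite <- (idx_node a), <- (idx_node b), Hu. apply idx_app.
Qed.

Lemma pre_refl a : pre a a = true.
Proof. apply pre_iff. exists nil. now rewrite app_nil_r. Qed.

Lemma pre_trans a b c : pre a b = true -> pre b c = true -> pre a c = true.
Proof. rewrite !pre_iff. intros [u Hu] [v Hv]. exists (u ++ v). rewrite Hv, Hu, app_assoc. reflexivity. Qed.

(** Initial segments of one node form a chain on which lengths and indices are ordered alike, so a
    comparison of indices decides the position in the tree. *)
Lemma pre_chain a b p : pre a p = true -> pre b p = true -> (a <= b)%nat -> pre a b = true.
Proof.
  intros Ha Hb Hab.
  pose proof Ha as Ha'. pose proof Hb as Hb'.
  apply pre_iff in Ha, Hb. destruct Ha as [u Hu], Hb as [v Hv].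
  destruct (le_ge_dec (length (node a)) (length (node b))) as [Hl|Hl].
  - apply pre_iff. exists (skipn (length (node a)) (node b)).
    rewrite <- (firstn_skipn (length (node a)) (node b)) at 1. f_equal.
    assert (E : firstn (length (node a)) (node p) = node a) by (rewrite Hu, firstn_app, firstn_all, Nat.sub_diag; apply app_nil_r).
    rewrite Hv, firstn_app in E. replace (length (node a) - length (node b))%nat with 0%nat in E by lia.
    simpl in E. rewrite app_nil_r in E. exact E.
  - assert (E : pre b a = true).
    { apply pre_iff. exists (skipn (length (node b)) (node a)).
      rewrite <- (firstn_skipn (length (node b)) (node a)) at 1. f_equal.
      assert (E : firstn (length (node b)) (node p) = node b) by (rewrite Hv, firstn_app, firstn_all, Nat.sub_diag; apply app_nil_r).
      rewrite Hu, firstn_app in E. replace (length (node b) - length (node a))%nat with 0%nat in E by lia.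
      simpl in E. rewrite app_nil_r in E. exact E. }
    apply pre_le in E. replace b with a by lia. apply pre_refl.
Qed.

Lemma pre_root a : pre 0 a = true.
Proof. apply pre_iff. exists (node a). replace (node 0) with (@nil nat). reflexivity. symmetry; apply (node_idx nil). Qed.

(** * Norming functionals *)

Definition mm (j : nat) : nat := 2 ^ (2 ^ (S j)).

(* The growth makes n_i^(2m) negligible against n_(i+1)/m^2, where m = m_(i+1). *)
Fixpoint nn (j : nat) : nat :=
  match j with
  | O => 1
  | S i => 1000 * mm (S i) ^ 2 * (nn i + 1) ^ (2 * mm (S i) + 1)
  end.

Notation vec := (nat -> R) (only parsing).

Definition restr (a b : nat) (x : vec) : vec :=
  fun n => if (andb (a <=? n) (n <? b))%nat then x n else 0.

(* Functionals are kept as syntax so that finite sequences of them can be coded by integers.  Each carries an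
   index interval [a, b) to which it is restricted.  Gr a b p s is a sign function on the chain of prefixes of
   node p, with sign - at n iff the n-th entry of s is false; Nd j a b l is the average of l with weight 1/m_j. *)
Inductive fn : Type :=
| Gr (a b p : nat) (s : list bool)
| Nd (j a b : nat) (l : list fn).

(** The hypothesis for the members of a nested list needs an inner recursion through that list. *)
Fixpoint fn_ind_list (P : fn -> Prop)
  (HG : forall a b p s, P (Gr a b p s))
  (HN : forall j a b l, (forall g, In g l -> P g) -> P (Nd j a b l)) (f : fn) {struct f} : P f :=
  match f with
  | Gr a b p s => HG a b p s
  | Nd j a b l => HN j a b l
      ((fix F (l : list fn) : forall g, In g l -> P g :=
          match l with
          | nil => fun g H => match H with end
          | h :: t => fun g H => match H with
                                 | or_introl e => eq_ind h P (fn_ind_list P HG HN h) g e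
                                 | or_intror H' => F t g H'
                                 end
          end) l)
  end.

Definition gc (p : nat) (s : list bool) (n : nat) : R :=
  if pre n p then (if nth n s true then 1 else -1) else 0.

(** Summing up to [p] loses nothing in the case of [Gr], since an initial segment of a node has no
    larger index. *)
Fixpoint ap (f : fn) (x : vec) {struct f} : R :=
  match f with
  | Gr a b p s => bsum (S p) (fun n => gc p s n * restr a b x n)
  | Nd j a b l => / INR (mm j) * fold_right (fun g acc => ap g (restr a b x) + acc) 0 l
  end.

Definition lo (f : fn) := match f with Gr a _ _ _ => a | Nd _ a _ _ => a end.
Definition hi (f : fn) := match f with Gr _ b _ _ => b | Nd _ _ b _ => b end.
Definition wt (f : fn) := match f with Gr _ _ _ _ => None | Nd j _ _ _ => Some j end.

(** Only the outer interval shrinks. The components and their codes stay as they are, so a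
    restricted special average remains special, and [K] is closed under restriction ([K_rs]). *)
Definition rs (a b : nat) (f : fn) : fn :=
  match f with
  | Gr a' b' p s => Gr (Nat.max a a') (Nat.min b b') p s
  | Nd j a' b' l => Nd j (Nat.max a a') (Nat.min b b') l
  end.

Fixpoint succ_l (l : list fn) : Prop :=
  match l with nil => True | f :: l => (forall g, In g l -> (hi f <= lo g)%nat) /\ succ_l l end.

Fixpoint bcode (s : list bool) : nat :=
  match s with nil => 0 | b :: s => S (Cantor.to_nat ((if b then 1 else 0)%nat, bcode s)) end.

(** Parity separates the two constructors. The inner fold is [lcode], written out because of the
    nested recursion. *)
Fixpoint fcode (f : fn) : nat :=
  match f with
  | Gr a b p s => 2 * Cantor.to_nat (a, Cantor.to_nat (b, Cantor.to_nat (p, bcode s)))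
  | Nd j a b l => 2 * Cantor.to_nat (j, Cantor.to_nat (a, Cantor.to_nat (b,
       fold_right (fun g acc => S (Cantor.to_nat (fcode g, acc))) 0%nat l))) + 1
  end.

Definition lcode (l : list fn) : nat :=
  fold_right (fun g acc => S (Cantor.to_nat (fcode g, acc))) 0%nat l.

Lemma bcode_inj s s' : bcode s = bcode s' -> s = s'.
Proof.
  revert s'. induction s as [|b s IH]; intros [|b' s']; simpl; try congruence.
  intro H. injection H as H. apply Cantor.to_nat_inj in H. injection H as H1 H2.
  f_equal; auto. destruct b, b'; congruence.
Qed.

Lemma fcode_inj f : forall f', fcode f = fcode f' -> f = f'.
Proof.
  induction f as [a b p s|j a b l IH] using fn_ind_list; intros [a' b' p' s'|j' a' b' l'] H; simpl fcode in H; try lia.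
  - assert (H' : Cantor.to_nat (a, Cantor.to_nat (b, Cantor.to_nat (p, bcode s))) = Cantor.to_nat (a', Cantor.to_nat (b', Cantor.to_nat (p', bcode s')))) by lia.
    apply Cantor.to_nat_inj in H'. injection H' as -> H'.
    apply Cantor.to_nat_inj in H'. injection H' as -> H'.
    apply Cantor.to_nat_inj in H'. injection H' as -> H'.
    apply bcode_inj in H'. congruence.
  - change (fold_right (fun g acc => S (Cantor.to_nat (fcode g, acc))) 0%nat l) with (lcode l) in H.
    change (fold_right (fun g acc => S (Cantor.to_nat (fcode g, acc))) 0%nat l') with (lcode l') in H.
    assert (H' : Cantor.to_nat (j, Cantor.to_nat (a, Cantor.to_nat (b, lcode l))) = Cantor.to_nat (j', Cantor.to_nat (a', Cantor.to_nat (b', lcode l')))) by lia.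
    apply Cantor.to_nat_inj in H'. injection H' as -> H'.
    apply Cantor.to_nat_inj in H'. injection H' as -> H'.
    apply Cantor.to_nat_inj in H'. injection H' as -> H'. f_equal. clear H.
    revert l' H'. induction l as [|g l IHl]; intros [|g' l'] H; simpl in H; try congruence.
    injection H as H. apply Cantor.to_nat_inj in H. injection H as H1 H2.
    f_equal. apply IH; simpl; auto. apply IHl; auto. intros; apply IH; simpl; auto.
Qed.

Lemma lcode_inj l l' : lcode l = lcode l' -> l = l'.
Proof.
  revert l'. induction l as [|g l IHl]; intros [|g' l'] H; simpl in H; try congruence.
  injection H as H. apply Cantor.to_nat_inj in H. injection H as H1 H2.
  f_equal; auto using fcode_inj.
Qed.

(* The value is even, so that no special condition limits the averages of that weight; its size makes the
   weight exceed n_j^2. *)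
Definition code_wt (j : nat) (l : list fn) : nat := (2 * (lcode l + nn j + j + 1))%nat.

(** The empty history counts too. As the coding is injective, two special sequences that differ at
    some entry have no weight in common after it. *)
Definition special (j : nat) (l : list fn) : Prop :=
  forall l1 g l2, l = l1 ++ g :: l2 -> wt g = Some (code_wt j l1).

Inductive K : fn -> Prop :=
| KG a b p s : K (Gr a b p s)
| KN j a b l : (forall f, In f l -> K f) -> succ_l l -> (length l <= nn j)%nat ->
    (Nat.odd j = true -> special j l) -> K (Nd j a b l).

Lemma ap_Nd j a b l x : ap (Nd j a b l) x = / INR (mm j) * lsum l (fun g => ap g (restr a b x)).
Proof. reflexivity. Qed.

Lemma restr_restr a b a' b' x : restr a' b' (restr a b x) = restr (Nat.max a a') (Nat.min b b') x.
Proof.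
  apply functional_extensionality; intro n. unfold restr.
  destruct (Nat.leb_spec a' n), (Nat.ltb_spec n b'), (Nat.leb_spec a n), (Nat.ltb_spec n b),
    (Nat.leb_spec (Nat.max a a') n), (Nat.ltb_spec n (Nat.min b b')); simpl; try reflexivity; lia.
Qed.

Lemma ap_rs a b f x : ap (rs a b f) x = ap f (restr a b x).
Proof. destruct f; simpl; rewrite restr_restr; reflexivity. Qed.

Lemma ap_range f x : ap f (restr (lo f) (hi f) x) = ap f x.
Proof. destruct f; simpl; rewrite restr_restr, Nat.max_id, Nat.min_id; reflexivity. Qed.

Lemma ap_plus f : forall x y, ap f (fun n => x n + y n) = ap f x + ap f y.
Proof.
  assert (Hr : forall a b x y, restr a b (fun n : nat => x n + y n) = (fun n => restr a b x n + restr a b y n)).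
  { intros. apply functional_extensionality; intro n. unfold restr. destruct (andb _ _); ring. }
  induction f as [a b p s|j a b l IH] using fn_ind_list; intros x y.
  - simpl ap. rewrite Hr. change (bsum (S p) (fun n => gc p s n * (restr a b x n + restr a b y n)) = bsum (S p) (fun n => gc p s n * restr a b x n) + bsum (S p) (fun n => gc p s n * restr a b y n)).
    rewrite <- bsum_plus. apply bsum_ext; intros; ring.
  - rewrite !ap_Nd, Hr. rewrite (lsum_ext l _ (fun g => ap g (restr a b x) + ap g (restr a b y))) by (intros; apply IH; auto).
    rewrite lsum_plus; ring.
Qed.

Lemma ap_scal f : forall c x, ap f (fun n => c * x n) = c * ap f x.
Proof.
  assert (Hr : forall a b c x, restr a b (fun n : nat => c * x n) = (fun n => c * restr a b x n)).
  { intros. apply functional_extensionality; intro n. unfold restr. destruct (andb _ _); ring. }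
  induction f as [a b p s|j a b l IH] using fn_ind_list; intros c x.
  - simpl ap. rewrite Hr. change (bsum (S p) (fun n => gc p s n * (c * restr a b x n)) = c * bsum (S p) (fun n => gc p s n * restr a b x n)).
    rewrite <- bsum_scal. apply bsum_ext; intros; ring.
  - rewrite !ap_Nd, Hr. rewrite (lsum_ext l _ (fun g => c * ap g (restr a b x))) by (intros; apply IH; auto).
    rewrite lsum_scal; ring.
Qed.

Definition vsum (n : nat) (x : nat -> vec) : vec := fun t => bsum n (fun k => x k t).

Lemma ap_0 f : ap f (fun _ => 0) = 0.
Proof. replace (fun _ : nat => 0) with (fun n : nat => 0 * 0) by (apply functional_extensionality; intro; ring).
  rewrite (ap_scal f 0 (fun _ => 0)). ring. Qed.

Lemma ap_vsum f n x : ap f (vsum n x) = bsum n (fun k => ap f (x k)).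
Proof.
  unfold vsum. induction n as [|n IH]; simpl. apply ap_0.
  rewrite <- IH. apply ap_plus.
Qed.

Definition bk (a b : nat) (x : vec) : Prop := forall n, x n <> 0 -> (a <= n < b)%nat.

Lemma bk_out a b x n : bk a b x -> ~ (a <= n < b)%nat -> x n = 0.
Proof. intros H Hn. destruct (Req_dec (x n) 0); auto. exfalso; auto. Qed.

Lemma restr_in a b x : bk a b x -> restr a b x = x.
Proof.
  intro H. apply functional_extensionality; intro n. unfold restr.
  destruct (Nat.leb_spec a n), (Nat.ltb_spec n b); simpl; try reflexivity; symmetry; apply (bk_out _ _ _ _ H); lia.
Qed.

Lemma restr_off a b a' b' x : bk a' b' x -> (b' <= a \/ b <= a')%nat -> restr a b x = (fun _ => 0).
Proof.
  intros H Hd. apply functional_extensionality; intro n. unfold restr.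
  destruct (Nat.leb_spec a n), (Nat.ltb_spec n b); simpl; try reflexivity; apply (bk_out _ _ _ _ H); lia.
Qed.

Lemma bk_restr a b x : bk a b (restr a b x).
Proof. intros n. unfold restr. destruct (Nat.leb_spec a n), (Nat.ltb_spec n b); simpl; intros; try lia; lra. Qed.

Lemma bk_restr_in a b a' b' x : bk a b x -> bk a b (restr a' b' x).
Proof. intros H n. unfold restr. destruct (andb (a' <=? n) (n <? b'))%nat; intros; [apply H; auto|lra]. Qed.

Lemma bk_weaken a b a' b' x : bk a b x -> (a' <= a)%nat -> (b <= b')%nat -> bk a' b' x.
Proof. intros H H1 H2 n Hn. specialize (H n Hn). lia. Qed.

Lemma ap_off f a b x : bk a b x -> (b <= lo f \/ hi f <= a)%nat -> ap f x = 0.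
Proof. intros H Hd. rewrite <- ap_range, (restr_off _ _ _ _ _ H) by tauto. apply ap_0. Qed.

Lemma succ_rs a b l : succ_l l -> succ_l (map (rs a b) l).
Proof.
  induction l as [|f l IH]; simpl; auto. intros [H1 H2]. split; auto.
  intros g Hg. apply in_map_iff in Hg. destruct Hg as [h [<- Hh]]. specialize (H1 h Hh).
  destruct f, h; simpl in *; lia.
Qed.

Lemma K_rs a b f : K f -> K (rs a b f).
Proof. intro H. inversion H; subst; simpl; constructor; auto. Qed.

Lemma mm_ge4 j : (4 <= mm j)%nat.
Proof. unfold mm. change 4%nat with (2 ^ 2)%nat. apply Nat.pow_le_mono_r; [lia|].
  change 2%nat with (2 ^ 1)%nat at 1. apply Nat.pow_le_mono_r; lia. Qed.

Lemma mm_S j : mm (S j) = (mm j * mm j)%nat.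
Proof. unfold mm. rewrite <- Nat.pow_add_r. f_equal. rewrite (Nat.pow_succ_r' 2 (S j)). lia. Qed.

Lemma mm_mono i j : (i <= j)%nat -> (mm i <= mm j)%nat.
Proof. intro H. induction H as [|j H IH]; auto. rewrite mm_S. pose proof (mm_ge4 j). nia. Qed.

Lemma mm_gt j : (2 * j + 4 <= mm j)%nat.
Proof. induction j as [|j IH]; [apply mm_ge4|]. rewrite mm_S. nia. Qed.

Lemma mm_pos j : 0 < INR (mm j).
Proof. apply lt_0_INR. pose proof (mm_ge4 j). lia. Qed.

Lemma mm_ge4R j : 4 <= INR (mm j).
Proof. replace 4 with (INR 4) by (simpl; ring). apply le_INR, mm_ge4. Qed.

Lemma mm_monoR i j : (i <= j)%nat -> INR (mm i) <= INR (mm j).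
Proof. intro. apply le_INR, mm_mono; auto. Qed.

Lemma mm_sqR i j : (i < j)%nat -> INR (mm i) * INR (mm i) <= INR (mm j).
Proof. intro. rewrite <- mult_INR, <- mm_S. apply mm_monoR; lia. Qed.

Definition l1n (N : nat) (x : vec) : R := bsum N (fun n => Rabs (x n)).

Lemma restr_le a b x n : Rabs (restr a b x n) <= Rabs (x n).
Proof. unfold restr. destruct (andb _ _); [lra|]. rewrite Rabs_R0. apply Rabs_pos. Qed.

(** Cutting [x] at [hi f] gives every functional its own part of the l_1 sum. *)
Lemma succ_l1 N l : succ_l l ->
  (forall f x, In f l -> bk 0 N x -> Rabs (ap f x) <= l1n N x) ->
  forall x, bk 0 N x -> lsum l (fun f => Rabs (ap f x)) <= l1n N x.
Proof.
  induction l as [|f l IH]; intros Hs Hf x Hx.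
  - unfold lsum; simpl. apply bsum_ge0. intros; apply Rabs_pos.
  - destruct Hs as [Hs1 Hs2]. rewrite lsum_cons.
    assert (E1 : ap f x = ap f (restr 0 (hi f) x)).
    { rewrite <- ap_range, <- (ap_range f (restr 0 (hi f) x)). f_equal. rewrite restr_restr.
      rewrite Nat.max_0_l, Nat.min_id. reflexivity. }
    assert (E2 : lsum l (fun g => Rabs (ap g x)) = lsum l (fun g => Rabs (ap g (restr (hi f) N x)))).
    { apply lsum_ext. intros g Hg. f_equal. rewrite <- (restr_in 0 N x Hx) at 1.
      rewrite <- ap_range, <- (ap_range g (restr (hi f) N x)). f_equal. rewrite !restr_restr.
      specialize (Hs1 g Hg). f_equal; lia. }
    rewrite E1, E2.
    apply Rle_trans with (l1n N (restr 0 (hi f) x) + l1n N (restr (hi f) N x)).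
    + apply Rplus_le_compat. apply Hf; [left; auto|apply bk_restr_in; auto].
      apply IH; auto. intros; apply Hf; [right|]; auto. apply bk_restr_in; auto.
    + unfold l1n. rewrite <- bsum_plus. apply bsum_le. intros k Hk. unfold restr.
      destruct (Nat.leb_spec 0 k); [|lia]. destruct (Nat.leb_spec (hi f) k), (Nat.ltb_spec k (hi f)), (Nat.ltb_spec k N); simpl;
      rewrite ?Rabs_R0; try lia; lra.
Qed.

Lemma gc_le p s n : Rabs (gc p s n) <= 1.
Proof. unfold gc. destruct (pre n p); [destruct (nth n s true)|]; unfold Rabs; destruct Rcase_abs; lra. Qed.

Lemma bsum_bound_max n m F : (forall k, 0 <= F k) -> (forall k, (m <= k)%nat -> F k = 0) -> bsum n F <= bsum m F.
Proof.
  intros H0 Hm. destruct (le_ge_dec n m) as [H|H].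
  - replace m with (n + (m - n))%nat by lia. rewrite bsum_add.
    assert (0 <= bsum (m - n) (fun k => F (n + k)%nat)) by (apply bsum_ge0; auto). lra.
  - rewrite (bsum_tail m n) by (auto; intros; apply Hm; lia). lra.
Qed.

Lemma ap_l1 f N x : K f -> bk 0 N x -> Rabs (ap f x) <= l1n N x.
Proof.
  intro H. revert x. induction H as [a b p s|j a b l HK IH Hs Hl Hsp]; intros x Hx.
  - simpl ap. change (Rabs (bsum (S p) (fun n => gc p s n * restr a b x n)) <= l1n N x).
    eapply Rle_trans; [apply bsum_abs|].
    apply Rle_trans with (bsum (S p) (fun n => Rabs (x n))).
    + apply bsum_le. intros. rewrite Rabs_mult. pose proof (gc_le p s k). pose proof (restr_le a b x k).
      pose proof (Rabs_pos (restr a b x k)). pose proof (Rabs_pos (gc p s k)). nra.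
    + apply bsum_bound_max. intros; apply Rabs_pos. intros k Hk. rewrite (bk_out _ _ _ _ Hx) by lia. apply Rabs_R0.
  - rewrite ap_Nd, Rabs_mult.
    assert (H1 : Rabs (lsum l (fun g => ap g (restr a b x))) <= l1n N x).
    { eapply Rle_trans; [apply lsum_abs|]. eapply Rle_trans; [apply (succ_l1 N); auto|].
      - apply bk_restr_in; auto.
      - apply bsum_le. intros; apply restr_le. }
    assert (H2 : Rabs (/ INR (mm j)) <= 1).
    { rewrite Rabs_pos_eq. rewrite <- Rinv_1. apply Rinv_le_contravar; [lra|]. pose proof (mm_ge4R j); lra.
      left; apply Rinv_0_lt_compat, mm_pos. }
    pose proof (Rabs_pos (lsum l (fun g => ap g (restr a b x)))). pose proof (Rabs_pos (/ INR (mm j))). nra.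
Qed.

(** The factor 1/m_j is kept here: a functional whose weight is large against the l_1 norm of a
    vector is negligible on it. *)
Lemma ap_Nd_l1 j a b l N x : K (Nd j a b l) -> bk 0 N x -> Rabs (ap (Nd j a b l) x) <= l1n N x / INR (mm j).
Proof.
  intros H Hx. inversion H as [|? ? ? ? HK Hs Hl Hsp]; subst. rewrite ap_Nd, Rabs_mult.
  rewrite Rabs_pos_eq by (left; apply Rinv_0_lt_compat, mm_pos). unfold Rdiv. rewrite Rmult_comm.
  apply Rmult_le_compat_r. left; apply Rinv_0_lt_compat, mm_pos.
  eapply Rle_trans; [apply lsum_abs|]. eapply Rle_trans; [apply (succ_l1 N); auto|].
  - intros; apply ap_l1; auto.
  - apply bk_restr_in; auto.
  - apply bsum_le. intros; apply restr_le.
Qed.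

(** * The norm *)

Definition fs (x : vec) : Prop := exists N, bk 0 N x.

(** The supremum may be infinite for infinite supports, where [real] returns a default; hence the
    hypotheses [fs] below. *)
Definition nrm (x : vec) : R := real (Lub_Rbar (fun r => exists f, K f /\ r = Rabs (ap f x))).

Lemma real_lub (E : R -> Prop) B r0 : E r0 -> (forall r, E r -> r <= B) ->
  (forall r, E r -> r <= real (Lub_Rbar E)) /\ (forall c, (forall r, E r -> r <= c) -> real (Lub_Rbar E) <= c).
Proof.
  intros H0 HB. destruct (Lub_Rbar_correct E) as [H1 H2].
  assert (HF : exists v, Lub_Rbar E = Finite v).
  { destruct (Lub_Rbar E) as [v| |] eqn:EE; [eauto|exfalso|exfalso].
    - apply (H2 (Finite B)). intros r Hr. simpl. auto.
    - apply (H1 r0 H0). }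
  destruct HF as [v Hv]. rewrite Hv in *. simpl. split.
  - intros r Hr. apply (H1 r Hr).
  - intros c Hc. apply (H2 (Finite c)). intros r Hr. apply Hc; auto.
Qed.

Lemma nrm_ub x f : fs x -> K f -> Rabs (ap f x) <= nrm x.
Proof.
  intros [N HN] Hf. refine (proj1 (real_lub (fun r => exists f, K f /\ r = Rabs (ap f x)) (l1n N x) (Rabs (ap f x)) _ _) _ _); eauto.
  intros r [g [Hg ->]]. apply ap_l1; auto.
Qed.

Lemma nrm_le x c : (forall f, K f -> Rabs (ap f x) <= c) -> nrm x <= c.
Proof.
  intro H. refine (proj2 (real_lub (fun r => exists f, K f /\ r = Rabs (ap f x)) c (Rabs (ap (Gr 0 0 0 nil) x)) _ _) _ _).
  - eexists; split; [apply KG|]; reflexivity.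
  - intros r [g [Hg ->]]; auto.
  - intros r [g [Hg ->]]; auto.
Qed.

Lemma nrm_ge0 x : fs x -> 0 <= nrm x.
Proof. intro H. eapply Rle_trans; [apply Rabs_pos|apply (nrm_ub x (Gr 0 0 0 nil) H)]. constructor. Qed.

Lemma nrm_near x : fs x -> 0 < nrm x -> exists f, K f /\ nrm x / 2 <= Rabs (ap f x).
Proof.
  intros Hx Hp. apply NNPP. intro H.
  assert (nrm x <= nrm x / 2); [|lra].
  apply nrm_le. intros f Hf. apply Rnot_lt_le. intro. apply H. exists f. split; auto. lra.
Qed.

(** Coordinates are functionals of [K]: a chain cut down to one node, with the default sign. *)
Lemma ap_unit n x : ap (Gr n (S n) n nil) x = x n.
Proof.
  simpl ap. change (bsum (S n) (fun k => gc n nil k * restr n (S n) x k) = x n).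
  rewrite (bsum_single (S n) n); [|lia|].
  2:{ intros k Hk Hne. unfold restr. destruct (Nat.leb_spec n k); [lia|]. simpl; ring. }
  unfold gc, restr. rewrite pre_refl, Nat.leb_refl. destruct (Nat.ltb_spec n (S n)); [|lia].
  destruct n; simpl; ring.
Qed.

Lemma nrm_coord x n : fs x -> Rabs (x n) <= nrm x.
Proof. intro H. rewrite <- (ap_unit n x). apply nrm_ub; auto. constructor. Qed.

Lemma nrm_pos x n : fs x -> x n <> 0 -> 0 < nrm x.
Proof. intros H Hn. pose proof (nrm_coord x n H). pose proof (Rabs_pos_lt _ Hn). lra. Qed.

Lemma nrm_0 : nrm (fun _ => 0) = 0.
Proof. apply Rle_antisym. apply nrm_le. intros; rewrite ap_0, Rabs_R0; lra. apply nrm_ge0. exists 0%nat; intros n Hn; lra. Qed.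

Lemma fs_plus x y : fs x -> fs y -> fs (fun n => x n + y n).
Proof.
  intros [N HN] [M HM]. exists (Nat.max N M). intros n Hn.
  destruct (Req_dec (x n) 0) as [E|E]. destruct (Req_dec (y n) 0) as [E'|E']. lra.
  specialize (HM n E'); lia. specialize (HN n E); lia.
Qed.

Lemma fs_scal c x : fs x -> fs (fun n => c * x n).
Proof. intros [N HN]. exists N. intros n Hn. apply HN. intro E; apply Hn; rewrite E; ring. Qed.

Lemma fs_sub x y : fs x -> fs y -> fs (fun n => x n - y n).
Proof. intros Hx Hy. replace (fun n => x n - y n) with (fun n : nat => x n + (-1) * y n) by (apply functional_extensionality; intro; ring).
  apply fs_plus; auto. apply (fs_scal (-1)); auto. Qed.

Lemma bk_fs a b x : bk a b x -> fs x.
Proof. intro H. exists b. eapply bk_weaken; eauto; lia. Qed.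

Lemma nrm_plus x y : fs x -> fs y -> nrm (fun n => x n + y n) <= nrm x + nrm y.
Proof.
  intros Hx Hy. apply nrm_le. intros f Hf. rewrite ap_plus. eapply Rle_trans; [apply Rabs_triang|].
  apply Rplus_le_compat; apply nrm_ub; auto.
Qed.

Lemma nrm_scal c x : fs x -> nrm (fun n => c * x n) = Rabs c * nrm x.
Proof.
  assert (H : forall c x, fs x -> nrm (fun n => c * x n) <= Rabs c * nrm x).
  { clear. intros c x Hx. apply nrm_le. intros f Hf. rewrite ap_scal, Rabs_mult.
    apply Rmult_le_compat_l; [apply Rabs_pos|]. apply nrm_ub; auto. }
  intro Hx. apply Rle_antisym; [auto|].
  destruct (Req_dec c 0) as [->|Hc].
  - rewrite Rabs_R0, Rmult_0_l. apply nrm_ge0. apply fs_scal; auto.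
  - assert (H1 := H (/ c) _ (fs_scal c x Hx)). simpl in H1.
    replace (fun n : nat => / c * (c * x n)) with x in H1 by (apply functional_extensionality; intro; field; auto).
    rewrite Rabs_inv in H1. pose proof (Rabs_pos_lt _ Hc).
    apply Rmult_le_reg_l with (/ Rabs c). now apply Rinv_0_lt_compat.
    rewrite <- Rmult_assoc, Rinv_l, Rmult_1_l by lra. exact H1.
Qed.

(** The unit vectors form a bimonotone basis because [K] is closed under [rs]. *)
Lemma nrm_restr a b x : fs x -> nrm (restr a b x) <= nrm x.
Proof. intro Hx. apply nrm_le. intros f Hf. rewrite <- ap_rs. apply nrm_ub; auto. apply K_rs; auto. Qed.

Lemma le_div a b c : 0 < c -> a * c <= b -> a <= b / c.
Proof. intros Hc H. apply (Rle_div_r a b c Hc). exact H. Qed.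

Lemma div_le a b c : 0 < c -> a <= b * c -> a / c <= b.
Proof. intros Hc H. apply (Rle_div_l a b c Hc). exact H. Qed.

(** * Estimates on block sequences *)

Definition blocks (c : nat -> nat) (x : nat -> nat -> R) : Prop :=
  forall k, (c k <= c (S k))%nat /\ bk (c k) (c (S k)) (x k).

Lemma blocks_mono c x i j : blocks c x -> (i <= j)%nat -> (c i <= c j)%nat.
Proof. intros H Hij. induction Hij as [|j Hj IH]; auto. destruct (H j). lia. Qed.

(** [q1] is the first index of the range whose block starts at or beyond [h], so at most block
    [q1 - 1] straddles [h]. *)
Lemma cut_point c h p q : (p <= q)%nat -> (forall k, (c k <= c (S k))%nat) ->
  exists q1, (p <= q1 <= q)%nat /\ (forall k, (q1 <= k < q)%nat -> (h <= c k)%nat) /\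
    ((p < q1)%nat -> (c (q1 - 1) < h)%nat).
Proof.
  intros Hpq Hc. induction Hpq as [|q Hq IH].
  - exists p. repeat split; intros; lia.
  - destruct IH as [q1 [H1 [H2 H3]]]. destruct (Nat.eq_dec q1 q) as [->|Hne].
    + destruct (le_lt_dec h (c q)) as [Hh|Hh].
      * exists q. split; [lia|]. split; auto. intros k Hk. replace k with q by lia. auto.
      * exists (S q). split; [lia|]. split; [intros; lia|]. intros _. simpl. rewrite Nat.sub_0_r. auto.
    + exists q1. split; [lia|]. split; auto. intros k Hk. destruct (Nat.eq_dec k q) as [->|Hk'].
      * apply Nat.le_trans with (c (q - 1)%nat). apply H2; lia.
        replace q with (S (q - 1)) at 2 by lia. apply Hc.
      * apply H2; lia.
Qed.

(** A functional and its successors share at most the block that straddles its right end. The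
    recursion therefore restarts at [q1 - 1] instead of [q1], and this overlap costs one extra [B]
    per functional. *)
Lemma lsum_split c x l A B q : 0 <= A -> 0 <= B -> blocks c x -> succ_l l ->
  (forall f p' q', In f l -> (p' <= q' <= q)%nat ->
     Rabs (isum p' q' (fun k => ap f (x k))) <= A + B * (INR q' - INR p')) ->
  forall p, (p <= q)%nat ->
  lsum l (fun f => Rabs (isum p q (fun k => ap f (x k)))) <= INR (length l) * (A + B) + B * (INR q - INR p).
Proof.
  intros HA HB Hx. induction l as [|f l IH]; intros Hs Hf p Hpq.
  - unfold lsum; simpl. assert (INR p <= INR q) by (apply le_INR; auto). nra.
  - destruct Hs as [Hs1 Hs2]. rewrite lsum_cons. simpl length. rewrite S_INR.
    destruct (cut_point c (hi f) p q Hpq (fun k => proj1 (Hx k))) as [q1 [Hq1 [H1 H2]]].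
    assert (E : isum p q (fun k => ap f (x k)) = isum p q1 (fun k => ap f (x k))).
    { rewrite (isum_split p q1 q), (isum_0 q1 q); [ring|lia|].
      intros k Hk. apply (ap_off f (c k) (c (S k))). apply Hx. right. apply H1; auto. }
    rewrite E.
    destruct (Nat.eq_dec q1 p) as [->|Hne].
    + rewrite isum_nil, Rabs_R0. assert (H := IH Hs2 (fun f p' q' i => Hf f p' q' (or_intror i)) p Hpq). lra.
    + assert (Hlt : (p < q1)%nat) by lia. specialize (H2 Hlt).
      assert (E2 : lsum l (fun g => Rabs (isum p q (fun k => ap g (x k)))) = lsum l (fun g => Rabs (isum (q1 - 1) q (fun k => ap g (x k))))).
      { apply lsum_ext. intros g Hg. f_equal. rewrite (isum_split p (q1 - 1) q), (isum_0 p (q1-1)); [ring|lia|].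
        intros k Hk. apply (ap_off g (c k) (c (S k))). apply Hx. left.
        specialize (Hs1 g Hg). assert (c (S k) <= c (q1 - 1))%nat by (apply (blocks_mono c x); auto; lia). lia. }
      rewrite E2.
      assert (H := IH Hs2 (fun f p' q' i => Hf f p' q' (or_intror i)) (q1 - 1)%nat ltac:(lia)).
      assert (H' := Hf f p q1 (or_introl eq_refl) ltac:(lia)).
      rewrite minus_INR in H by lia. simpl INR in H. lra.
Qed.

Lemma Nd_split c x j a b l A B q : 0 <= A -> 0 <= B -> blocks c x -> K (Nd j a b l) ->
  (forall f p' q', K f -> (p' <= q' <= q)%nat ->
     Rabs (isum p' q' (fun k => ap f (x k))) <= A + B * (INR q' - INR p')) ->
  forall p, (p <= q)%nat ->
  Rabs (isum p q (fun k => ap (Nd j a b l) (x k))) <=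
    / INR (mm j) * (INR (length l) * (A + B) + B * (INR q - INR p)).
Proof.
  intros HA HB Hx HK Hf p Hpq. inversion HK as [|? ? ? ? HK1 Hs Hl Hsp]; subst.
  rewrite (isum_ext p q _ (fun k => / INR (mm j) * lsum (map (rs a b) l) (fun g => ap g (x k)))).
  2: auto. 2:{ intros k Hk. rewrite ap_Nd, lsum_map. f_equal. apply lsum_ext. intros; symmetry; apply ap_rs. }
  rewrite isum_scal, Rabs_mult, Rabs_pos_eq by (left; apply Rinv_0_lt_compat, mm_pos).
  apply Rmult_le_compat_l. left; apply Rinv_0_lt_compat, mm_pos.
  rewrite <- lsum_isum. eapply Rle_trans; [apply lsum_abs|].
  replace (length l) with (length (map (rs a b) l)) by apply length_map.
  apply (lsum_split c); auto. apply succ_rs; auto.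
  intros f p' q' Hin H. apply Hf; auto. apply in_map_iff in Hin. destruct Hin as [g [<- Hg]]. apply K_rs; auto.
Qed.

(* Passing from a functional to its components divides the bound by at least 4 at the cost of at most N
   boundary terms; r such passages leave the error C / 2^r. *)
Lemma block_sum_bound c x n C A0 B0 N : 0 <= C -> 0 <= A0 -> 0 <= B0 -> (1 <= N)%nat -> blocks c x ->
  (forall f k, K f -> (k < n)%nat -> Rabs (ap f (x k)) <= C) ->
  (forall f, K f ->
     (forall p q, (p <= q <= n)%nat -> Rabs (isum p q (fun k => ap f (x k))) <= A0 + B0 * (INR q - INR p)) \/
     (exists i a b l, f = Nd i a b l /\ (length l <= N)%nat)) ->
  forall r f p q, K f -> (p <= q <= n)%nat ->
    Rabs (isum p q (fun k => ap f (x k))) <= (A0 + B0 + C) * INR N ^ r + (B0 + C / 2 ^ r) * (INR q - INR p).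
Proof.
  intros HC HA HB HN Hx HxC Hd.
  assert (HN1 : 1 <= INR N) by (replace 1 with (INR 1) by reflexivity; apply le_INR; auto).
  assert (HP : forall r, 1 <= INR N ^ r) by (intro; apply pow_R1_Rle; auto).
  induction r as [|r IH]; intros f p q Hf Hpq.
  - assert (Rabs (isum p q (fun k => ap f (x k))) <= C * (INR q - INR p)).
    { apply isum_abs_le; [lia|]. intros; apply HxC; auto; lia. }
    assert (INR p <= INR q) by (apply le_INR; lia). simpl. nra.
  - assert (Hp2 : 0 < 2 ^ r) by (apply pow_lt; lra).
    assert (Hle : INR p <= INR q) by (apply le_INR; lia).
    assert (HCr : 0 <= C / 2 ^ r) by (apply Rdiv_le_0_compat; auto).
    assert (HCS : C / 2 ^ S r = (C / 2 ^ r) / 2) by (simpl; field; lra).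
    destruct (Hd f Hf) as [H|[i [a [b [l [-> Hl]]]]]].
    + specialize (H p q Hpq). assert (HPr := HP (S r)). rewrite HCS.
      assert (A0 <= (A0 + B0 + C) * INR N ^ S r) by nra. nra.
    + assert (H : Rabs (isum p q (fun k => ap (Nd i a b l) (x k))) <=
        / INR (mm i) * (INR (length l) * ((A0 + B0 + C) * INR N ^ r + (B0 + C / 2 ^ r)) + (B0 + C / 2 ^ r) * (INR q - INR p))).
      { apply (Nd_split c); auto; try lia. pose proof (HP r); nra. lra. intros; apply IH; auto; lia. }
      eapply Rle_trans; [exact H|]. clear H.
      assert (Hll : INR (length l) <= INR N) by (apply le_INR; auto).
      pose proof (pos_INR (length l)).
      assert (Hm : / INR (mm i) <= / 4) by (apply Rinv_le_contravar; [lra|apply mm_ge4R]).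
      pose proof (HP r) as HPr. rewrite HCS. simpl (INR N ^ S r).
      set (P := INR N ^ r) in *. set (D := C / 2 ^ r) in *. set (d := INR q - INR p) in *.
      assert (HD : D <= C). { unfold D. apply div_le; auto. assert (1 <= 2 ^ r) by (apply pow_R1_Rle; lra). nra. }
      assert (0 <= d) by (unfold d; lra).
      apply Rle_trans with (/ 4 * (INR N * (2 * ((A0 + B0 + C) * P)) + (B0 + D) * d)).
      * apply Rmult_le_compat; auto. left; apply Rinv_0_lt_compat, mm_pos.
        apply Rplus_le_le_0_compat; [apply Rmult_le_pos; auto; nra|nra].
        apply Rplus_le_compat_r. apply Rmult_le_compat; auto; nra.
      * assert (0 <= INR N * ((A0 + B0 + C) * P)) by (apply Rmult_le_pos; [lra|nra]).
        assert (0 <= D * d) by nra. assert (0 <= B0 * d) by nra. nra.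
Qed.

Lemma isum_one_bad p q F B D k0 : (p <= q)%nat -> 0 <= B -> 0 <= D ->
  (forall k, (p <= k < q)%nat -> Rabs (F k) <= D) ->
  (forall k, (p <= k < q)%nat -> k <> k0 -> Rabs (F k) <= B) ->
  Rabs (isum p q F) <= D + B * (INR q - INR p).
Proof.
  intros Hpq HB HD H1 H2. assert (INR p <= INR q) by (apply le_INR; auto).
  destruct (classic (p <= k0 < q)%nat) as [Hk|Hk].
  - rewrite (isum_split p k0 q), (isum_split k0 (S k0) q), isum_S, isum_nil, Rplus_0_l.
    assert (Rabs (isum p k0 F) <= B * (INR k0 - INR p)) by (apply isum_abs_le; [lia|intros; apply H2; lia]).
    assert (Rabs (isum (S k0) q F) <= B * (INR q - INR (S k0))) by (apply isum_abs_le; [lia|intros; apply H2; lia]).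
    assert (Rabs (F k0) <= D) by auto. rewrite S_INR in *.
    eapply Rle_trans; [apply Rabs_triang|]. pose proof (Rabs_triang (F k0) (isum (S k0) q F)). lra.
  - assert (Rabs (isum p q F) <= B * (INR q - INR p)) by (apply isum_abs_le; auto; intros; apply H2; auto; intros ->; auto). lra.
Qed.

Lemma nn_ge1 j : (1 <= nn j)%nat.
Proof.
  destruct j as [|j]; [simpl; lia|]. cbn [nn].
  assert (mm (S j) ^ 2 <> 0)%nat by (apply Nat.pow_nonzero; pose proof (mm_ge4 (S j)); lia).
  assert ((nn j + 1) ^ (2 * mm (S j) + 1) <> 0)%nat by (apply Nat.pow_nonzero; lia).
  set (u := (mm (S j) ^ 2)%nat) in *. set (v := ((nn j + 1) ^ (2 * mm (S j) + 1))%nat) in *.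
  assert (1000 * u * v <> 0)%nat; [|lia]. apply Nat.neq_mul_0; split; auto. apply Nat.neq_mul_0; split; auto; lia.
Qed.

Lemma nn_growth i : 1000 * INR (mm (S i)) ^ 2 * (INR (nn i) + 1) ^ (2 * mm (S i) + 1) = INR (nn (S i)).
Proof. cbn [nn]. rewrite !mult_INR, !pow_INR, plus_INR. replace (INR 1000) with 1000. simpl (INR 1). reflexivity.
  rewrite INR_IZR_INZ. reflexivity. Qed.

Lemma nnR_ge1 i : 1 <= INR (nn i).
Proof. replace 1 with (INR 1) by reflexivity. apply le_INR, nn_ge1. Qed.

Lemma nn_growth' i r : (r <= 2 * mm (S i) + 1)%nat ->
  1000 * INR (mm (S i)) ^ 2 * INR (nn i) ^ r <= INR (nn (S i)).
Proof.
  intro Hr. rewrite <- nn_growth. pose proof (mm_pos (S i)). pose proof (nnR_ge1 i).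
  apply Rmult_le_compat_l. assert (0 <= INR (mm (S i)) ^ 2) by (apply pow_le; lra). lra.
  apply Rle_trans with ((INR (nn i) + 1) ^ r). apply pow_incr; lra. apply Rle_pow; [lra|auto].
Qed.

Lemma nn_lt j : (nn j + 1 <= nn (S j))%nat.
Proof.
  apply INR_le. rewrite <- nn_growth, plus_INR. simpl (INR 1). pose proof (mm_ge4R (S j)). pose proof (nnR_ge1 j).
  assert ((INR (nn j) + 1) ^ 1 <= (INR (nn j) + 1) ^ (2 * mm (S j) + 1)) by (apply Rle_pow; [lra|lia]). rewrite pow_1 in *.
  assert (1 <= INR (mm (S j)) ^ 2) by nra. nra.
Qed.

Lemma nn_mono i j : (i <= j)%nat -> (nn i <= nn j)%nat.
Proof. intro H. induction H as [|j H IH]; auto. pose proof (nn_lt j); lia. Qed.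

Lemma nn_gt j : (j < nn j)%nat.
Proof. induction j as [|j IH]. simpl; lia. pose proof (nn_lt j); lia. Qed.

Lemma pow2_ge m : (4 <= m)%nat -> INR m <= 2 ^ m /\ INR m ^ 2 <= 2 ^ (2 * m).
Proof.
  intro H. assert (INR m <= 2 ^ m).
  { replace 2 with (INR 2) by reflexivity. rewrite <- pow_INR. apply le_INR.
    pose proof (Nat.pow_gt_lin_r 2 m). lia. }
  split; auto. rewrite pow_mult. rewrite <- (pow_mult 2 2 m), Nat.mul_comm, pow_mult. apply pow_incr. split; auto. apply pos_INR.
Qed.

(** * Rapidly increasing sequences *)

Definition vscal (a : R) (x : nat -> R) : nat -> R := fun t => a * x t.

(** Only weights from [J k] up to, but excluding, [J (S k)] can be large on [x k]: smaller ones are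
    handled by [ris_low], larger ones by [ris_l1], as they outgrow the l_1 norm. These ranges are
    disjoint, so a given weight has at most one exceptional [k]. Chain functionals have no weight
    and need [ris_gr]. *)
Record RIS (j : nat) (eta : R) (c : nat -> nat) (x : nat -> nat -> R) (J : nat -> nat) : Prop := {
  ris_blocks : blocks c x;
  ris_norm : forall k, nrm (x k) <= 8;
  ris_J0 : (j <= J 0)%nat;
  ris_J : forall k, (J k < J (S k))%nat;
  ris_low : forall k i a b l, K (Nd i a b l) -> (i < J k)%nat -> Rabs (ap (Nd i a b l) (x k)) <= 8 / INR (mm i);
  ris_l1 : forall k, INR (nn j) * l1n (c (S k)) (x k) <= INR (mm (J (S k)));
  ris_gr : forall k a b p s, Rabs (ap (Gr a b p s) (x k)) <= eta }.

Lemma div_pos_m i a : 0 <= a -> 0 <= a / INR (mm i).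
Proof. intro. apply Rdiv_le_0_compat; auto. apply mm_pos. Qed.

(** In the constant 9, the exceptional vector accounts for 8, and the error 1/n_j summed over at
    most n_j vectors for 1. *)
Lemma ris_high j eta c x J : RIS j eta c x J ->
  forall i a b l p q, K (Nd i a b l) -> (j <= i)%nat -> (p <= q <= nn j)%nat ->
  Rabs (isum p q (fun k => ap (Nd i a b l) (x k))) <= 9 + 8 / INR (mm i) * (INR q - INR p).
Proof.
  intros H i a b l p q HK Hji Hpq.
  pose proof (div_pos_m i 8 ltac:(lra)) as Hm8. pose proof (nnR_ge1 j) as Hn1.
  assert (Hn0 : 0 <= / INR (nn j)) by (left; apply Rinv_0_lt_compat; lra).
  assert (HJm : forall k k', (k <= k')%nat -> (J k <= J k')%nat).
  { intros k k' Hk. induction Hk as [|k' Hk IH]; auto. pose proof (ris_J _ _ _ _ _ H k'). lia. }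
  assert (Hhi : forall k, (J (S k) <= i)%nat -> Rabs (ap (Nd i a b l) (x k)) <= / INR (nn j)).
  { intros k Hk. eapply Rle_trans; [apply (ap_Nd_l1 i a b l (c (S k)))|]; auto.
    - eapply bk_weaken; [apply (ris_blocks _ _ _ _ _ H)| |]; lia.
    - apply div_le. apply mm_pos. apply Rmult_le_reg_l with (INR (nn j)); [lra|].
      eapply Rle_trans; [apply (ris_l1 _ _ _ _ _ H)|]. rewrite <- Rmult_assoc, Rinv_r, Rmult_1_l by lra.
      apply mm_monoR; auto. }
  assert (HD : forall k, Rabs (ap (Nd i a b l) (x k)) <= 8).
  { intro k. eapply Rle_trans; [apply nrm_ub; auto|apply (ris_norm _ _ _ _ _ H)].
    eapply bk_fs; apply (ris_blocks _ _ _ _ _ H). }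
  assert (Hk0 : exists k0, forall k, k <> k0 -> Rabs (ap (Nd i a b l) (x k)) <= 8 / INR (mm i) + / INR (nn j)).
  { destruct (classic (exists k0, (J k0 <= i < J (S k0))%nat)) as [[k0 Hk0]|Hno].
    - exists k0. intros k Hk. destruct (le_lt_dec (J (S k)) i) as [H1|H1].
      + specialize (Hhi k H1). lra.
      + assert (i < J k)%nat.
        { destruct (le_lt_dec (J k) i); auto. exfalso. destruct (lt_dec k k0).
          pose proof (HJm (S k) k0 ltac:(lia)); lia. pose proof (HJm (S k0) k ltac:(lia)); lia. }
        pose proof (ris_low _ _ _ _ _ H k i a b l HK H0). lra.
    - exists 0%nat. intros k _. destruct (le_lt_dec (J (S k)) i) as [H1|H1].
      + specialize (Hhi k H1). lra.
      + assert (i < J k)%nat. { destruct (le_lt_dec (J k) i); auto. exfalso. apply Hno; eauto. }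
        pose proof (ris_low _ _ _ _ _ H k i a b l HK H0). lra. }
  destruct Hk0 as [k0 Hk0].
  eapply Rle_trans; [apply (isum_one_bad p q _ (8 / INR (mm i) + / INR (nn j)) 8 k0); auto; try lia; try lra|].
  assert (INR q <= INR (nn j)) by (apply le_INR; lia). assert (0 <= INR p) by apply pos_INR. assert (INR p <= INR q) by (apply le_INR; lia).
  assert (/ INR (nn j) * (INR q - INR p) <= 1).
  { apply Rmult_le_reg_l with (INR (nn j)); [lra|]. rewrite <- Rmult_assoc, Rinv_r by lra. lra. }
  lra.
Qed.

(** [block_sum_bound] with m_j passages, after which 8 / 2^m_j is at most 8 / m_j. Only weights
    below [j] are split further, and these have at most [nn i0] components. The constant is 9 + 2 +
    8. *)
Lemma ris_all i0 eta c x J : let j := S i0 in RIS j eta c x J -> eta <= / INR (nn j) ->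
  forall f p q, K f -> (p <= q <= nn j)%nat ->
  Rabs (isum p q (fun k => ap f (x k))) <= 19 * INR (nn i0) ^ (mm j) + 16 / INR (mm j) * (INR q - INR p).
Proof.
  intros j H Heta f p q Hf Hpq.
  pose proof (mm_ge4R j) as Hm4. pose proof (nnR_ge1 j) as Hn1.
  pose proof (div_pos_m j 8 ltac:(lra)) as Hm8.
  assert (Hb : Rabs (isum p q (fun k => ap f (x k))) <=
     (9 + 8 / INR (mm j) + 8) * INR (nn i0) ^ (mm j) + (8 / INR (mm j) + 8 / 2 ^ (mm j)) * (INR q - INR p)).
  { apply (block_sum_bound c x (nn j)); auto; try lra. apply nn_ge1. apply H.
    - intros g k Hg _. eapply Rle_trans; [apply nrm_ub; auto|apply (ris_norm _ _ _ _ _ H)].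
      eapply bk_fs; apply (ris_blocks _ _ _ _ _ H).
    - intros g Hg. destruct Hg as [a b u s|i a b l HK Hs Hl Hsp].
      + left. intros p' q' Hpq'.
        assert (INR q' <= INR (nn j)) by (apply le_INR; lia). assert (0 <= INR p') by apply pos_INR. assert (INR p' <= INR q') by (apply le_INR; lia).
        apply Rle_trans with (/ INR (nn j) * (INR q' - INR p')).
        * apply isum_abs_le; [lia|]. intros. eapply Rle_trans; [apply (ris_gr _ _ _ _ _ H)|auto].
        * assert (/ INR (nn j) * (INR q' - INR p') <= 1).
          { apply Rmult_le_reg_l with (INR (nn j)); [lra|]. rewrite <- Rmult_assoc, Rinv_r by lra. lra. }
          nra.
      + destruct (le_lt_dec j i) as [Hi|Hi].
        * left. intros p' q' Hpq'. eapply Rle_trans; [apply (ris_high _ _ _ _ _ H); auto; constructor; auto|].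
          assert (INR p' <= INR q') by (apply le_INR; lia).
          apply Rplus_le_compat_l. apply Rmult_le_compat_r; [lra|].
          unfold Rdiv. apply Rmult_le_compat_l; [lra|]. apply Rinv_le_contravar; [lra|]. apply mm_monoR; auto.
        * right. exists i, a, b, l. split; auto. eapply Nat.le_trans; [apply Hl|]. apply nn_mono. unfold j in Hi; lia. }
  eapply Rle_trans; [exact Hb|].
  assert (INR p <= INR q) by (apply le_INR; lia).
  assert (8 / 2 ^ mm j <= 8 / INR (mm j)).
  { unfold Rdiv. apply Rmult_le_compat_l; [lra|]. apply Rinv_le_contravar; [lra|]. apply pow2_ge, mm_ge4. }
  assert (8 / INR (mm j) <= 2). { apply div_le; lra. }
  assert (0 <= INR (nn i0) ^ mm j) by (apply pow_le, pos_INR).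
  apply Rplus_le_compat. nra.
  apply Rmult_le_compat_r. lra. unfold Rdiv in *. lra.
Qed.

(** The error terms of the splittings are negligible even against n_j / m_j^2, the size of the
    alternating sums below. *)
Lemma nn_big i0 : let j := S i0 in let M := INR (mm j) in let n := INR (nn j) in
  1000 * INR (nn i0) ^ (mm j) <= n / M / M /\ 1000 * INR (nn i0) ^ (2 * mm j) <= n / M / M /\ 1000 * INR (nn i0) ^ (mm j + 1) <= n / M / M /\ 1 <= n / M / M.
Proof.
  intros j M n. assert (HM : 0 < M) by apply mm_pos.
  assert (Hd : forall r, (r <= 2 * mm j + 1)%nat -> 1000 * INR (nn i0) ^ r <= n / M / M).
  { intros r Hr. apply le_div; auto. apply le_div; auto. pose proof (nn_growth' i0 r Hr) as H.
    fold j in H. fold M n in H. nra. }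
  repeat split; try (apply Hd; lia).
  assert (H := Hd 0%nat ltac:(lia)). simpl in H. lra.
Qed.

(** The factor m_j / n_j normalizes the sum for the weight [j], the only one missing from the
    bounds. A functional of smaller weight is split once into at most [nn i0] pieces; larger weights
    fall under [ris_high], where m_i is at least m_j^2. *)
Lemma ris_vector i0 eta c x J : let j := S i0 in RIS j eta c x J -> eta <= / INR (nn j) ->
  let y := vscal (INR (mm j) / INR (nn j)) (vsum (nn j) x) in
  nrm y <= 24 /\
  (forall i a b l, K (Nd i a b l) -> (i < j)%nat -> Rabs (ap (Nd i a b l) y) <= 24 / INR (mm i)) /\
  (forall i a b l, K (Nd i a b l) -> (j < i)%nat -> Rabs (ap (Nd i a b l) y) <= 24 / INR (mm j)) /\
  (forall a b p s, Rabs (ap (Gr a b p s) y) <= INR (mm j) * eta).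
Proof.
  intros j H Heta y.
  pose proof (mm_ge4R j) as Hm4. pose proof (nnR_ge1 j) as Hn1.
  destruct (nn_big i0) as [HB1 [HB2 [HB3 HB4]]]. fold j in HB1, HB2, HB3, HB4.
  assert (Hap : forall f, ap f y = INR (mm j) / INR (nn j) * isum 0 (nn j) (fun k => ap f (x k))).
  { intro f. unfold y, vscal. rewrite (ap_scal f _ (vsum (nn j) x)), ap_vsum, isum_0n. reflexivity. }
  set (M := INR (mm j)) in *. set (n := INR (nn j)) in *.
  assert (Hmn : 0 < M / n) by (apply Rdiv_lt_0_compat; lra).
  assert (Hapb : forall f B, Rabs (isum 0 (nn j) (fun k => ap f (x k))) <= n / M * B -> Rabs (ap f y) <= B).
  { intros f B HB. rewrite Hap, Rabs_mult, (Rabs_pos_eq (M / n)) by lra.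
    apply Rmult_le_reg_l with (n / M). apply Rdiv_lt_0_compat; lra.
    rewrite <- Rmult_assoc. replace (n / M * (M / n)) with 1 by (field; lra). lra. }
  assert (Hnm : n / M / M <= n / M). { apply div_le; [lra|]. assert (0 < n / M) by (apply Rdiv_lt_0_compat; lra). nra. }
  set (P := INR (nn i0) ^ (mm j)) in *.
  assert (HP : 1 <= P) by (apply pow_R1_Rle, nnR_ge1).
  split; [|split; [|split]].
  - apply nrm_le. intros f Hf. apply Hapb.
    eapply Rle_trans; [apply (ris_all i0 eta c x J H Heta); auto; fold j; lia|]. fold j M n P. simpl (INR 0).
    replace (16 / M * (n - 0)) with (16 * (n / M)) by (field; lra). lra.
  - intros i a b l HK Hi. apply Hapb.
    eapply Rle_trans; [apply (Nd_split c x i a b l (19 * P) (16 / M) (nn j))|]; auto; try lia; try lra.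
    + apply Rdiv_le_0_compat; lra. + apply H.
    + intros. apply (ris_all i0 eta c x J H Heta); auto.
    + inversion HK as [|? ? ? ? HK1 Hs Hl Hsp]; subst. fold n. simpl (INR 0).
      replace (n / M * (24 / INR (mm i))) with (/ INR (mm i) * (24 * (n / M))) by (field; split; [|lra]; pose proof (mm_pos i); lra).
      apply Rmult_le_compat_l. left; apply Rinv_0_lt_compat, mm_pos.
      assert (Hll : INR (length l) <= INR (nn i0)). { apply le_INR. eapply Nat.le_trans; [apply Hl|]. apply nn_mono. unfold j in Hi; lia. }
      replace (16 / M * (n - 0)) with (16 * (n / M)) by (field; lra).
      assert (16 / M <= 4) by (apply div_le; lra). assert (0 <= 16 / M) by (apply Rdiv_le_0_compat; lra).
      rewrite Nat.add_1_r in HB3. simpl in HB3. fold P in HB3. pose proof (pos_INR (length l)).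
      assert (INR (length l) * (19 * P + 16 / M) <= INR (nn i0) * (23 * P)) by (apply Rmult_le_compat; nra).
      nra.
  - intros i a b l HK Hi. apply Hapb.
    eapply Rle_trans; [apply (ris_high j eta c x J H i a b l); auto; lia|]. fold n. simpl (INR 0).
    assert (Hmi : M * M <= INR (mm i)) by (apply mm_sqR; auto).
    assert (8 / INR (mm i) <= 8 / (M * M)). { unfold Rdiv. apply Rmult_le_compat_l; [lra|]. apply Rinv_le_contravar; nra. }
    replace (n / M * (24 / M)) with (24 * (n / M / M)) by (field; lra).
    assert (8 / INR (mm i) * (n - 0) <= 8 / (M * M) * n) by (rewrite Rminus_0_r; apply Rmult_le_compat_r; lra).
    replace (8 / (M * M) * n) with (8 * (n / M / M)) in * by (field; lra).
    lra.
  - intros a b p s. rewrite Hap, Rabs_mult, (Rabs_pos_eq (M / n)) by lra.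
    assert (Rabs (isum 0 (nn j) (fun k => ap (Gr a b p s) (x k))) <= eta * (INR (nn j) - INR 0)).
    { apply isum_abs_le; [lia|]. intros; apply (ris_gr _ _ _ _ _ H). }
    fold n in H0. simpl (INR 0) in H0. rewrite Rminus_0_r in H0.
    apply Rle_trans with (M / n * (eta * n)). apply Rmult_le_compat_l; lra. right; field; lra.
Qed.

(** * Alternating sums along special sequences *)

Definition hist (F : nat -> fn) (k : nat) : list fn := map F (seq 0 k).

(** A dependent sequence: each [F k] has the weight prescribed by its predecessors and takes the
    value 1 on [y k], and every other weight is small on [y k] by [ds_low] or [ds_high]. *)
Record DS (j : nat) (c : nat -> nat) (y : nat -> nat -> R) (F : nat -> fn) : Prop := {
  ds_blocks : blocks c y;
  ds_K : forall k, K (F k);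
  ds_wt : forall k, wt (F k) = Some (code_wt j (hist F k));
  ds_lo : forall k, (c k <= lo (F k))%nat;
  ds_hi : forall k, (hi (F k) <= c (S k))%nat;
  ds_one : forall k, ap (F k) (y k) = 1;
  ds_norm : forall k, nrm (y k) <= 24;
  ds_low : forall k i a b l, K (Nd i a b l) -> (i < code_wt j (hist F k))%nat -> Rabs (ap (Nd i a b l) (y k)) <= 24 / INR (mm i);
  ds_high : forall k i a b l, K (Nd i a b l) -> (code_wt j (hist F k) < i)%nat ->
     Rabs (ap (Nd i a b l) (y k)) <= 24 / INR (mm (code_wt j (hist F k)));
  ds_gr : forall k a b p s, Rabs (ap (Gr a b p s) (y k)) <= / INR (nn j) }.

Lemma hist_length F k : length (hist F k) = k.
Proof. unfold hist. rewrite length_map, length_seq. reflexivity. Qed.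

Lemma hist_nth F k i : (i < k)%nat -> nth_error (hist F k) i = Some (F i).
Proof.
  intro H. unfold hist. rewrite nth_error_map. rewrite (nth_error_nth' (seq 0 k) 0%nat) by (rewrite length_seq; auto).
  rewrite seq_nth by auto. reflexivity.
Qed.

Lemma hist_S F k : hist F (S k) = hist F k ++ F k :: nil.
Proof. unfold hist. rewrite seq_S, map_app. reflexivity. Qed.

Lemma code_wt_inj j l l' : code_wt j l = code_wt j l' -> l = l'.
Proof. unfold code_wt. intro H. apply lcode_inj. lia. Qed.

Lemma code_wt_gt j l : (j < code_wt j l)%nat.
Proof. unfold code_wt. lia. Qed.

Lemma code_wt_even j l : Nat.odd (code_wt j l) = false.
Proof. unfold code_wt. rewrite Nat.odd_mul. reflexivity. Qed.

Lemma code_wt_mm j l : INR (nn j) * INR (nn j) <= INR (mm (code_wt j l)).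
Proof.
  rewrite <- mult_INR. apply le_INR. unfold code_wt. set (u := (lcode l + nn j + j + 1)%nat).
  assert (nn j < u)%nat by (unfold u; lia). replace (2 * u)%nat with (S (2 * u - 1)) by lia.
  rewrite mm_S. pose proof (mm_gt (2 * u - 1)). nia.
Qed.

Lemma code_wt_hist_inj j F k k' : code_wt j (hist F k) = code_wt j (hist F k') -> k = k'.
Proof. intro H. apply code_wt_inj in H. rewrite <- (hist_length F k), H, hist_length. reflexivity. Qed.

Definition alt (k : nat) : R := if Nat.even k then 1 else -1.

Lemma alt_abs k : Rabs (alt k) = 1.
Proof. unfold alt. destruct (Nat.even k); unfold Rabs; destruct Rcase_abs; lra. Qed.

Lemma bsum_alt n : bsum n alt = if Nat.even n then 0 else 1.
Proof.
  induction n as [|n IH]; [reflexivity|]. simpl bsum. rewrite IH. rewrite Nat.even_succ. unfold alt.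
  rewrite <- Nat.negb_even. destruct (Nat.even n); simpl; ring.
Qed.

Lemma isum_alt p q : Rabs (isum p q alt) <= 1.
Proof. unfold isum. rewrite !bsum_alt. destruct (Nat.even p), (Nat.even q); unfold Rabs; destruct Rcase_abs; lra. Qed.

(** Neighbouring terms cancel before [k0]; at most one unpaired term and the transitional one
    survive. *)
Lemma isum_alt_step p q v k0 C : (p <= q)%nat -> 0 <= C -> (forall k, (k < k0)%nat -> v k = 1) ->
  (forall k, (k0 < k < q)%nat -> v k = 0) -> (forall k, Rabs (v k) <= C) ->
  Rabs (isum p q (fun k => alt k * v k)) <= 1 + C.
Proof.
  intros Hpq HC H1 H0 Hv.
  assert (Hgen : forall q, (p <= q)%nat -> (q <= k0)%nat -> isum p q (fun k => alt k * v k) = isum p q alt).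
  { intros q' Hq Hq'. apply isum_ext; auto. intros k Hk. rewrite H1 by lia. ring. }
  destruct (le_lt_dec q k0) as [Hq|Hq].
  - rewrite Hgen by auto. pose proof (isum_alt p q). lra.
  - assert (E : forall r, (r <= q)%nat -> (k0 < r)%nat -> isum r q (fun k => alt k * v k) = 0).
    { intros r Hr Hr'. apply isum_0; auto. intros k Hk. rewrite H0 by lia. ring. }
    destruct (le_lt_dec p k0) as [Hp|Hp].
    + rewrite (isum_split p k0 q), (isum_split k0 (S k0) q), (E (S k0)), isum_S, isum_nil, Hgen by lia.
      pose proof (isum_alt p k0). pose proof (Hv k0).
      eapply Rle_trans; [apply Rabs_triang|]. rewrite Rplus_0_l, Rplus_0_r, Rabs_mult, alt_abs. lra.
    + rewrite E by lia. rewrite Rabs_R0. lra.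
Qed.

(** [t] is the length of the longest common initial part of [l] and the sequence [F s], [F (S s)],
    and so on. *)
Lemma list_split_hist (F : nat -> fn) : forall (l : list fn) s, exists t rest, l = map F (seq s t) ++ rest /\
  (rest = nil \/ exists g r, rest = g :: r /\ g <> F (s + t)%nat).
Proof.
  induction l as [|g l IH]; intro s.
  - exists 0%nat, nil. simpl. auto.
  - destruct (classic (g = F s)) as [->|Hg].
    + destruct (IH (S s)) as [t [rest [-> H]]]. exists (S t), rest. simpl. split; auto.
      rewrite Nat.add_succ_r. exact H.
    + exists 0%nat, (g :: l). split; auto. right. exists g, l. rewrite Nat.add_0_r. auto.
Qed.

Lemma ds_ne j c y F : DS j c y F -> forall f k i, K f -> wt f = Some i -> i <> code_wt j (hist F k) ->
  Rabs (ap f (y k)) <= 24 / INR (mm (Nat.min i (code_wt j (hist F k)))).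
Proof.
  intros H f k i Hf Hw Hi. destruct f as [|i' a b l]; [discriminate|]. injection Hw as ->.
  destruct (lt_dec i (code_wt j (hist F k))) as [Hlt|Hge].
  - rewrite Nat.min_l by lia. apply (ds_low _ _ _ _ H); auto.
  - rewrite Nat.min_r by lia. apply (ds_high _ _ _ _ H); auto. lia.
Qed.

Lemma rs_wt a b f : wt (rs a b f) = wt f.
Proof. destruct f; reflexivity. Qed.

Lemma div_mono a u v : 0 <= a -> 0 < u -> u <= v -> a / v <= a / u.
Proof. intros. unfold Rdiv. apply Rmult_le_compat_l; auto. apply Rinv_le_contravar; auto. Qed.

(** By injectivity of the coding at most one [y k] belongs to the weight [i]; it costs 24. All
    weights compared exceed [j], whence the factor with [mm (S j)]. *)
Lemma ds_other j c y F : DS j c y F -> forall f i p q, K f -> wt f = Some i -> (j < i)%nat -> (p <= q)%nat ->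
  Rabs (isum p q (fun k => ap f (vscal (alt k) (y k)))) <= 24 + 24 / INR (mm (S j)) * (INR q - INR p).
Proof.
  intros H f i p q Hf Hw Hi Hpq.
  assert (Ha : forall k, Rabs (ap f (vscal (alt k) (y k))) = Rabs (ap f (y k))).
  { intro k. unfold vscal. rewrite ap_scal, Rabs_mult, alt_abs. ring. }
  assert (H24 : forall k, Rabs (ap f (y k)) <= 24).
  { intro k. eapply Rle_trans; [apply nrm_ub; auto|apply (ds_norm _ _ _ _ H)]. eapply bk_fs, (ds_blocks _ _ _ _ H). }
  assert (Hne : forall k, i <> code_wt j (hist F k) -> Rabs (ap f (y k)) <= 24 / INR (mm (S j))).
  { intros k Hk. eapply Rle_trans; [apply (ds_ne j c y F H); eauto|]. apply div_mono; [lra|apply mm_pos|].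
    apply mm_monoR. pose proof (code_wt_gt j (hist F k)). lia. }
  assert (exists k0, forall k, k <> k0 -> i <> code_wt j (hist F k)) as [k0 Hk0].
  { destruct (classic (exists k0, i = code_wt j (hist F k0))) as [[k0 Hk0]|Hno].
    - exists k0. intros k Hk E. apply Hk. apply (code_wt_hist_inj j F). congruence.
    - exists 0%nat. intros k _ E. apply Hno. eauto. }
  apply (isum_one_bad p q _ _ 24 k0); auto; try lra.
  - apply div_pos_m; lra.
  - intros. rewrite Ha. auto.
  - intros. rewrite Ha. auto.
Qed.

(** [F i] sees only block [i]. So the summand is [alt k] for [k < t] as long as the block lies
    before [a], and 0 once it lies beyond [a] or [k] reaches [t]; the signs cancel up to one
    transitional block. *)
Lemma ds_prefix j c y F t a p q : DS j c y F -> (p <= q)%nat ->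
  Rabs (isum p q (fun k => lsum (hist F t) (fun g => ap g (restr 0 a (vscal (alt k) (y k)))))) <= 25.
Proof.
  intros H Hpq. pose proof (ds_blocks _ _ _ _ H) as Hb.
  set (v := fun k => if (k <? t)%nat then ap (F k) (restr 0 a (y k)) else 0).
  rewrite (isum_ext p q _ (fun k => alt k * v k)); auto.
  2:{ intros k Hk. unfold hist. rewrite lsum_map, lsum_map_seq.
      assert (Hoff : forall i, i <> k -> ap (F i) (restr 0 a (vscal (alt k) (y k))) = 0).
      { intros i Hik. apply (ap_off _ (c k) (c (S k))).
        - apply bk_restr_in. intros n Hn. apply (proj2 (Hb k)). unfold vscal in Hn. intro E; apply Hn; rewrite E; ring.
        - destruct (lt_dec i k) as [Hl|Hl].
          + right. eapply Nat.le_trans; [apply (ds_hi _ _ _ _ H)|]. apply (blocks_mono c y); auto.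
          + left. eapply Nat.le_trans; [|apply (ds_lo _ _ _ _ H)]. apply (blocks_mono c y); auto. lia. }
      unfold v. destruct (Nat.ltb_spec k t) as [Hkt|Hkt].
      - rewrite (bsum_single t k) by auto. unfold vscal. rewrite <- ap_scal. f_equal.
        apply functional_extensionality; intro n. unfold restr. destruct (andb _ _); ring.
      - rewrite bsum_0. ring. intros i Hi. apply Hoff. lia. }
  replace 25 with (1 + 24) by ring.
  assert (Hv : forall k, Rabs (v k) <= 24).
  { intro k. unfold v. destruct (k <? t)%nat; [|rewrite Rabs_R0; lra].
    eapply Rle_trans; [apply nrm_ub|]. eapply bk_fs, bk_restr_in, Hb. apply H.
    eapply Rle_trans; [apply nrm_restr; eapply bk_fs, Hb|apply H]. }
  (* With the shift by one, [q1] is the first block that ends beyond [a]; no other block can be cut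
     by [a]. *)
  destruct (cut_point (fun k => c (S k)) (S a) 0 q ltac:(lia) (fun k => proj1 (Hb (S k)))) as [q1 [Hq1 [H1 H2]]].
  apply (isum_alt_step p q v (Nat.min q1 t)); auto; try lra.
  - intros k Hk. unfold v. destruct (Nat.ltb_spec k t); [|lia].
    specialize (H2 ltac:(lia)). replace (S (q1 - 1)) with q1 in H2 by lia.
    rewrite restr_in. apply (ds_one _ _ _ _ H). eapply bk_weaken; [apply Hb|lia|].
    assert (c (S k) <= c q1)%nat by (apply (blocks_mono c y); auto; lia). lia.
  - intros k Hk. unfold v. destruct (Nat.ltb_spec k t); [|reflexivity].
    rewrite (restr_off 0 a (c k) (c (S k))). apply ap_0. apply Hb. right.
    specialize (H1 q1 ltac:(lia)). assert (c (S q1) <= c k)%nat by (apply (blocks_mono c y); auto; lia). lia.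
Qed.

(** The components are compared with the sequence [F]. The common initial part cancels by
    alternation. The first different component [g] may still have the weight of [F t], which costs
    24. All later ones have weights that occur at no [F k] in the range. *)
Lemma ds_special i0 c y F : let j := S i0 in DS j c y F -> Nat.odd j = true ->
  forall a b l p q, K (Nd j a b l) -> (p <= q <= nn j)%nat ->
  Rabs (isum p q (fun k => ap (Nd j a b l) (vscal (alt k) (y k)))) <= 100 + 24 / INR (mm (S j)) * (INR q - INR p).
Proof.
  intros j H Hodd a b l p q HK Hpq.
  pose proof (ds_blocks _ _ _ _ H) as Hb. pose proof (mm_ge4R j) as Hm4. pose proof (nnR_ge1 j) as Hn1.
  assert (Hle : INR p <= INR q) by (apply le_INR; lia).
  assert (Hqn : INR q <= INR (nn j)) by (apply le_INR; lia). pose proof (pos_INR p) as Hp0.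
  inversion HK as [|? ? ? ? HKl Hs Hl Hsp]; subst. specialize (Hsp Hodd).
  set (X := fun k => vscal (alt k) (y k)) in *.
  assert (HX : forall k, fs (X k)). { intro k. apply fs_scal. eapply bk_fs, Hb. }
  rewrite (isum_ext p q _ (fun k => / INR (mm j) * lsum l (fun g => ap g (restr a b (X k))))) by (auto; try lia; intros; apply ap_Nd).
  rewrite isum_scal, Rabs_mult, Rabs_pos_eq by (left; apply Rinv_0_lt_compat, mm_pos).
  assert (HD0 : 0 <= 24 / INR (mm (S j)) * (INR q - INR p)).
  { apply Rmult_le_pos; [apply div_pos_m|]; lra. }
  set (D := 24 / INR (mm (S j)) * (INR q - INR p)) in *.
  assert (Hmain : Rabs (isum p q (fun k => lsum l (fun g => ap g (restr a b (X k))))) <= 98 + D).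
  2:{ assert (/ INR (mm j) <= 1). { rewrite <- Rinv_1. apply Rinv_le_contravar; lra. }
      assert (0 < / INR (mm j)) by (apply Rinv_0_lt_compat; lra).
      pose proof (Rabs_pos (isum p q (fun k => lsum l (fun g => ap g (restr a b (X k)))))). nra. }
  destruct (list_split_hist F l 0) as [t [rest [El Hrest]]]. rewrite Nat.add_0_l in Hrest.
  fold (hist F t) in El.
  (* The interval [a, b) is the difference of [0, b) and [0, a), hence twice 25. *)
  assert (H1 : Rabs (isum p q (fun k => lsum (hist F t) (fun g => ap g (restr a b (X k))))) <= 50).
  { destruct (le_lt_dec a b) as [Hab|Hab].
    - rewrite (isum_ext p q _ (fun k => lsum (hist F t) (fun g => ap g (restr 0 b (X k))) + (-1) * lsum (hist F t) (fun g => ap g (restr 0 a (X k))))); [|lia|].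
      + rewrite isum_plus, isum_scal. pose proof (ds_prefix j c y F t a p q H ltac:(lia)) as Ha1.
        pose proof (ds_prefix j c y F t b p q H ltac:(lia)) as Hb1. fold X in Ha1, Hb1.
        eapply Rle_trans; [apply Rabs_triang|]. rewrite Rabs_mult. replace (Rabs (-1)) with 1 by (unfold Rabs; destruct Rcase_abs; lra).
        unfold X. lra.
      + intros k Hk. rewrite <- lsum_scal, <- lsum_plus. apply lsum_ext. intros g _. rewrite <- ap_scal, <- ap_plus. f_equal.
        apply functional_extensionality; intro n. unfold restr.
        destruct (Nat.leb_spec a n), (Nat.ltb_spec n b), (Nat.ltb_spec n a); simpl; try lia; ring.
    - rewrite isum_0; [rewrite Rabs_R0; lra|lia|]. intros k Hk. apply lsum_0. intros g _.
      rewrite <- (ap_0 g). f_equal. apply functional_extensionality; intro n. unfold restr.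
      destruct (Nat.leb_spec a n), (Nat.ltb_spec n b); simpl; try lia; reflexivity. }
  rewrite (isum_ext p q _ (fun k => lsum (hist F t) (fun g => ap g (restr a b (X k))) + lsum rest (fun g => ap g (restr a b (X k))))) by (try lia; intros; rewrite El; apply lsum_app).
  rewrite isum_plus.
  destruct Hrest as [->|[g [r [-> Hg]]]].
  - rewrite (isum_0 p q (fun k => lsum nil _)); [|lia|reflexivity]. rewrite Rplus_0_r. lra.
  - assert (HwK : forall l1 h l2, l = l1 ++ h :: l2 -> K h /\ wt h = Some (code_wt j l1)).
    { intros l1 h l2 E. split; [|eapply Hsp; eauto]. apply HKl. rewrite E. apply in_or_app; right; left; auto. }
    assert (H2 : Rabs (isum p q (fun k => ap g (restr a b (X k)))) <= 24 + D).
    { destruct (HwK _ _ _ El) as [Kg Wg].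
      rewrite (isum_ext p q _ (fun k => ap (rs a b g) (X k))) by (try lia; intros; symmetry; apply ap_rs).
      apply (ds_other j c y F H _ (code_wt j (hist F t))); [apply K_rs; auto|rewrite rs_wt; auto|apply code_wt_gt|lia]. }
    (* At most n_j components act on at most n_j blocks, and each value is at most 24 / n_j^2,
       because by [code_wt_mm] both weights involved are that large. *)
    assert (H3 : Rabs (isum p q (fun k => lsum r (fun h => ap h (restr a b (X k))))) <= 24).
    { rewrite <- lsum_isum. eapply Rle_trans; [apply lsum_abs|].
      apply Rle_trans with (lsum r (fun _ => 24 / INR (nn j))).
      - apply lsum_le. intros h Hh. apply in_split in Hh. destruct Hh as [r1 [r2 ->]].
        destruct (HwK (hist F t ++ g :: r1) h r2) as [Kh Wh]. { rewrite El, <- app_assoc. reflexivity. }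
        apply Rle_trans with (24 / (INR (nn j) * INR (nn j)) * (INR q - INR p)).
        + apply isum_abs_le; [lia|]. intros k Hk. rewrite <- ap_rs. unfold X, vscal. rewrite ap_scal, Rabs_mult, alt_abs, Rmult_1_l.
          eapply Rle_trans; [apply (ds_ne j c y F H _ k (code_wt j (hist F t ++ g :: r1)))|].
          * apply K_rs; auto. * rewrite rs_wt; auto.
          (* Equal codes would mean equal histories, but at place [t] one has [g] and the other
             [F t]. *)
          * intro E. apply code_wt_inj in E. assert (Hlen := f_equal (@length fn) E). rewrite length_app, !hist_length in Hlen. simpl in Hlen.
            assert (E2 : nth_error (hist F k) t = Some g).
            { rewrite <- E. rewrite nth_error_app2; rewrite hist_length; [|lia]. rewrite Nat.sub_diag. reflexivity. }
            rewrite hist_nth in E2 by lia. congruence.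
          * apply div_mono; [lra|nra|]. apply Nat.min_case; apply code_wt_mm.
        + apply Rle_trans with (24 / (INR (nn j) * INR (nn j)) * INR (nn j)).
          apply Rmult_le_compat_l; [|lra]. apply Rdiv_le_0_compat; nra. right; field; lra.
      - rewrite lsum_const. assert (INR (length r) <= INR (nn j)).
        { apply le_INR. apply Nat.le_trans with (length l); auto. rewrite El, length_app. simpl. lia. }
        apply Rle_trans with (INR (nn j) * (24 / INR (nn j))). apply Rmult_le_compat_r; auto. apply Rdiv_le_0_compat; lra.
        right; field; lra. }
    rewrite (isum_ext p q (fun k => lsum (g :: r) _) (fun k => ap g (restr a b (X k)) + lsum r (fun h => ap h (restr a b (X k))))) by (try lia; reflexivity).
    rewrite isum_plus.
    eapply Rle_trans; [apply Rabs_triang|].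
    pose proof (Rabs_triang (isum p q (fun k => ap g (restr a b (X k)))) (isum p q (fun k => lsum r (fun h => ap h (restr a b (X k)))))). lra.
Qed.

(** Here 2 m_j passages are made, since the error has to fall below 24 / m_j^2. Weights below [j]
    are split, the weight [j] is covered by [ds_special], and larger ones by [ds_other]. *)
Lemma ds_alt i0 c y F : let j := S i0 in DS j c y F -> Nat.odd j = true ->
  nrm (vsum (nn j) (fun k => vscal (alt k) (y k))) <= 49 * (INR (nn j) / INR (mm j) / INR (mm j)).
Proof.
  intros j H Hodd. pose proof (ds_blocks _ _ _ _ H) as Hb. pose proof (mm_ge4R j) as Hm4. pose proof (nnR_ge1 j) as Hn1.
  destruct (nn_big i0) as [HB1 [HB2 [HB3 HB4]]]. fold j in HB1, HB2, HB3, HB4.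
  set (X := fun k => vscal (alt k) (y k)) in *.
  assert (HX : blocks c X).
  { intro k. split; [exact (proj1 (Hb k))|]. intros n Hn. apply (proj2 (Hb k)). unfold X, vscal in Hn. intro E; apply Hn; rewrite E; ring. }
  apply nrm_le. intros f Hf. rewrite ap_vsum, <- isum_0n.
  assert (Hm : INR (mm (S j)) = INR (mm j) * INR (mm j)) by (rewrite mm_S, mult_INR; reflexivity).
  assert (HX24 : forall f k, K f -> Rabs (ap f (X k)) <= 24).
  { intros g k Hg. unfold X, vscal. rewrite ap_scal, Rabs_mult, alt_abs, Rmult_1_l.
    eapply Rle_trans; [apply nrm_ub; auto|apply (ds_norm _ _ _ _ H)]. eapply bk_fs, Hb. }
  pose proof (div_pos_m (S j) 24 ltac:(lra)) as HM24.
  eapply Rle_trans; [apply (block_sum_bound c X (nn j) 24 100 (24 / INR (mm (S j))) (nn i0)) with (r := (2 * mm j)%nat)|]; auto; try lra; try lia.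
  - apply nn_ge1.
  - intros g Hg. destruct g as [a b u s|i a b l].
    + left. intros p' q' Hpq'.
      assert (INR q' <= INR (nn j)) by (apply le_INR; lia). assert (0 <= INR p') by apply pos_INR. assert (INR p' <= INR q') by (apply le_INR; lia).
      apply Rle_trans with (/ INR (nn j) * (INR q' - INR p')).
      * apply isum_abs_le; [lia|]. intros. unfold X, vscal. rewrite ap_scal, Rabs_mult, alt_abs, Rmult_1_l. apply (ds_gr _ _ _ _ H).
      * assert (/ INR (nn j) * (INR q' - INR p') <= 1).
        { apply Rmult_le_reg_l with (INR (nn j)); [lra|]. rewrite <- Rmult_assoc, Rinv_r by lra. lra. }
        nra.
    + destruct (lt_eq_lt_dec i j) as [[Hi|Hi]|Hi].
      * right. exists i, a, b, l. split; auto. inversion Hg as [|? ? ? ? HKl Hs Hl Hsp]; subst.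
        eapply Nat.le_trans; [apply Hl|]. apply nn_mono. unfold j in Hi; lia.
      * left. intros p' q' Hpq'. subst i. apply (ds_special i0 c y F H Hodd); auto.
      * left. intros p' q' Hpq'. eapply Rle_trans; [apply (ds_other j c y F H (Nd i a b l) i); auto; lia|]. lra.
  - rewrite Hm in *. set (M := INR (mm j)) in *. set (n := INR (nn j)) in *. set (P := INR (nn i0) ^ (2 * mm j)) in *.
    simpl (INR 0). rewrite Rminus_0_r.
    assert (24 / 2 ^ (2 * mm j) <= 24 / (M * M)).
    { apply div_mono; [lra|nra|]. pose proof (proj2 (pow2_ge (mm j) (mm_ge4 j))). fold M in H0. simpl in H0 |- *. lra. }
    assert (HP : 0 <= P) by (apply pow_le, pos_INR).
    assert (24 / (M * M) <= 24). { apply div_le; nra. }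
    replace (49 * (n / M / M)) with (48 / (M * M) * n + n / M / M) by (field; lra).
    assert ((24 / (M * M) + 24 / 2 ^ (2 * mm j)) * n <= 48 / (M * M) * n).
    { apply Rmult_le_compat_r; [lra|]. unfold Rdiv in *. lra. }
    assert ((100 + 24 / (M * M) + 24) * P <= 1000 * P) by (apply Rmult_le_compat_r; lra). lra.
Qed.

Lemma bk_vsum c x n : blocks c x -> bk (c 0%nat) (c n) (vsum n x).
Proof.
  intros Hb t Ht. apply NNPP. intro Hc. apply Ht. unfold vsum. apply bsum_0. intros k Hk.
  apply (bk_out _ _ _ _ (proj2 (Hb k))). assert (c (S k) <= c n)%nat by (apply (blocks_mono c x); auto).
  assert (c 0%nat <= c k)%nat by (apply (blocks_mono c x); auto; lia). lia.
Qed.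

Lemma succ_hist c x F r s : blocks c x -> (forall k, (c k <= lo (F k))%nat) -> (forall k, (hi (F k) <= c (S k))%nat) ->
  succ_l (map F (seq s r)).
Proof.
  intros Hb Hlo Hhi. revert s. induction r as [|r IH]; intro s; simpl; auto.
  split; auto. intros g Hg. apply in_map_iff in Hg. destruct Hg as [k [<- Hk]]. apply in_seq in Hk.
  eapply Nat.le_trans; [apply Hhi|]. eapply Nat.le_trans; [|apply Hlo].
  apply (blocks_mono c x); auto. lia.
Qed.

Lemma ap_hist c x F n j a b : blocks c x -> (forall k, (c k <= lo (F k))%nat) -> (forall k, (hi (F k) <= c (S k))%nat) ->
  (a <= c 0%nat)%nat -> (c n <= b)%nat ->
  ap (Nd j a b (hist F n)) (vsum n x) = / INR (mm j) * bsum n (fun k => ap (F k) (x k)).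
Proof.
  intros Hb Hlo Hhi Ha Hbn. rewrite ap_Nd, restr_in by (eapply bk_weaken; [apply (bk_vsum c)|..]; auto).
  unfold hist. rewrite lsum_map, lsum_map_seq. f_equal. apply bsum_ext.
  intros i Hi. rewrite ap_vsum, (bsum_single n i); auto.
  intros k Hk Hne. apply (ap_off _ (c k) (c (S k))). apply Hb.
  destruct (lt_dec i k) as [Hl|Hl].
  - right. eapply Nat.le_trans; [apply Hhi|]. apply (blocks_mono c x); auto.
  - left. eapply Nat.le_trans; [|apply Hlo]. apply (blocks_mono c x); auto. lia.
Qed.

(** The average of the [F k] themselves is admissible: every initial part of [hist F n] is again a
    history, so [ds_wt] is the special condition. *)
Lemma ds_sum j c y F : DS j c y F -> INR (nn j) / INR (mm j) <= nrm (vsum (nn j) y).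
Proof.
  intros H. pose proof (ds_blocks _ _ _ _ H) as Hb. set (n := nn j).
  set (f := Nd j (c 0%nat) (c n) (hist F n)).
  assert (HKf : K f).
  { constructor.
    - intros g Hg. apply in_map_iff in Hg. destruct Hg as [k [<- _]]. apply H.
    - apply (succ_hist c y); auto; apply H.
    - rewrite hist_length. auto.
    - intros _ l1 g l2 E.
      assert (Hlt : (length l1 < n)%nat). { rewrite <- (hist_length F n), E, length_app. simpl; lia. }
      assert (Hg : g = F (length l1)).
      { assert (E1 : nth_error (hist F n) (length l1) = Some g) by (rewrite E, nth_error_app2, Nat.sub_diag; auto).
        rewrite hist_nth in E1 by auto. congruence. }
      assert (Hl : l1 = hist F (length l1)).
      { assert (E1 : firstn (length l1) (hist F n) = l1) by (rewrite E, firstn_app, firstn_all, Nat.sub_diag; apply app_nil_r).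
        rewrite <- E1 at 1. apply firstn_map_seq. lia. }
      rewrite Hg, Hl, hist_length. apply H. }
  apply Rle_trans with (Rabs (ap f (vsum n y))).
  2:{ apply nrm_ub; auto. eapply bk_fs, bk_vsum; eauto. }
  eapply Rle_trans; [|apply Rle_abs]. unfold f. rewrite (ap_hist c) by (auto; apply H).
  rewrite (bsum_ext n _ (fun _ => 1)) by (intros; apply H). rewrite bsum_const. right. unfold n. field. pose proof (mm_pos j); lra.
Qed.

(** * Construction of special sequences *)

(** Plays the role of a block subspace; [ts_tail] allows block sequences to be picked in it beyond
    any index. *)
Record tailsub (Z : (nat -> R) -> Prop) : Prop := {
  ts_fs : forall x, Z x -> fs x;
  ts_plus : forall x y, Z x -> Z y -> Z (fun n => x n + y n);
  ts_scal : forall a x, Z x -> Z (vscal a x);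
  ts_tail : forall k, exists x, Z x /\ (exists n, x n <> 0) /\ forall n, (n < k)%nat -> x n = 0 }.

(** The state passes on what later choices must know about earlier ones: a list of functionals, a
    weight or a counter. *)
Lemma block_choice {S T : Type} (Q : nat -> nat -> S -> (nat -> R) -> T -> S -> Prop) :
  (forall k s, exists b x t s', (k <= b)%nat /\ bk k b x /\ Q k b s x t s') ->
  forall k0 s0, exists c x t u, c 0%nat = k0 /\ u 0%nat = s0 /\ blocks c x /\
    forall k, Q (c k) (c (Datatypes.S k)) (u k) (x k) (t k) (u (Datatypes.S k)).
Proof.
  intros H k0 s0.
  assert (H' : forall ks : nat * S, exists r : nat * ((nat -> R) * (T * S)),
    (fst ks <= fst r)%nat /\ bk (fst ks) (fst r) (fst (snd r)) /\
    Q (fst ks) (fst r) (snd ks) (fst (snd r)) (fst (snd (snd r))) (snd (snd (snd r)))).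
  { intros [k s]. destruct (H k s) as [b [x [t [s' Hb]]]]. exists (b, (x, (t, s'))). exact Hb. }
  destruct (choice _ H') as [g Hg].
  set (u := fun n => Nat.iter n (fun ks => (fst (g ks), snd (snd (snd (g ks))))) (k0, s0)).
  exists (fun n => fst (u n)), (fun n => fst (snd (g (u n)))), (fun n => fst (snd (snd (g (u n))))), (fun n => snd (u n)).
  split; [reflexivity|]. split; [reflexivity|]. split.
  - intro k. destruct (Hg (u k)) as [H1 [H2 H3]]. split; [exact H1|exact H2].
  - intro k. destruct (Hg (u k)) as [H1 [H2 H3]]. exact H3.
Qed.

Lemma normalize x : fs x -> (exists n, x n <> 0) ->
  exists a f, a <> 0 /\ K f /\ nrm (vscal a x) = 1 /\ / 2 <= ap f (vscal a x).
Proof.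
  intros Hx [n Hn]. pose proof (nrm_pos x n Hx Hn) as Hp.
  destruct (nrm_near x Hx Hp) as [f [Hf Hfx]].
  assert (Hi : 0 < / nrm x) by (apply Rinv_0_lt_compat; auto).
  assert (Hd : / 2 <= / nrm x * Rabs (ap f x)).
  { apply Rmult_le_reg_l with (nrm x); auto. rewrite <- Rmult_assoc, Rinv_r by lra. lra. }
  assert (Hnn : forall e, Rabs e = / nrm x -> nrm (vscal e x) = 1).
  { intros e He. unfold vscal. rewrite nrm_scal, He by auto. apply Rinv_l; lra. }
  destruct (Rle_lt_dec 0 (ap f x)) as [Hs|Hs].
  - exists (/ nrm x), f. repeat split; auto; try lra.
    + apply Hnn. apply Rabs_pos_eq; lra.
    + unfold vscal. rewrite ap_scal. rewrite Rabs_pos_eq in Hd by auto. lra.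
  - exists (- / nrm x), f. repeat split; auto; try lra.
    + apply Hnn. rewrite Rabs_Ropp. apply Rabs_pos_eq; lra.
    + unfold vscal. rewrite ap_scal. rewrite Rabs_left in Hd by auto. lra.
Qed.

Lemma bk_scal a c b x : bk c b x -> bk c b (vscal a x).
Proof. intros H n Hn. apply H. intro E. apply Hn. unfold vscal. rewrite E; ring. Qed.

Lemma fs_bk x k : fs x -> (forall n, (n < k)%nat -> x n = 0) -> exists b, (k <= b)%nat /\ bk k b x.
Proof.
  intros [N HN] H. exists (Nat.max k N). split; [lia|]. intros n Hn. specialize (HN n Hn).
  destruct (lt_dec n k); [|lia]. exfalso. auto.
Qed.

(** An even weight accepts any successive functionals, here the [f k] cut down to their blocks. *)
Lemma lower_bound c u f j n : blocks c u -> (forall k, K (f k) /\ / 2 <= ap (f k) (u k)) ->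
  Nat.odd j = false -> (n <= nn j)%nat -> INR n / (2 * INR (mm j)) <= nrm (vsum n u).
Proof.
  intros Hb Hf Hj Hn. set (F := fun k => rs (c k) (c (S k)) (f k)).
  assert (Hlo : forall k, (c k <= lo (F k))%nat) by (intro k; unfold F; destruct (f k); simpl; lia).
  assert (Hhi : forall k, (hi (F k) <= c (S k))%nat) by (intro k; unfold F; destruct (f k); simpl; lia).
  apply Rle_trans with (Rabs (ap (Nd j (c 0%nat) (c n) (hist F n)) (vsum n u))).
  2:{ apply nrm_ub. eapply bk_fs, bk_vsum; eauto. constructor.
      - intros g Hg. apply in_map_iff in Hg. destruct Hg as [k [<- _]]. apply K_rs, Hf.
      - apply (succ_hist c u); auto.
      - rewrite hist_length; auto.
      - congruence. }
  eapply Rle_trans; [|apply Rle_abs]. rewrite (ap_hist c) by auto.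
  apply Rle_trans with (/ INR (mm j) * bsum n (fun _ => / 2)).
  - rewrite bsum_const. right. field. pose proof (mm_pos j); lra.
  - apply Rmult_le_compat_l. left; apply Rinv_0_lt_compat, mm_pos. apply bsum_le.
    intros k Hk. unfold F. rewrite ap_rs, restr_in by apply Hb. apply Hf.
Qed.

Lemma ts_vsum Z n x : tailsub Z -> (forall k, Z (x k)) -> Z (vsum n x).
Proof.
  intros HZ Hx. unfold vsum. induction n as [|n IH]; simpl.
  - destruct (ts_tail Z HZ 0) as [y [Hy _]]. replace (fun _ : nat => 0) with (vscal 0 y). apply HZ; auto.
    apply functional_extensionality; intro; unfold vscal; ring.
  - apply (ts_plus Z HZ (fun t => bsum n (fun k => x k t)) (x n)); auto.
Qed.

Lemma bsum_mul M P F : bsum (M * P) F = bsum M (fun l => bsum P (fun i => F (l * P + i)%nat)).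
Proof.
  induction M as [|M IH]; [reflexivity|]. simpl bsum. rewrite <- IH, <- bsum_add. f_equal. simpl. lia.
Qed.

Lemma vsum_scal n a x : vsum n (fun k => vscal a (x k)) = vscal a (vsum n x).
Proof. apply functional_extensionality; intro t. unfold vsum, vscal. apply bsum_scal. Qed.

(** James's blocking argument. If M successive vectors of norm at most 1 always had a sum of norm at
    most M/2, repeated grouping would bound sums of M^s of them by (M/2)^s. An even weight j gives
    normalized blocks the lower bound M^s / (2 m_j), which is larger for s = m_j. *)
Lemma l1_average Z k0 M : tailsub Z -> (1 <= M)%nat ->
  exists c y, blocks c y /\ (k0 <= c 0%nat)%nat /\ (forall k, Z (y k) /\ nrm (y k) <= 1) /\
    INR M / 2 <= nrm (vsum M y).
Proof.
  intros HZ HM. apply NNPP. intro Hno.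
  assert (HM0 : 1 <= INR M) by (replace 1 with (INR 1) by reflexivity; apply le_INR; auto).
  assert (H1 : forall c y L, 0 < L -> blocks c y -> (k0 <= c 0%nat)%nat -> (forall k, Z (y k) /\ nrm (y k) <= L) ->
     nrm (vsum M y) <= L * (INR M / 2)).
  { intros c y L HL Hb Hc Hy. apply Rnot_lt_le. intro Hlt. apply Hno.
    exists c, (fun k => vscal (/ L) (y k)).
    assert (HLi : 0 < / L) by (apply Rinv_0_lt_compat; auto).
    split; [intro k; split; [exact (proj1 (Hb k))|apply bk_scal, Hb]|]. split; auto. split.
    - intro k. destruct (Hy k) as [Hy1 Hy2]. split; [apply HZ; auto|]. unfold vscal. rewrite nrm_scal by (apply (ts_fs Z); auto).
      rewrite Rabs_pos_eq by lra. apply Rmult_le_reg_l with L; auto. rewrite <- Rmult_assoc, Rinv_r by lra. lra.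
    - rewrite vsum_scal. unfold vscal. rewrite nrm_scal by (apply (ts_fs Z); auto; apply ts_vsum; auto; apply Hy).
      rewrite Rabs_pos_eq by lra. apply Rmult_le_reg_l with L; auto. rewrite <- Rmult_assoc, Rinv_r by lra. lra. }
  assert (H2 : forall s c y, blocks c y -> (k0 <= c 0%nat)%nat -> (forall k, Z (y k) /\ nrm (y k) <= 1) ->
     nrm (vsum (M ^ s) y) <= (INR M / 2) ^ s).
  { induction s as [|s IH]; intros c y Hb Hc Hy.
    - simpl. replace (vsum 1 y) with (y 0%nat) by (apply functional_extensionality; intro; unfold vsum; simpl; ring). apply Hy.
    - set (P := (M ^ s)%nat) in *.
      set (y' := fun l => vsum P (fun i => y (l * P + i)%nat)).
      replace (vsum (M ^ S s) y) with (vsum M y').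
      2:{ apply functional_extensionality; intro t. unfold vsum, y'. rewrite Nat.pow_succ_r'. fold P. symmetry. apply bsum_mul. }
      simpl pow. rewrite Rmult_comm. apply (H1 (fun l => c (l * P)%nat)).
      + apply pow_lt. lra.
      + intro l. split. apply (blocks_mono c y); auto. simpl; lia.
        pose proof (bk_vsum (fun i => c (l * P + i)%nat) (fun i => y (l * P + i)%nat) P) as Hv. simpl in Hv.
        rewrite Nat.add_0_r in Hv. unfold y'. simpl. rewrite (Nat.add_comm P). apply Hv.
        intro i. rewrite Nat.add_succ_r. apply Hb.
      + exact Hc.
      + intro l. split. apply ts_vsum; auto. intro; apply Hy.
        apply (IH (fun i => c (l * P + i)%nat)).
        * intro i. rewrite Nat.add_succ_r. apply Hb.
        * eapply Nat.le_trans; [apply Hc|]. apply (blocks_mono c y); auto; lia.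
        * intro; apply Hy. }
  destruct (@block_choice unit fn (fun k b _ x f _ => Z x /\ nrm x = 1 /\ K f /\ / 2 <= ap f x)) with (k0 := k0) (s0 := tt)
    as [c [u [f [_u [Hc [_ [Hb Hu]]]]]]].
  { intros k _. destruct (ts_tail Z HZ k) as [x [Hx [Hn Hk]]].
    destruct (normalize x (ts_fs Z HZ x Hx) Hn) as [a [f [Ha [Hf [H3 H4]]]]].
    destruct (fs_bk x k (ts_fs Z HZ x Hx) Hk) as [b [Hkb Hbk]].
    exists b, (vscal a x), f, tt. split; auto. split. apply bk_scal; auto. split; auto. apply HZ; auto. }
  (* [j] is even, and n_(j-1) >= M together with the growth of [nn] puts M^s below n_j. *)
  set (j := (2 * M)%nat). set (s := mm j).
  assert (Hns : (M ^ s <= nn j)%nat).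
  { apply INR_le. rewrite pow_INR. replace j with (S (2 * M - 1)) by (unfold j; lia).
    eapply Rle_trans; [|apply (nn_growth' (2 * M - 1) s)].
    - pose proof (mm_ge4R (S (2 * M - 1))). pose proof (nn_gt (2 * M - 1)).
      assert (INR M ^ s <= INR (nn (2 * M - 1)) ^ s) by (apply pow_incr; split; [lra|apply le_INR; lia]).
      assert (0 <= INR M ^ s) by (apply pow_le; lra). assert (1 <= INR (mm (S (2 * M - 1))) ^ 2) by nra. nra.
    - unfold s, j. replace (S (2 * M - 1)) with (2 * M)%nat by lia. lia. }
  assert (Hlow := lower_bound c u f j (M ^ s) Hb (fun k => conj (proj1 (proj2 (proj2 (Hu k)))) (proj2 (proj2 (proj2 (Hu k)))))).
  assert (Hup := H2 s c u Hb ltac:(lia) (fun k => conj (proj1 (Hu k)) (Req_le _ _ (proj1 (proj2 (Hu k)))))).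
  specialize (Hlow ltac:(unfold j; rewrite Nat.odd_mul; reflexivity) Hns).
  assert (Hc1 : INR M ^ s / (2 * INR (mm j)) <= INR M ^ s / 2 ^ s).
  { rewrite <- pow_INR. eapply Rle_trans; [exact Hlow|]. eapply Rle_trans; [exact Hup|]. right. unfold Rdiv.
    rewrite Rpow_mult_distr, pow_inv, pow_INR. reflexivity. }
  assert (HMs : 0 < INR M ^ s) by (apply pow_lt; lra).
  assert (H2s : 2 * INR (mm j) < 2 ^ s).
  { unfold s. replace 2 with (INR 2) by reflexivity. rewrite <- pow_INR, <- mult_INR. apply lt_INR.
    pose proof (mm_ge4 j) as H4. replace (mm j) with (S (mm j - 1)) at 2 by lia. rewrite Nat.pow_succ_r'.
    assert (mm j < 2 ^ (mm j - 1))%nat; [|lia].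
    clear - H4. induction H4 as [|m Hm IH]; [simpl; lia|]. replace (S m - 1)%nat with (S (m - 1)) by lia. rewrite Nat.pow_succ_r'. lia. }
  pose proof (mm_pos j).
  assert (INR M ^ s / 2 ^ s < INR M ^ s / (2 * INR (mm j))).
  { unfold Rdiv. apply Rmult_lt_compat_l; auto. apply Rinv_lt_contravar; auto. apply Rmult_lt_0_compat; [lra|]. lra. }
  lra.
Qed.

(** The average is scaled to the value 1 at an almost norming [f]. Since [f] reaches half of the
    norm, which is at least M/2, each of the M summands has norm at most 4/M. A functional of weight
    i has at most M components, so the boundary terms cost at most 4 beside the 4 of the sum
    itself. *)
Lemma average_vector Z k0 M : tailsub Z -> (1 <= M)%nat ->
  exists b x f, (k0 <= b)%nat /\ bk k0 b x /\ Z x /\ nrm x <= 4 /\ K f /\ (k0 <= lo f)%nat /\ (hi f <= b)%nat /\ ap f x = 1 /\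
    forall i a' b' l, K (Nd i a' b' l) -> (nn i <= M)%nat -> Rabs (ap (Nd i a' b' l) x) <= 8 / INR (mm i).
Proof.
  intros HZ HM.
  assert (HM0 : 1 <= INR M) by (replace 1 with (INR 1) by reflexivity; apply le_INR; auto).
  destruct (l1_average Z k0 M HZ HM) as [c [y [Hb [Hc [Hy HX]]]]].
  set (X := vsum M y) in *.
  assert (HZX : Z X) by (apply ts_vsum; auto; apply Hy).
  assert (HbX : bk (c 0%nat) (c M) X) by (apply bk_vsum; auto).
  destruct (nrm_near X (ts_fs Z HZ X HZX) ltac:(lra)) as [f [Hf HfX]].
  set (a := / ap f X).
  assert (Hap : 0 < Rabs (ap f X)) by lra.
  assert (Hne : ap f X <> 0). { intro E. rewrite E, Rabs_R0 in Hap. lra. }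
  assert (Ha : Rabs a <= 4 / INR M).
  { unfold a. rewrite Rabs_inv. apply Rmult_le_reg_l with (Rabs (ap f X)); auto. rewrite Rinv_r by lra.
    apply Rle_trans with (INR M / 4 * (4 / INR M)). right; field; lra.
    apply Rmult_le_compat_r; [|lra]. apply Rdiv_le_0_compat; lra. }
  assert (Hay : forall g k, K g -> Rabs (ap g (vscal a (y k))) <= 4 / INR M).
  { intros g k Hg. unfold vscal. rewrite ap_scal, Rabs_mult.
    assert (Rabs (ap g (y k)) <= 1). { eapply Rle_trans; [apply nrm_ub; auto|apply Hy]. apply (ts_fs Z HZ), Hy. }
    pose proof (Rabs_pos a). pose proof (Rabs_pos (ap g (y k))). nra. }
  assert (HcM : (c 0 <= c M)%nat) by (apply (blocks_mono c y); auto; lia).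
  assert (Hsum : forall g, ap g (vscal a X) = isum 0 M (fun k => ap g (vscal a (y k)))).
  { intro g. unfold X. rewrite <- vsum_scal, ap_vsum, isum_0n. reflexivity. }
  exists (c M), (vscal a X), (rs k0 (c M) f).
  split; [lia|]. split. { apply bk_scal. eapply bk_weaken; eauto. }
  split; [apply HZ; auto|]. split.
  { apply nrm_le. intros g Hg. rewrite Hsum. eapply Rle_trans; [apply (isum_abs_le 0 M _ (4 / INR M)); [lia|intros; auto]|].
    simpl (INR 0). right; field; lra. }
  split; [apply K_rs; auto|]. split; [destruct f; simpl; lia|]. split; [destruct f; simpl; lia|]. split.
  { rewrite ap_rs, restr_in by (apply bk_scal; eapply bk_weaken; eauto). unfold vscal. rewrite ap_scal. unfold a. apply Rinv_l; auto. }
  intros i a' b' l HK Hi. rewrite Hsum.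
  assert (H4 : 0 < 4 / INR M) by (apply Rdiv_lt_0_compat; lra).
  eapply Rle_trans; [apply (Nd_split c _ i a' b' l 0 (4 / INR M) M)|]; auto; try lra; try lia.
  - intro k; split; [exact (proj1 (Hb k))|apply bk_scal, Hb].
  - intros g p q Hg Hpq. rewrite Rplus_0_l. apply isum_abs_le; [lia|auto].
  - inversion HK as [|? ? ? ? HKl Hs Hl Hsp]; subst. simpl (INR 0).
    assert (INR (length l) <= INR M) by (apply le_INR; lia).
    unfold Rdiv at 3. rewrite (Rmult_comm 8). apply Rmult_le_compat_l. left; apply Rinv_0_lt_compat, mm_pos.
    apply Rle_trans with (INR M * (0 + 4 / INR M) + 4 / INR M * (INR M - 0)).
    apply Rplus_le_compat_r, Rmult_le_compat_r; lra. right; field; lra.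
Qed.

Definition ground_le (eta : R) (Z : (nat -> R) -> Prop) : Prop :=
  forall x a b p s, Z x -> Rabs (ap (Gr a b p s) x) <= eta * nrm x.

(** An average of length [nn J] satisfies [ris_low] below [J]; the next threshold is then taken
    large against its l_1 norm. The factor 4 of [eta] is the norm of an average. *)
Lemma ris_exists Z j eta k0 : tailsub Z -> ground_le eta Z -> 0 <= eta ->
  exists c x f J, c 0%nat = k0 /\ RIS j (4 * eta) c x J /\
    forall k, Z (x k) /\ K (f k) /\ (c k <= lo (f k))%nat /\ (hi (f k) <= c (S k))%nat /\ ap (f k) (x k) = 1.
Proof.
  intros HZ HG Heta.
  destruct (@block_choice nat fn (fun k b J x f J' => (J < J')%nat /\ Z x /\ nrm x <= 4 /\ K f /\ (k <= lo f)%nat /\ (hi f <= b)%nat /\ ap f x = 1 /\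
     (forall i a' b' l, K (Nd i a' b' l) -> (i < J)%nat -> Rabs (ap (Nd i a' b' l) x) <= 8 / INR (mm i)) /\
     INR (nn j) * l1n b x <= INR (mm J'))) with (k0 := k0) (s0 := j) as [c [x [f [J [Hc [HJ [Hb H]]]]]]].
  { intros k J. destruct (average_vector Z k (nn J) HZ (nn_ge1 J)) as [b [x [f [H1 [H2 [H3 [H4 [H5 [H6 [H7 [H8 H9]]]]]]]]]]].
    destruct (INR_unbounded (INR (nn j) * l1n b x)) as [r Hr].
    exists b, x, f, (S (Nat.max r J)). repeat match goal with |- _ /\ _ => split end; auto; try lia.
    - intros. apply H9; auto. apply nn_mono. lia.
    - left. eapply Rlt_le_trans; [apply Hr|]. apply le_INR. pose proof (mm_gt (S (Nat.max r J))). lia. }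
  exists c, x, f, J. split; auto. split.
  - constructor.
    + exact Hb.
    + intro k. apply Rle_trans with 4; [apply H|lra].
    + lia.
    + intro k. exact (proj1 (H k)).
    + intros k i a b l HK Hi. destruct (H k) as [_ [_ [_ [_ [_ [_ [_ [H9 _]]]]]]]]. auto.
    + intro k. destruct (H k) as [_ [_ [_ [_ [_ [_ [_ [_ H9]]]]]]]]. exact H9.
    + intros k a b p s. destruct (H k) as [_ [H1 [H2 _]]]. specialize (HG (x k) a b p s H1). nra.
  - intro k. destruct (H k) as [_ [H1 [H2 [H3 [H4 [H5 [H6 _]]]]]]]. auto.
Qed.

(** Nothing is asked of subspaces of [Z]: each vector of a special sequence may be taken from a [Z']
    of its own. *)
Definition ground_singular (Z : (nat -> R) -> Prop) : Prop :=
  forall eta, 0 < eta -> exists Z', tailsub Z' /\ (forall x, Z' x -> Z x) /\ ground_le eta Z'.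

Lemma weighted_vector Z i0 k0 eta : let p := S i0 in ground_singular Z -> 0 < eta -> Nat.odd p = false ->
  exists b y f, (k0 <= b)%nat /\ bk k0 b y /\ Z y /\ K f /\ wt f = Some p /\ (k0 <= lo f)%nat /\ (hi f <= b)%nat /\
    ap f y = 1 /\ nrm y <= 24 /\
    (forall i a b l, K (Nd i a b l) -> (i < p)%nat -> Rabs (ap (Nd i a b l) y) <= 24 / INR (mm i)) /\
    (forall i a b l, K (Nd i a b l) -> (p < i)%nat -> Rabs (ap (Nd i a b l) y) <= 24 / INR (mm p)) /\
    (forall a b q s, Rabs (ap (Gr a b q s) y) <= eta).
Proof.
  intros p HS Heta Hp. pose proof (nnR_ge1 p) as Hn1. pose proof (mm_ge4R p) as Hm4.
  (* The first bound is the hypothesis of [ris_vector]; the second offsets the factor m_p in its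
     estimate for chain functionals. *)
  set (e := Rmin (/ INR (nn p)) (eta / INR (mm p))).
  assert (He : 0 < e). { apply Rmin_glb_lt. apply Rinv_0_lt_compat; lra. apply Rdiv_lt_0_compat; lra. }
  destruct (HS (e / 4) ltac:(lra)) as [Z' [HZ' [Hsub HG]]].
  destruct (ris_exists Z' p (e / 4) k0 HZ' HG ltac:(lra)) as [c [x [f [J [Hc [HR Hx]]]]]].
  replace (4 * (e / 4)) with e in HR by field.
  destruct (ris_vector i0 e c x J HR (Rmin_l _ _)) as [H1 [H2 [H3 H4]]]. fold p in H1, H2, H3, H4.
  pose proof (ris_blocks _ _ _ _ _ HR) as Hb.
  set (y := vscal (INR (mm p) / INR (nn p)) (vsum (nn p) x)) in *.
  exists (c (nn p)), y, (Nd p k0 (c (nn p)) (hist f (nn p))).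
  assert (Hcn : (c 0 <= c (nn p))%nat) by (apply (blocks_mono c x); auto; lia).
  split; [lia|]. split. { apply bk_scal. rewrite <- Hc. apply bk_vsum; auto. }
  split. { apply Hsub. apply HZ'. apply ts_vsum; auto. apply Hx. }
  split. { constructor.
      - intros g Hg. apply in_map_iff in Hg. destruct Hg as [k [<- _]]. apply Hx.
      - apply (succ_hist c x); auto; apply Hx.
      - rewrite hist_length; auto.
      - congruence. }
  split; [reflexivity|]. split; [simpl; lia|]. split; [simpl; lia|]. split.
  { unfold y, vscal. rewrite ap_scal, (ap_hist c) by (auto; try lia; apply Hx).
    rewrite (bsum_ext _ _ (fun _ => 1)) by (intros; apply Hx). rewrite bsum_const. field. split; lra. }
  split; [exact H1|]. split; [exact H2|]. split; [exact H3|].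
  intros. eapply Rle_trans; [apply H4|]. apply Rle_trans with (INR (mm p) * (eta / INR (mm p))).
  apply Rmult_le_compat_l; [lra|apply Rmin_r]. right; field; lra.
Qed.

(** The state is the list of functionals so far. Its code is the next weight, which is even, so
    [weighted_vector] applies; the parity of its length selects the subspace. *)
Lemma ds_exists Z W j : ground_singular Z -> ground_singular W ->
  exists c y F, DS j c y F /\ forall k, if Nat.even k then Z (y k) else W (y k).
Proof.
  intros HZ HW.
  destruct (@block_choice (list fn) fn (fun k b s y f s' => s' = s ++ f :: nil /\
     (if Nat.even (length s) then Z y else W y) /\ K f /\ wt f = Some (code_wt j s) /\ (k <= lo f)%nat /\ (hi f <= b)%nat /\
    ap f y = 1 /\ nrm y <= 24 /\
    (forall i a b l, K (Nd i a b l) -> (i < code_wt j s)%nat -> Rabs (ap (Nd i a b l) y) <= 24 / INR (mm i)) /\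
    (forall i a b l, K (Nd i a b l) -> (code_wt j s < i)%nat -> Rabs (ap (Nd i a b l) y) <= 24 / INR (mm (code_wt j s))) /\
    (forall a b q s, Rabs (ap (Gr a b q s) y) <= / INR (nn j)))) with (k0 := 0%nat) (s0 := @nil fn)
    as [c [y [F [u [Hc [Hu0 [Hb H]]]]]]].
  { intros k s. set (V := if Nat.even (length s) then Z else W).
    assert (HV : ground_singular V) by (unfold V; destruct (Nat.even _); auto).
    assert (Hp : exists i0, code_wt j s = S i0). { exists (code_wt j s - 1)%nat. pose proof (code_wt_gt j s). lia. }
    destruct Hp as [i0 Hi0].
    destruct (weighted_vector V i0 k (/ INR (nn j)) HV) as [b [y [f Hy]]].
    { apply Rinv_0_lt_compat. pose proof (nnR_ge1 j); lra. }
    { rewrite <- Hi0. apply code_wt_even. }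
    rewrite <- Hi0 in Hy. destruct Hy as [H1 [H2 [H3 H4]]].
    exists b, y, f, (s ++ f :: nil). split; auto. split; auto. split; auto. split; auto.
    unfold V in H3. destruct (Nat.even (length s)); auto. }
  assert (Hu : forall k, u k = hist F k).
  { induction k as [|k IH]. exact Hu0. rewrite hist_S, <- IH. apply H. }
  exists c, y, F. split.
  - constructor; auto; try (intro k; destruct (H k) as [H1 [H2 [H3 [H4 [H5 [H6 [H7 [H8 [H9 [H10 H11]]]]]]]]]]; rewrite <- ?Hu; auto).
  - intro k. destruct (H k) as [_ [H2 _]]. rewrite Hu, hist_length in H2. exact H2.
Qed.

(** The even terms of a special sequence make up [u], the odd ones [v]. [ds_sum] and [ds_alt] give
    the quotient 49 / m_j, and [j] is odd with m_j above 49 / eps. *)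
Theorem block_HI Z W : tailsub Z -> tailsub W -> ground_singular Z -> ground_singular W ->
  forall eps, 0 < eps -> exists u v, Z u /\ W v /\ 0 < nrm (fun n => u n + v n) /\
    nrm (fun n => u n - v n) <= eps * nrm (fun n => u n + v n).
Proof.
  intros HZt HWt HZ HW eps Heps.
  destruct (INR_unbounded (49 / eps)) as [r Hr].
  set (i0 := (2 * r)%nat). set (j := S i0).
  assert (Hodd : Nat.odd j = true). { unfold j, i0. rewrite Nat.odd_succ, Nat.even_mul. reflexivity. }
  destruct (ds_exists Z W j HZ HW) as [c [y [F [HD HZW]]]].
  pose proof (ds_alt i0 c y F HD Hodd) as H1. pose proof (ds_sum j c y F HD) as H2. fold j in H1.
  pose proof (mm_ge4R j) as Hm4. pose proof (nnR_ge1 j) as Hn1.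
  set (u := vsum (nn j) (fun k => if Nat.even k then y k else fun _ => 0)).
  set (v := vsum (nn j) (fun k => if Nat.even k then fun _ => 0 else y k)).
  assert (Hz : forall V, tailsub V -> V (fun _ => 0)).
  { intros V HV. exact (ts_vsum V 0 (fun _ _ => 0) HV ltac:(intro; destruct (ts_tail V HV 0) as [x [Hx _]]; replace (fun _ : nat => 0) with (vscal 0 x); [apply HV; auto|apply functional_extensionality; intro; unfold vscal; ring])). }
  pose proof (Hz Z HZt) as HZ0. pose proof (Hz W HWt) as HW0. exists u, v.
  assert (Eu : (fun n => u n + v n) = vsum (nn j) y).
  { apply functional_extensionality; intro t. unfold u, v, vsum. rewrite <- bsum_plus. apply bsum_ext.
    intros k _. destruct (Nat.even k); ring. }
  assert (Ev : (fun n => u n - v n) = vsum (nn j) (fun k => vscal (alt k) (y k))).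
  { apply functional_extensionality; intro t. unfold u, v, vsum, vscal, Rminus.
    rewrite <- (Rmult_1_l (bsum _ (fun k => (if Nat.even k then fun _ => 0 else y k) t))), Ropp_mult_distr_l, <- bsum_scal, <- bsum_plus. apply bsum_ext.
    intros k _. unfold alt. destruct (Nat.even k); ring. }
  rewrite Eu, Ev.
  split. { apply ts_vsum; auto. intro k. specialize (HZW k). destruct (Nat.even k); auto. }
  split. { apply ts_vsum; auto. intro k. specialize (HZW k). destruct (Nat.even k); auto. }
  assert (Hq : 0 < INR (nn j) / INR (mm j)) by (apply Rdiv_lt_0_compat; lra).
  split; [lra|].
  eapply Rle_trans; [exact H1|]. apply Rle_trans with (eps * (INR (nn j) / INR (mm j))).
  2:{ apply Rmult_le_compat_l; lra. }
  replace (49 * (INR (nn j) / INR (mm j) / INR (mm j))) with (49 / INR (mm j) * (INR (nn j) / INR (mm j))) by (field; lra).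
  apply Rmult_le_compat_r; [lra|]. apply div_le; [lra|].
  assert (INR r <= INR (mm j)). { apply le_INR. pose proof (mm_gt j). unfold j, i0 in *. lia. }
  apply Rmult_lt_compat_r with (r := eps) in Hr; auto. unfold Rdiv in Hr. rewrite Rmult_assoc, Rinv_l in Hr by lra. nra.
Qed.

(** * Chain functionals on well-founded trees *)

Definition bspan (x : nat -> nat -> R) (z : nat -> R) : Prop :=
  exists n (a : nat -> R), z = vsum n (fun k => vscal (a k) (x k)).

Lemma vsum_extend n m a x : (n <= m)%nat ->
  vsum n (fun k => vscal (a k) (x k)) = vsum m (fun k => vscal (if (k <? n)%nat then a k else 0) (x k)).
Proof.
  intro H. apply functional_extensionality; intro t. unfold vsum, vscal. rewrite (bsum_tail n m); auto.
  - apply bsum_ext. intros k Hk. destruct (Nat.ltb_spec k n); [reflexivity|lia].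
  - intros k Hk. destruct (Nat.ltb_spec k n); [lia|ring].
Qed.

Lemma blocks_scal c x a : blocks c x -> blocks c (fun k => vscal (a k) (x k)).
Proof. intros H k. split; [exact (proj1 (H k))|]. apply bk_scal, H. Qed.

(** The projection onto block [k] is a contraction, and [x k] is normalized. *)
Lemma bspan_coef c x n a k : blocks c x -> (forall k, nrm (x k) = 1) -> (k < n)%nat ->
  Rabs (a k) <= nrm (vsum n (fun k => vscal (a k) (x k))).
Proof.
  intros Hb Hn Hk. set (z := vsum n (fun k => vscal (a k) (x k))).
  assert (Hz : fs z) by (eapply bk_fs, bk_vsum; apply (blocks_scal c); auto).
  assert (E : restr (c k) (c (S k)) z = vscal (a k) (x k)).
  { apply functional_extensionality; intro t. unfold restr.
    destruct (Nat.leb_spec (c k) t), (Nat.ltb_spec t (c (S k))); simpl;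
      try (unfold vscal; rewrite (bk_out _ _ _ _ (proj2 (Hb k))) by lia; ring).
    unfold z, vsum. apply (bsum_single n k (fun k => vscal (a k) (x k) t)); auto.
    intros i Hi Hik. unfold vscal. rewrite (bk_out _ _ _ _ (proj2 (Hb i))). ring.
    destruct (lt_dec i k) as [Hl|Hl].
    - assert (c (S i) <= c k)%nat by (apply (blocks_mono c x); auto). lia.
    - assert (c (S k) <= c i)%nat by (apply (blocks_mono c x); auto; lia). lia. }
  rewrite <- (Rmult_1_r (Rabs (a k))), <- (Hn k), <- (nrm_scal (a k) (x k)) by (eapply bk_fs, Hb).
  fold (vscal (a k) (x k)). rewrite <- E. apply nrm_restr; auto.
Qed.

Lemma nrm1_nonzero x : nrm x = 1 -> exists n, x n <> 0.
Proof.
  intro H. apply NNPP. intro Hno. replace x with (fun _ : nat => 0) in H. rewrite nrm_0 in H; lra.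
  apply functional_extensionality; intro t. destruct (Req_dec (x t) 0) as [E|E]; auto. exfalso; eauto.
Qed.

Lemma blocks_ge c x k : blocks c x -> (forall k, nrm (x k) = 1) -> (k <= c k)%nat.
Proof.
  intros Hb Hn. induction k as [|k IH]; [lia|].
  destruct (nrm1_nonzero _ (Hn k)) as [t Ht]. apply (proj2 (Hb k)) in Ht. lia.
Qed.

Lemma bspan_tailsub c x : blocks c x -> (forall k, nrm (x k) = 1) -> tailsub (bspan x).
Proof.
  intros Hb Hn. constructor.
  - intros z [n [a ->]]. eapply bk_fs, bk_vsum. apply (blocks_scal c); auto.
  - intros z w [n [a ->]] [m [b ->]]. exists (Nat.max n m).
    eexists. rewrite (vsum_extend n (Nat.max n m)), (vsum_extend m (Nat.max n m)) by lia.
    apply functional_extensionality; intro t. unfold vsum. rewrite <- bsum_plus. apply bsum_ext.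
    intros k Hk. unfold vscal. rewrite <- Rmult_plus_distr_r.
    instantiate (1 := fun k => (if (k <? n)%nat then a k else 0) + (if (k <? m)%nat then b k else 0)). reflexivity.
  - intros e z [n [a ->]]. exists n, (fun k => e * a k). rewrite <- vsum_scal.
    apply functional_extensionality; intro t. unfold vsum, vscal. apply bsum_ext. intros; ring.
  - intro k. exists (x k). split; [|split].
    + exists (S k), (fun i => if (i =? k)%nat then 1 else 0). apply functional_extensionality; intro t.
      unfold vsum, vscal. rewrite (bsum_single (S k) k); [rewrite Nat.eqb_refl; ring|lia|].
      intros i Hi Hik. destruct (Nat.eqb_spec i k); [contradiction|ring].
    + apply nrm1_nonzero; auto.
    + intros i Hi. apply (bk_out _ _ _ _ (proj2 (Hb k))). pose proof (blocks_ge c x k Hb Hn). lia.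
Qed.

Lemma bspan_sub Z x : tailsub Z -> (forall k, Z (x k)) -> forall z, bspan x z -> Z z.
Proof. intros HZ H z [n [a ->]]. apply ts_vsum; auto. intro k. apply HZ; auto. Qed.

Lemma geom_half n : bsum n (fun k => / 2 ^ S k) = 1 - / 2 ^ n.
Proof.
  induction n as [|n IH]; [simpl; field|]. change (bsum n (fun k => / 2 ^ S k) + / 2 ^ S n = 1 - / 2 ^ S n). rewrite IH. simpl. field. apply pow_nonzero; lra.
Qed.

Lemma geom_half_le n e : 0 <= e -> bsum n (fun k => e * / 2 ^ S k) <= e.
Proof.
  intro He. rewrite (bsum_scal n e (fun k => / 2 ^ S k)), geom_half. assert (0 < / 2 ^ n) by (apply Rinv_0_lt_compat, pow_lt; lra). nra.
Qed.

(** Normalized blocks are picked on which [G] is at most eta / 2^(i+1). Coefficients are bounded by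
    the norm of the combination, so the errors add up to [eta]. *)
Lemma small_subspace (G : fn -> Prop) Z : tailsub Z ->
  (forall k eps, 0 < eps -> exists x, Z x /\ (exists n, x n <> 0) /\ (forall n, (n < k)%nat -> x n = 0) /\
     forall g, G g -> Rabs (ap g x) <= eps * nrm x) ->
  forall eta, 0 < eta -> exists Z', tailsub Z' /\ (forall x, Z' x -> Z x) /\
    forall x g, Z' x -> G g -> Rabs (ap g x) <= eta * nrm x.
Proof.
  intros HZ H eta Heta.
  destruct (@block_choice nat unit (fun k b i x _ i' => i' = S i /\ Z x /\ nrm x = 1 /\ forall g, G g -> Rabs (ap g x) <= eta * / 2 ^ S i))
    with (k0 := 0%nat) (s0 := 0%nat) as [c [x [_t [u [Hc [Hu0 [Hb Hx]]]]]]].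
  { intros k i. assert (He : 0 < eta * / 2 ^ S i) by (apply Rmult_lt_0_compat; auto; apply Rinv_0_lt_compat, pow_lt; lra).
    destruct (H k _ He) as [x [Hx [Hn [Hk HG]]]].
    destruct (normalize x (ts_fs Z HZ x Hx) Hn) as [a [f [Ha [Hf [H3 H4]]]]].
    destruct (fs_bk x k (ts_fs Z HZ x Hx) Hk) as [b [Hkb Hbk]].
    exists b, (vscal a x), tt, (S i). split; auto. split. apply bk_scal; auto. split; auto. split. apply HZ; auto. split; auto.
    intros g Hg. unfold vscal. rewrite ap_scal, Rabs_mult. specialize (HG g Hg).
    assert (Hax : Rabs a * nrm x = 1). { rewrite <- H3. unfold vscal. rewrite nrm_scal; auto. apply (ts_fs Z HZ); auto. }
    pose proof (Rabs_pos a). apply Rle_trans with (Rabs a * (eta * / 2 ^ S i * nrm x)). nra. rewrite <- (Rmult_1_r (eta * / 2 ^ S i)) at 2. rewrite <- Hax. right; ring. }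
  assert (Hu : forall k, u k = k). { induction k as [|k IH]; auto. rewrite (proj1 (Hx k)). congruence. }
  assert (Hn : forall k, nrm (x k) = 1) by (intro; apply Hx).
  exists (bspan x). split; [|split].
  - apply (bspan_tailsub c); auto.
  - apply bspan_sub; auto. intro; apply Hx.
  - intros z g [n [a ->]] Hg.
    set (z := vsum n (fun k => vscal (a k) (x k))). unfold z at 1. rewrite ap_vsum.
    eapply Rle_trans; [apply bsum_abs|]. apply Rle_trans with (bsum n (fun k => (eta * nrm z) * / 2 ^ S k)).
    + apply bsum_le. intros k Hk. unfold vscal. rewrite ap_scal, Rabs_mult.
      pose proof (bspan_coef c x n a k Hb Hn Hk) as H1. fold z in H1.
      destruct (Hx k) as [_ [_ [_ H2]]]. specialize (H2 g Hg). rewrite Hu in H2.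
      apply Rle_trans with (nrm z * (eta * / 2 ^ S k)). apply Rmult_le_compat; auto using Rabs_pos. right; ring.
    + apply geom_half_le. apply Rmult_le_pos; [lra|]. apply nrm_ge0. eapply bk_fs, bk_vsum. apply (blocks_scal c); auto.
Qed.

Lemma ts_inter Z k : tailsub Z -> tailsub (fun x => Z x /\ forall n, (n < k)%nat -> x n = 0).
Proof.
  intro HZ. constructor.
  - intros x [Hx _]. apply (ts_fs Z HZ); auto.
  - intros x y [Hx Hx'] [Hy Hy']. split. apply HZ; auto. intros n Hn. rewrite Hx', Hy' by auto. ring.
  - intros a x [Hx Hx']. split. apply HZ; auto. intros n Hn. unfold vscal. rewrite Hx' by auto. ring.
  - intro r. destruct (ts_tail Z HZ (Nat.max k r)) as [x [Hx [Hn H0]]]. exists x. repeat split; auto; intros; apply H0; lia.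
Qed.

Definition supported (theta : TrSpace) (Z : (nat -> R) -> Prop) : Prop :=
  forall x n, Z x -> x n <> 0 -> theta (node n) = true.

(* On Z the norm is dominated by chains lying strictly below the node s. *)
Definition dominated (s : nat) (Z : (nat -> R) -> Prop) (eps : R) : Prop :=
  forall x, Z x -> exists a b p e, pre s p = true /\ (s < a)%nat /\ eps * nrm x <= Rabs (ap (Gr a b p e) x).

Lemma least (P : nat -> Prop) : (exists n, P n) -> exists n, P n /\ forall k, (k < n)%nat -> ~ P k.
Proof.
  intros [n Hn]. revert Hn. induction n as [n IH] using lt_wf_ind. intro Hn.
  destruct (classic (exists k, (k < n)%nat /\ P k)) as [[k [Hk HP]]|Hno].
  - apply (IH k); auto.
  - exists n. split; auto. intros k Hk HP. apply Hno; eauto.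
Qed.

(** If domination passed to no node, the chains below any given node of [theta] under [s] could be
    made small on a further subspace. Take blocks on which the chains below earlier nodes are at
    most 1/n. A chain that first acts at a node [t] of some block runs below [t] on all later
    blocks, so it is at most 2 on the sum of n blocks. An even weight makes the norm of that sum too
    large for this. *)
Lemma dominated_step theta Z s eps : tailsub Z -> supported theta Z -> 0 < eps -> dominated s Z eps ->
  exists s' Z' eps', pre s s' = true /\ (s < s')%nat /\ theta (node s') = true /\
    tailsub Z' /\ supported theta Z' /\ 0 < eps' /\ dominated s' Z' eps'.
Proof.
  intros HZ Hsup Heps Hdom. apply NNPP. intro Hno.
  set (good := fun s' => pre s s' = true /\ (s < s')%nat /\ theta (node s') = true).
  set (G := fun s' g => exists a b p e, g = Gr a b p e /\ pre s' p = true /\ (s' < a)%nat).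
  assert (HA : forall s' Z1 eta, good s' -> tailsub Z1 -> (forall x, Z1 x -> Z x) -> 0 < eta ->
    exists Z2, tailsub Z2 /\ (forall x, Z2 x -> Z1 x) /\ forall x g, Z2 x -> G s' g -> Rabs (ap g x) <= eta * nrm x).
  { intros s' Z1 eta Hs' HZ1 Hsub Heta. apply small_subspace; auto. intros k e He.
    set (Z1k := fun x : nat -> R => Z1 x /\ forall n, (n < k)%nat -> x n = 0).
    assert (Hnd : ~ dominated s' Z1k e).
    { intro Hd. apply Hno. exists s', Z1k, e. unfold good in Hs'. repeat match goal with |- _ /\ _ => split end; try tauto.
      apply ts_inter; auto. intros x n [Hx _]. apply Hsup; auto. }
    apply not_all_ex_not in Hnd. destruct Hnd as [x Hx]. apply imply_to_and in Hx. destruct Hx as [[Hx1 Hx2] Hx].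
    assert (Hlt : forall g, G s' g -> Rabs (ap g x) < e * nrm x).
    { intros g [a [b [p [f [-> [Hp Ha]]]]]]. apply Rnot_le_lt. intro Hle. apply Hx. exists a, b, p, f. auto. }
    exists x. split; auto. split; [|split; auto].
    (* For [x = 0] the strict bound at a functional with empty interval would read 0 < 0. *)
    - apply NNPP. intro Hz. assert (E : x = (fun _ => 0)).
      { apply functional_extensionality; intro t. apply NNPP; intro Ht. apply Hz; eauto. }
      assert (H := Hlt (Gr (S s') 0 s' nil)). rewrite E, nrm_0, ap_0, Rabs_R0 in H.
      assert (0 < e * 0); [|lra]. apply H. exists (S s'), 0%nat, s', nil. split; auto. split; [apply pre_refl|lia].
    - intros g Hg. left; auto. }
  (* Smallness is inherited by subspaces, so finitely many nodes can be treated one after the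
     other. *)
  assert (HB : forall (l : list nat) eta, 0 < eta -> exists Z2, tailsub Z2 /\ (forall x, Z2 x -> Z x) /\
     forall s' x g, In s' l -> good s' -> Z2 x -> G s' g -> Rabs (ap g x) <= eta * nrm x).
  { intros l eta Heta. induction l as [|s' l IH].
    - exists Z. split; [exact HZ|]. split; [auto|]. simpl; tauto.
    - destruct IH as [Z2 [H1 [H2 H3]]]. destruct (classic (good s')) as [Hg|Hg].
      + destruct (HA s' Z2 eta Hg H1 H2 Heta) as [Z3 [H4 [H5 H6]]]. exists Z3. split; auto. split; auto.
        intros t x g [<-|Hin] Ht Hx Hg'; auto. apply (H3 t); auto.
      + exists Z2. split; auto. split; auto. intros t x g [<-|Hin] Ht Hx Hg'; [tauto|]. apply (H3 t); auto. }
  (* Domination gives eps m_j / 2 <= 2, which m_j > 4 / eps refutes. *)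
  destruct (INR_unbounded (4 / eps)) as [r Hr].
  set (i0 := (2 * r + 1)%nat). set (j := S i0). set (n := nn j).
  assert (Hev : Nat.odd j = false). { unfold j, i0. rewrite Nat.odd_succ, Nat.add_1_r, Nat.even_succ, Nat.odd_mul. reflexivity. }
  pose proof (nnR_ge1 j) as Hn1. pose proof (mm_ge4R j) as Hm4. fold n in Hn1.
  assert (Hni : 0 < / INR n) by (apply Rinv_0_lt_compat; lra).
  destruct (@block_choice unit fn (fun k b _ x f _ => Z x /\ nrm x = 1 /\ K f /\ / 2 <= ap f x /\
     forall s' g, (s' < k)%nat -> good s' -> G s' g -> Rabs (ap g x) <= / INR n)) with (k0 := 0%nat) (s0 := tt)
    as [c [u [f [_u [Hc [_ [Hb Hu]]]]]]].
  { intros k _. destruct (HB (seq 0 k) (/ INR n) Hni) as [Z2 [H1 [H2 H3]]].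
    destruct (ts_tail Z2 H1 k) as [x [Hx [Hxn Hk]]].
    destruct (normalize x (ts_fs Z2 H1 x Hx) Hxn) as [a [f [Ha [Hf [H4 H5]]]]].
    destruct (fs_bk x k (ts_fs Z2 H1 x Hx) Hk) as [b [Hkb Hbk]].
    exists b, (vscal a x), f, tt. split; auto. split. apply bk_scal; auto.
    assert (HZ2 : Z2 (vscal a x)) by (apply H1; auto).
    split; auto. repeat split; auto. intros s' g Hs' Hg HGg.
    rewrite <- (Rmult_1_r (/ INR n)), <- H4. apply (H3 s'); auto. apply in_seq; lia. }
  assert (Hlow := lower_bound c u f j n Hb (fun k => conj (proj1 (proj2 (proj2 (Hu k)))) (proj1 (proj2 (proj2 (proj2 (Hu k)))))) Hev (Nat.le_refl _)).
  set (x := vsum n u) in *.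
  assert (HZx : Z x) by (apply ts_vsum; auto; intro; apply Hu).
  destruct (Hdom x HZx) as [a [b [p [e [Hp [Ha Hge]]]]]].
  assert (Hup : Rabs (ap (Gr a b p e) x) <= 2).
  { unfold x. rewrite ap_vsum, <- isum_0n.
    assert (Hk0 : exists k0, forall k, k <> k0 -> Rabs (ap (Gr a b p e) (u k)) <= / INR n).
    { destruct (classic (exists k, ap (Gr a b p e) (u k) <> 0)) as [Hex|Hnex].
      - destruct (least _ Hex) as [i [Hi Hmin]]. exists i. intros k Hk.
        destruct (lt_dec k i) as [Hki|Hki].
        + specialize (Hmin k Hki). apply NNPP in Hmin. rewrite Hmin, Rabs_R0. lra.
        + assert (exists t, gc p e t * restr a b (u i) t <> 0) as [t Ht].
          { apply NNPP. intro Hn. apply Hi. simpl ap. apply (bsum_0 (S p) (fun n => gc p e n * restr a b (u i) n)). intros t _. apply NNPP. intro. apply Hn; eauto. }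
          unfold gc, restr in Ht. destruct (pre t p) eqn:Hpt; [|exfalso; apply Ht; ring].
          destruct (Nat.leb_spec a t) as [Hat|Hat]; [|exfalso; apply Ht; simpl; ring].
          destruct (Nat.ltb_spec t b) as [Htb|Htb]; [|exfalso; apply Ht; simpl; ring]. simpl in Ht.
          assert (Hut : u i t <> 0) by (intro E; apply Ht; rewrite E; ring).
          pose proof (proj2 (Hb i) t Hut) as Hct.
          assert (c (S i) <= c k)%nat by (apply (blocks_mono c u); auto; lia).
          assert (Hgood : good t). { split; [|split]. apply (pre_chain s t p); auto; lia. lia. apply (Hsup (u i)); auto. apply Hu. }
          destruct (Hu k) as [_ [_ [_ [_ H5]]]].
          rewrite <- (restr_in (S t) (c (S k)) (u k)) by (eapply bk_weaken; [apply Hb|lia|lia]).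
          rewrite <- ap_rs. simpl rs. apply (H5 t); auto. lia.
          exists (Nat.max (S t) a), (Nat.min (c (S k)) b), p, e. split; auto. split; auto. lia.
      - exists 0%nat. intros k _. replace (ap (Gr a b p e) (u k)) with 0. rewrite Rabs_R0; lra.
        symmetry. apply NNPP. intro. apply Hnex; eauto. }
    destruct Hk0 as [k0 Hk0].
    eapply Rle_trans; [apply (isum_one_bad 0 n _ (/ INR n) 1 k0); auto; try lra; try lia|].
    - intros k Hk. destruct (Hu k) as [H1 [H2 _]]. rewrite <- H2. apply nrm_ub. eapply bk_fs, Hb. constructor.
    - simpl (INR 0). rewrite Rminus_0_r, Rinv_l by lra. lra. }
  assert (Hbig := proj2 (proj2 (proj2 (nn_big i0)))). cbv zeta in Hbig. fold j in Hbig. fold n in Hbig.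
  assert (H2 : INR (mm j) / 2 <= INR n / (2 * INR (mm j))).
  { apply le_div; [lra|]. apply (Rle_div_r 1 _ _) in Hbig; [|lra]. apply (Rle_div_r (1 * INR (mm j)) _ _) in Hbig; lra. }
  assert (INR r <= INR (mm j)). { apply le_INR. pose proof (mm_gt j). unfold j, i0 in *. lia. }
  apply Rmult_lt_compat_r with (r := eps) in Hr; auto. unfold Rdiv in Hr. rewrite Rmult_assoc, Rinv_l in Hr by lra.
  assert (INR (mm j) / 2 * eps <= 2) by nra. nra.
Qed.

(** Each step properly extends the node, so entry [i] is settled from [s (S i)] on and the branch
    reads it there. *)
Lemma node_chain_ill_founded theta (s : nat -> nat) : is_tree theta ->
  (forall n, pre (s n) (s (S n)) = true /\ (s n < s (S n))%nat /\ theta (node (s (S n))) = true) -> ill_founded theta.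
Proof.
  intros Ht Hs.
  assert (Hlen : forall n, (n <= length (node (s n)))%nat).
  { induction n as [|n IH]; [lia|]. destruct (Hs n) as [H1 [H2 _]]. apply pre_iff in H1. destruct H1 as [u Hu].
    rewrite Hu, length_app. destruct u as [|x u]; [|simpl; lia]. rewrite app_nil_r in Hu.
    assert (s n = s (S n)) by (rewrite <- (idx_node (s n)), <- (idx_node (s (S n))), Hu; reflexivity). lia. }
  assert (Hpre : forall n m, (n <= m)%nat -> pre (s n) (s m) = true).
  { intros n m H. induction H as [|m H IH]. apply pre_refl. eapply pre_trans; [exact IH|apply Hs]. }
  exists (fun i => nth i (node (s (S i))) 0%nat). intro n.
  assert (Hth : theta (firstn n (node (s (S n)))) = true).
  { apply (Ht _ (skipn n (node (s (S n))))). rewrite firstn_skipn. apply Hs. }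
  replace (map _ (seq 0 n)) with (firstn n (node (s (S n)))); auto.
  assert (Hl : length (firstn n (node (s (S n)))) = n).
  { rewrite length_firstn. pose proof (Hlen (S n)). lia. }
  apply (nth_ext _ _ 0%nat (nth 0 (node (s 1%nat)) 0%nat)).
  - rewrite Hl, length_map, length_seq. reflexivity.
  - rewrite Hl. intros i Hi.
    rewrite (nth_map_seq (fun i => nth i (node (s (S i))) 0%nat)), nth_firstn by auto. destruct (Nat.ltb_spec i n); [|lia].
    assert (H1 := Hpre (S i) (S n) ltac:(lia)). apply pre_iff in H1. destruct H1 as [u ->].
    apply app_nth1. pose proof (Hlen (S i)). lia.
Qed.

(** Otherwise chain functionals dominate the norm on some tail. Dropping coordinate 0 puts them
    strictly below the root, and iterating [dominated_step] produces an infinite branch. *)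
Theorem well_founded_singular theta Z : is_tree theta -> well_founded_tree theta ->
  tailsub Z -> supported theta Z -> ground_singular Z.
Proof.
  intros Ht Hwf HZ Hsup eta Heta.
  destruct (classic (forall k eps, 0 < eps -> exists x, Z x /\ (exists n, x n <> 0) /\ (forall n, (n < k)%nat -> x n = 0) /\
     forall g, wt g = None -> Rabs (ap g x) <= eps * nrm x)) as [H|H].
  - destruct (small_subspace (fun g => wt g = None) Z HZ H eta Heta) as [Z' [H1 [H2 H3]]].
    exists Z'. split; auto. split; auto. intros x a b p s Hx. apply H3; auto.
  - exfalso. apply not_all_ex_not in H. destruct H as [k H]. apply not_all_ex_not in H. destruct H as [eps H].
    apply imply_to_and in H. destruct H as [Heps H].
    set (Z0 := fun x : nat -> R => Z x /\ forall n, (n < Nat.max 1 k)%nat -> x n = 0).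
    assert (HZ0 : tailsub Z0) by (apply ts_inter; auto).
    assert (HD : dominated 0 Z0 eps).
    { intros x [Hx Hx0]. destruct (classic (exists n, x n <> 0)) as [Hn|Hn].
      - apply NNPP. intro Hno. apply H. exists x. split; auto. split; auto. split; [intros; apply Hx0; lia|].
        intros g Hg. destruct g as [a b p s|]; [|discriminate]. apply Rnot_lt_le. intro Hlt. apply Hno.
        destruct (ts_fs Z HZ x Hx) as [N HN].
        exists (Nat.max 1 a), (Nat.min N b), p, s. split; [apply pre_root|]. split; [lia|].
        change (Gr (Nat.max 1 a) (Nat.min N b) p s) with (rs 1 N (Gr a b p s)). rewrite ap_rs, restr_in; [lra|].
        intros n Hxn. specialize (HN n Hxn). split; [|lia]. destruct n; [|lia]. exfalso; apply Hxn, Hx0; lia.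
      - assert (E : x = (fun _ => 0)). { apply functional_extensionality; intro t. apply NNPP; intro. apply Hn; eauto. }
        exists 1%nat, 1%nat, 0%nat, nil. split; [apply pre_root|]. split; [lia|]. rewrite E, nrm_0, Rmult_0_r. apply Rabs_pos. }
    apply Hwf.
    destruct (dep_choice (fun q : nat * (((nat -> R) -> Prop) * R) =>
        tailsub (fst (snd q)) /\ supported theta (fst (snd q)) /\ 0 < snd (snd q) /\ dominated (fst q) (fst (snd q)) (snd (snd q)))
      (fun q q' => pre (fst q) (fst q') = true /\ (fst q < fst q')%nat /\ theta (node (fst q')) = true))
      with (a0 := (0%nat, (Z0, eps))) as [u [Hu0 [Hu1 Hu2]]].
    { intros [s [Z1 e]] [H1 [H2 [H3 H4]]]. simpl in *.
      destruct (dominated_step theta Z1 s e H1 H2 H3 H4) as [s' [Z' [e' [G1 [G2 [G3 [G4 [G5 [G6 G7]]]]]]]]].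
      exists (s', (Z', e')). simpl. auto 10. }
    { simpl. split; auto. split; auto. intros x n [Hx _]. apply Hsup; auto. }
    apply (node_chain_ill_founded theta (fun n => fst (u n))); auto.
Qed.

(** * Continuous functions on the Cantor space *)

(** Compactness by bisection: a function unbounded on a cylinder is unbounded on one of its halves,
    and continuity fails at the limit point. *)
Lemma cont_bounded f : cont f -> exists B, forall t, Rabs (f t) <= B.
Proof.
  intro Hf. apply NNPP. intro Hno.
  destruct (dep_choice (fun q : nat * Cantor => forall B, exists y, agree_upto (fst q) (snd q) y /\ B < Rabs (f y))
    (fun q q' => fst q' = S (fst q) /\ agree_upto (fst q) (snd q) (snd q'))) with (a0 := (0%nat, fun _ : nat => false)) as [u [Hu0 [Hu1 Hu2]]].
  { intros [n x] HP. simpl in *.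
    set (xb := fun b : bool => fun i => if (i <? n)%nat then x i else b).
    assert (Hx : exists b, forall B, exists y, agree_upto (S n) (xb b) y /\ B < Rabs (f y)).
    { apply NNPP. intro Hb.
      assert (H1 : forall b, exists B, forall y, agree_upto (S n) (xb b) y -> Rabs (f y) <= B).
      { intro b. apply NNPP. intro H. apply Hb. exists b. intro B. apply NNPP. intro H'. apply H. exists B. intros y Hy.
        apply Rnot_lt_le. intro. apply H'. eauto. }
      destruct (H1 true) as [B1 HB1], (H1 false) as [B2 HB2]. destruct (HP (Rmax B1 B2)) as [y [Hy Hlt]].
      assert (Hag : agree_upto (S n) (xb (y n)) y).
      { intros i Hi. unfold xb. destruct (Nat.ltb_spec i n). apply Hy; auto. replace i with n by lia. reflexivity. }
      pose proof (Rmax_l B1 B2). pose proof (Rmax_r B1 B2).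
      destruct (y n); [specialize (HB1 y Hag)|specialize (HB2 y Hag)]; lra. }
    destruct Hx as [b Hb]. exists (S n, xb b). simpl. split; auto. split; auto.
    intros i Hi. unfold xb. destruct (Nat.ltb_spec i n); [reflexivity|lia]. }
  { simpl. intro B. apply NNPP. intro H. apply Hno. exists B. intro t. apply Rnot_lt_le. intro Hlt. apply H. exists t.
    split; auto. intros i Hi; lia. }
  assert (Hfst : forall n, fst (u n) = n). { induction n as [|n IH]; [rewrite Hu0; reflexivity|]. rewrite (proj1 (Hu2 n)), IH; reflexivity. }
  set (z := fun i => snd (u (S i)) i).
  assert (Hag : forall n m, (n <= m)%nat -> agree_upto n (snd (u n)) (snd (u m))).
  { intros n m H. induction H as [|m H IH]; intros i Hi; auto. rewrite IH by auto.
    destruct (Hu2 m) as [_ H2]. rewrite Hfst in H2. apply H2. lia. }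
  destruct (Hf z 1 ltac:(lra)) as [n Hn].
  destruct (Hu1 n (Rabs (f z) + 1)) as [y [Hy Hlt]]. rewrite Hfst in Hy.
  assert (H1 : Rabs (f y - f z) < 1).
  { apply Hn. intros i Hi. unfold z. rewrite (Hag (S i) n) by lia. apply Hy; auto. }
  pose proof (Rabs_triang (f y - f z) (f z)). replace (f y - f z + f z) with (f y) in H by ring. lra.
Qed.

Definition nb (f : Cantor -> R) (c : R) : Prop := forall t, Rabs (f t) <= c.

Lemma supnorm_nb f : cont f -> nb f (supnorm f).
Proof.
  intros Hf t. destruct (cont_bounded f Hf) as [B HB].
  refine (proj1 (real_lub (fun r => exists t, r = Rabs (f t)) B (Rabs (f t)) _ _) _ _); eauto.
  intros r [s ->]; auto.
Qed.

Lemma nb_supnorm f c : nb f c -> supnorm f <= c.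
Proof.
  intro H. refine (proj2 (real_lub (fun r => exists t, r = Rabs (f t)) c (Rabs (f (fun _ => false))) _ _) _ _); eauto.
  - intros r [s ->]; auto.
  - intros r [s ->]; auto.
Qed.

Lemma cont_plus f g : cont f -> cont g -> cont (fun t => f t + g t).
Proof.
  intros Hf Hg x e He. destruct (Hf x (e / 2) ltac:(lra)) as [n Hn], (Hg x (e / 2) ltac:(lra)) as [m Hm].
  exists (Nat.max n m). intros y Hy.
  specialize (Hn y (fun i Hi => Hy i ltac:(lia))). specialize (Hm y (fun i Hi => Hy i ltac:(lia))).
  replace (f y + g y - (f x + g x)) with ((f y - f x) + (g y - g x)) by ring.
  eapply Rle_lt_trans; [apply Rabs_triang|]. lra.
Qed.

Lemma cont_const c : cont (fun _ => c).
Proof. intros x e He. exists 0%nat. intros. rewrite Rminus_diag, Rabs_R0. auto. Qed.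

Lemma cont_scal a f : cont f -> cont (fun t => a * f t).
Proof.
  intros Hf x e He. pose proof (Rabs_pos a). destruct (Hf x (e / (Rabs a + 1))) as [n Hn]. apply Rdiv_lt_0_compat; lra.
  exists n. intros y Hy. rewrite <- Rmult_minus_distr_l, Rabs_mult. specialize (Hn y Hy).
  pose proof (Rabs_pos (f y - f x)). apply Rle_lt_trans with ((Rabs a + 1) * Rabs (f y - f x)). nra.
  apply Rmult_lt_compat_l with (r := Rabs a + 1) in Hn; [|lra]. unfold Rdiv in Hn.
  rewrite (Rmult_comm e), <- Rmult_assoc, Rinv_r in Hn by lra. lra.
Qed.

Lemma cont_sub f g : cont f -> cont g -> cont (fun t => f t - g t).
Proof.
  intros Hf Hg. replace (fun t => f t - g t) with (fun t => f t + (-1) * g t) by (apply functional_extensionality; intro; ring).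
  apply cont_plus; auto. apply cont_scal; auto.
Qed.

Lemma cont_bsum n (F : nat -> Cantor -> R) : (forall k, cont (F k)) -> cont (fun t => bsum n (fun k => F k t)).
Proof. intro H. induction n as [|n IH]; simpl. apply cont_const. apply (cont_plus (fun t => bsum n (fun k => F k t))); auto. Qed.

Lemma cont_uniform f : (forall e, 0 < e -> exists g, cont g /\ nb (fun t => f t - g t) e) -> cont f.
Proof.
  intros H x e He. destruct (H (e / 4) ltac:(lra)) as [g [Hg Hfg]]. destruct (Hg x (e / 4) ltac:(lra)) as [n Hn].
  exists n. intros y Hy. specialize (Hn y Hy). pose proof (Hfg x) as H1. pose proof (Hfg y) as H2. simpl in *.
  apply Rabs_def2 in Hn. apply Rabs_le_between in H1, H2. apply Rabs_def1; lra.
Qed.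

Lemma uniform_complete (u : nat -> Cantor -> R) (e : nat -> R) : (forall n, cont (u n)) ->
  (forall n m, (n <= m)%nat -> nb (fun t => u m t - u n t) (e n)) ->
  (forall d, 0 < d -> exists n, e n < d) ->
  exists f, cont f /\ forall n, nb (fun t => f t - u n t) (e n).
Proof.
  intros Hu He H0.
  assert (Hl : forall t, exists l, is_lim_seq (fun n => u n t) (Finite l)).
  { intro t. apply ex_lim_seq_cauchy_corr. intros [d Hd]. destruct (H0 (d / 2) ltac:(lra)) as [N HN].
    exists N. intros n m Hn Hm. simpl. pose proof (He N n Hn t) as H1. pose proof (He N m Hm t) as H2. simpl in *.
    apply Rabs_le_between in H1, H2. apply Rabs_def1; lra. }
  destruct (choice _ Hl) as [f Hf].
  assert (Hfn : forall n, nb (fun t => f t - u n t) (e n)).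
  { intros n t. apply Rabs_le_between. split.
    - assert (Rbar_le (Finite (u n t - e n)) (Finite (f t))); [|simpl in *; lra].
      apply (is_lim_seq_le_loc (fun _ => u n t - e n) (fun m => u m t)); [|apply is_lim_seq_const|apply Hf].
      exists n. intros m Hm. pose proof (He n m Hm t) as H1. simpl in H1. apply Rabs_le_between in H1. lra.
    - assert (Rbar_le (Finite (f t)) (Finite (u n t + e n))); [|simpl in *; lra].
      apply (is_lim_seq_le_loc (fun m => u m t) (fun _ => u n t + e n)); [|apply Hf|apply is_lim_seq_const].
      exists n. intros m Hm. pose proof (He n m Hm t) as H1. simpl in H1. apply Rabs_le_between in H1. lra. }
  exists f. split; auto. apply cont_uniform. intros d Hd. destruct (H0 d Hd) as [n Hn]. exists (u n). split; auto.
  intro t. specialize (Hfn n t). simpl in *. lra.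
Qed.

(** * Embedding a bounded set of sequences into the Cantor space *)

(** The values to be coded lie in [-1, 1]; starting at -2 leaves room for a grid point just below
    each of them. *)
Definition grid (i L : nat) : R := INR i / INR (S L) - 2.

Definition bit (n i L : nat) : nat := Cantor.to_nat (n, Cantor.to_nat (i, L)).

(** Coordinates are stored as Dedekind cuts, so that agreement on finitely many bits makes finitely
    many coordinates close. *)
Definition vcode (v : nat -> R) : Cantor := fun k =>
  let (n, m) := Cantor.of_nat k in let (i, L) := Cantor.of_nat m in
  if Rlt_dec (grid i L) (v n) then true else false.

Lemma vcode_bit v n i L : vcode v (bit n i L) = true <-> grid i L < v n.
Proof.
  unfold vcode, bit. rewrite !Cantor.cancel_of_to. destruct (Rlt_dec (grid i L) (v n)); split; auto; congruence.
Qed.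

Lemma to_nat_mono x y x' y' : (x <= x')%nat -> (y <= y')%nat -> (Cantor.to_nat (x, y) <= Cantor.to_nat (x', y'))%nat.
Proof.
  intros Hx Hy. pose proof (Cantor.to_nat_spec x y) as H1. pose proof (Cantor.to_nat_spec x' y') as H2.
  assert (H3 : ((y + x) * S (y + x) <= (y' + x') * S (y' + x'))%nat) by (apply Nat.mul_le_mono; lia).
  set (u := ((y + x) * S (y + x))%nat) in *. set (u' := ((y' + x') * S (y' + x'))%nat) in *. lia.
Qed.

Lemma grid_point L a b : -2 <= a -> b <= 2 -> a + / INR (S L) <= b ->
  exists i, (i <= 4 * S L)%nat /\ a <= grid i L < b.
Proof.
  intros Ha Hb Hab. assert (HL : 0 < INR (S L)) by (apply lt_0_INR; lia).
  destruct (least (fun i => (a + 2) * INR (S L) <= INR i)) as [i [Hi Hmin]].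
  { destruct (INR_unbounded ((a + 2) * INR (S L))) as [r Hr]. exists r. lra. }
  assert (Hlt : INR i < (a + 2) * INR (S L) + 1).
  { destruct i as [|i]. change (INR 0) with 0; nra. assert (H := Hmin i ltac:(lia)). rewrite S_INR. lra. }
  assert (Hab' : (a + 2) * INR (S L) + 1 <= (b + 2) * INR (S L)).
  { apply Rmult_le_compat_r with (r := INR (S L)) in Hab; [|lra]. rewrite Rmult_plus_distr_r, Rinv_l in Hab by lra. lra. }
  exists i. split; [|unfold grid; split].
  - apply INR_le. rewrite mult_INR. replace (INR 4) with 4 by (simpl; ring). nra.
  - assert (a + 2 <= INR i / INR (S L)) by (apply le_div; auto). lra.
  - assert (INR i / INR (S L) < b + 2); [|lra]. apply Rmult_lt_reg_r with (INR (S L)); auto.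
    unfold Rdiv. rewrite Rmult_assoc, Rinv_l by lra. lra.
Qed.

Definition next_bit (A : (nat -> R) -> Prop) (p : Cantor) (n : nat) (b : bool) : bool :=
  if excluded_middle_informative (exists v, A v /\ agree_upto n (vcode v) p /\ vcode v n = b) then b else negb b.

Fixpoint prefix (A : (nat -> R) -> Prop) (t : Cantor) (n : nat) : Cantor :=
  match n with
  | O => fun _ => false
  | S n => fun i => if (i =? n)%nat then next_bit A (prefix A t n) n (t n) else prefix A t n i
  end.

(* Follows t as long as the prefix extends to the code of an element of A: a retraction onto the closure of the codes. *)
Definition retract (A : (nat -> R) -> Prop) (t : Cantor) : Cantor := fun i => prefix A t (S i) i.

Lemma prefix_retract A t n i : (i < n)%nat -> prefix A t n i = retract A t i.
Proof.
  intro H. unfold retract. induction H as [|n H IH]; auto. simpl prefix at 1. destruct (Nat.eqb_spec i n); [lia|]. exact IH.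
Qed.

Lemma retract_next A t n : retract A t n = next_bit A (retract A t) n (t n).
Proof.
  unfold retract at 1. simpl. rewrite Nat.eqb_refl. unfold next_bit.
  destruct (excluded_middle_informative _) as [[v [H1 [H2 H3]]]|Hn]; destruct (excluded_middle_informative _) as [[w [G1 [G2 G3]]]|Gn]; auto; exfalso.
  - apply Gn. exists v. repeat split; auto. intros i Hi. rewrite H2 by auto. apply prefix_retract; auto.
  - apply Hn. exists w. repeat split; auto. intros i Hi. rewrite G2 by auto. symmetry; apply prefix_retract; auto.
Qed.

Lemma retract_approx A t n : (exists v, A v) -> exists v, A v /\ agree_upto n (vcode v) (retract A t).
Proof.
  intro HA. induction n as [|n IH].
  - destruct HA as [v Hv]. exists v. split; auto. intros i Hi; lia.
  - destruct IH as [v [Hv Hag]].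
    assert (Hext : forall w, agree_upto n (vcode w) (retract A t) -> vcode w n = retract A t n -> agree_upto (S n) (vcode w) (retract A t)).
    { intros w Hw Hwn i Hi. destruct (Nat.eq_dec i n) as [->|]; auto. apply Hw; lia. }
    pose proof (retract_next A t n) as E. unfold next_bit in E.
    destruct (excluded_middle_informative _) as [[w [G1 [G2 G3]]]|Gn].
    + exists w. split; auto. apply Hext; auto. congruence.
    + exists v. split; auto. apply Hext; auto. rewrite E.
      destruct (vcode v n) eqn:Ev, (t n) eqn:Et; simpl; auto; exfalso; apply Gn; exists v; rewrite Ev; auto.
Qed.

Lemma retract_code A v : A v -> retract A (vcode v) = vcode v.
Proof.
  intro Hv. apply functional_extensionality. intro n. induction n as [n IH] using lt_wf_ind.
  rewrite retract_next. unfold next_bit. destruct (excluded_middle_informative _) as [_|Hn]; auto.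
  exfalso. apply Hn. exists v. repeat split; auto. intros i Hi. symmetry. apply IH; auto.
Qed.

Lemma retract_cont A t t' n : agree_upto n t t' -> agree_upto n (retract A t) (retract A t').
Proof.
  intros H i. induction i as [i IH] using lt_wf_ind. intro Hi.
  rewrite !retract_next, (H i Hi). unfold next_bit.
  assert (Hag : agree_upto i (retract A t) (retract A t')) by (intros k Hk; apply IH; auto; lia).
  destruct (excluded_middle_informative _) as [[v [H1 [H2 H3]]]|Hn]; destruct (excluded_middle_informative _) as [[w [G1 [G2 G3]]]|Gn]; auto; exfalso.
  - apply Gn. exists v. repeat split; auto. intros k Hk. rewrite H2 by auto. apply Hag; auto.
  - apply Hn. exists w. repeat split; auto. intros k Hk. rewrite G2 by auto. symmetry; apply Hag; auto.
Qed.

(** Reading the cut after the retraction gives a meaningful value at every point, not only at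
    codes. *)
Definition decode (A : (nat -> R) -> Prop) (n : nat) (t : Cantor) : R :=
  real (Lub_Rbar (fun q => exists i L, q = grid i L /\ retract A t (bit n i L) = true)).

(** Suppose a recorded grid point exceeds [v n] by more than the mesh. Some [w] in [A], whose code
    agrees with the retracted point on enough bits, lies above it; then a grid point of level [L]
    separates [v n] from [w n], although both codes agree there. *)
Lemma decode_near A n t L v : (forall v k, A v -> Rabs (v k) <= 1) -> A v ->
  (forall i, (i <= 4 * S L)%nat -> vcode v (bit n i L) = retract A t (bit n i L)) ->
  Rabs (decode A n t - v n) <= / INR (S L).
Proof.
  intros HA Hv Hag. assert (HL : 0 < / INR (S L)) by (apply Rinv_0_lt_compat, lt_0_INR; lia).
  assert (HL1 : / INR (S L) <= 1). { rewrite <- Rinv_1. apply Rinv_le_contravar; [lra|]. rewrite S_INR. pose proof (pos_INR L). lra. }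
  set (E := fun q => exists i L, q = grid i L /\ retract A t (bit n i L) = true).
  assert (Hb := fun w Hw => proj1 (Rabs_le_between _ _) (HA w n Hw)).
  assert (Hup : forall q, E q -> q <= v n + / INR (S L)).
  { intros q [i' [L' [-> Hbit]]].
    assert (exists M, (bit n i' L' < M)%nat /\ forall i, (i <= 4 * S L)%nat -> (bit n i L < M)%nat) as [M [HM1 HM2]].
    { exists (S (bit n i' L' + bit n (4 * S L) L)). split; [lia|]. intros i Hi.
      assert (bit n i L <= bit n (4 * S L) L)%nat; [|lia]. unfold bit. apply to_nat_mono; auto. apply to_nat_mono; auto. }
    destruct (retract_approx A t M (ex_intro _ v Hv)) as [w [Hw Hwa]].
    assert (Hq : grid i' L' < w n). { apply vcode_bit. rewrite Hwa by auto. exact Hbit. }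
    apply Rnot_lt_le. intro Hlt. destruct (grid_point L (v n) (w n)) as [i [Hi [G1 G2]]].
    { specialize (Hb v Hv). lra. } { specialize (Hb w Hw). lra. } { lra. }
    assert (vcode w (bit n i L) = true) by (apply vcode_bit; auto).
    rewrite Hwa, <- Hag in H by auto. apply vcode_bit in H. lra. }
  destruct (grid_point L (v n - / INR (S L)) (v n)) as [i [Hi [G1 G2]]].
  { specialize (Hb v Hv). lra. } { specialize (Hb v Hv). lra. } { lra. }
  assert (HE : E (grid i L)). { exists i, L. split; auto. rewrite <- Hag by auto. apply vcode_bit; auto. }
  destruct (real_lub E (v n + / INR (S L)) (grid i L) HE Hup) as [H1 H2].
  specialize (H1 _ HE). specialize (H2 _ Hup). unfold decode. fold E. apply Rabs_le_between. lra.
Qed.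

Lemma bits_bound N L : exists M, forall n i, (n < N)%nat -> (i <= 4 * S L)%nat -> (bit n i L < M)%nat.
Proof.
  exists (S (bit N (4 * S L) L)). intros n i Hn Hi. unfold bit. apply Nat.lt_succ_r.
  apply to_nat_mono; [lia|]. apply to_nat_mono; auto.
Qed.

Lemma inv_small e : 0 < e -> exists L, / INR (S L) < e.
Proof.
  intro He. destruct (INR_unbounded (/ e)) as [r Hr]. exists r.
  rewrite <- (Rinv_inv e). apply Rinv_lt_contravar.
  - apply Rmult_lt_0_compat; [apply Rinv_0_lt_compat; auto|apply lt_0_INR; lia].
  - rewrite S_INR. lra.
Qed.

(** By the last clause the points that are not codes add only limits of elements of [A], so suprema
    over the Cantor space are suprema over [A]. *)
Lemma cantor_embedding (A : (nat -> R) -> Prop) : (exists v, A v) -> (forall v k, A v -> Rabs (v k) <= 1) ->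
  exists phi : nat -> Cantor -> R, (forall n, cont (phi n)) /\
    (forall v, A v -> exists t, forall n, phi n t = v n) /\
    (forall t N e, 0 < e -> exists v, A v /\ forall n, (n < N)%nat -> Rabs (phi n t - v n) <= e).
Proof.
  intros HA Hb. exists (decode A). split; [|split].
  - intros n t e He. destruct (inv_small (e / 4) ltac:(lra)) as [L HL]. destruct (bits_bound (S n) L) as [M HM].
    exists M. intros y Hy. destruct (retract_approx A t M HA) as [v [Hv Hag]].
    assert (H1 : Rabs (decode A n t - v n) <= / INR (S L)) by (apply decode_near; auto).
    assert (H2 : Rabs (decode A n y - v n) <= / INR (S L)).
    { apply decode_near; auto. intros i Hi. rewrite Hag by auto. apply (retract_cont A t y M Hy). auto. }
    apply Rabs_le_between in H1, H2. apply Rabs_def1; lra.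
  - intros v Hv. exists (vcode v). intro n. apply NNPP. intro Hne.
    assert (Hp : 0 < Rabs (decode A n (vcode v) - v n)) by (apply Rabs_pos_lt; lra).
    destruct (inv_small _ Hp) as [L HL].
    assert (Rabs (decode A n (vcode v) - v n) <= / INR (S L)); [|lra].
    apply decode_near; auto. intros i Hi. rewrite retract_code; auto.
  - intros t N e He. destruct (inv_small e He) as [L HL]. destruct (bits_bound N L) as [M HM].
    destruct (retract_approx A t M HA) as [v [Hv Hag]]. exists v. split; auto. intros n Hn.
    apply Rle_trans with (/ INR (S L)); [|lra]. apply decode_near; auto.
Qed.

Definition unit_vec (n : nat) : nat -> R := fun k => if (k =? n)%nat then 1 else 0.

Lemma vec_units b x : bk 0 b x -> x = vsum b (fun n => vscal (x n) (unit_vec n)).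
Proof.
  intro H. apply functional_extensionality; intro t. unfold vsum, vscal, unit_vec.
  destruct (lt_dec t b) as [Ht|Ht].
  - rewrite (bsum_single b t); auto. rewrite Nat.eqb_refl; ring.
    intros k Hk Hne. destruct (Nat.eqb_spec t k); [congruence|ring].
  - rewrite (bk_out _ _ _ _ H) by lia. symmetry. apply bsum_0. intros k Hk. destruct (Nat.eqb_spec t k); [lia|ring].
Qed.

Lemma ap_units f b x : bk 0 b x -> ap f x = bsum b (fun n => x n * ap f (unit_vec n)).
Proof.
  intro H. rewrite (vec_units b x H) at 1. rewrite ap_vsum. apply bsum_ext. intros. unfold vscal. apply ap_scal.
Qed.

(** Taking for [A] the values of the functionals of [K] at the unit vectors embeds the finitely
    supported vectors isometrically into the continuous functions. *)
Lemma norming_embedding : exists phi : nat -> Cantor -> R, (forall n, cont (phi n)) /\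
  (forall f, K f -> exists t, forall x b, bk 0 b x -> bsum b (fun n => x n * phi n t) = ap f x) /\
  (forall x b t, bk 0 b x -> Rabs (bsum b (fun n => x n * phi n t)) <= nrm x).
Proof.
  destruct (cantor_embedding (fun v => exists f, K f /\ forall n, v n = ap f (unit_vec n))) as [phi [H1 [H2 H3]]].
  - exists (fun n => ap (Gr 0 0 0 nil) (unit_vec n)). exists (Gr 0 0 0 nil). split; auto. constructor.
  - intros v k [f [Hf Hv]]. rewrite Hv. eapply Rle_trans; [apply (ap_l1 f (S k)); auto|].
    + intros n. unfold unit_vec. destruct (Nat.eqb_spec n k); [lia|lra].
    + unfold l1n. rewrite (bsum_single (S k) k); [|lia|].
      * unfold unit_vec. rewrite Nat.eqb_refl, Rabs_R1. lra.
      * intros i Hi Hik. unfold unit_vec. destruct (Nat.eqb_spec i k); [lia|apply Rabs_R0].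
  - exists phi. split; auto. split.
    + intros f Hf. destruct (H2 (fun n => ap f (unit_vec n))) as [t Ht]. { exists f; auto. }
      exists t. intros x b Hx. rewrite (ap_units f b x Hx). apply bsum_ext. intros. rewrite Ht. reflexivity.
    + intros x b t Hx. apply Rnot_lt_le. intro Hlt.
      set (S1 := bsum b (fun n => Rabs (x n))). assert (HS : 0 <= S1) by (apply bsum_ge0; intros; apply Rabs_pos).
      set (d := Rabs (bsum b (fun n => x n * phi n t)) - nrm x).
      assert (Hd : 0 < d) by (unfold d; lra).
      destruct (H3 t b (d / (2 * (S1 + 1)))) as [v [[f [Hf Hv]] Hn]]. { apply Rdiv_lt_0_compat; lra. }
      assert (Hdiff : Rabs (bsum b (fun n => x n * phi n t) - ap f x) <= S1 * (d / (2 * (S1 + 1)))).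
      { rewrite (ap_units f b x Hx). replace (bsum b (fun n => x n * phi n t) - bsum b (fun n => x n * ap f (unit_vec n)))
          with (bsum b (fun n => x n * phi n t + (-1) * (x n * ap f (unit_vec n)))).
        2:{ rewrite bsum_plus, bsum_scal. ring. }
        eapply Rle_trans; [apply bsum_abs|]. unfold S1. rewrite Rmult_comm, <- bsum_scal. apply bsum_le. intros k Hk.
        replace (x k * phi k t + -1 * (x k * ap f (unit_vec k))) with (x k * (phi k t - v k)) by (rewrite Hv; ring).
        rewrite Rabs_mult, Rmult_comm. apply Rmult_le_compat_r; [apply Rabs_pos|]. auto. }
      assert (S1 * (d / (2 * (S1 + 1))) < d).
      { apply Rmult_lt_reg_r with (2 * (S1 + 1)); [lra|]. replace (S1 * (d / (2 * (S1 + 1))) * (2 * (S1 + 1))) with (S1 * d) by (field; lra). nra. }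
      assert (Rabs (ap f x) <= nrm x) by (apply nrm_ub; auto; eapply bk_fs; eauto).
      pose proof (Rabs_triang (bsum b (fun n => x n * phi n t) - ap f x) (ap f x)) as Htri.
      replace (bsum b (fun n => x n * phi n t) - ap f x + ap f x) with (bsum b (fun n => x n * phi n t)) in Htri by ring.
      unfold d in *. lra.
Qed.

(** * Closed subspaces spanned by nodes *)

Lemma cs_cont X f : closed_subspace X -> X f -> cont f.
Proof. intros [[H _] _]. apply H. Qed.

Lemma cs_0 X : closed_subspace X -> X (fun _ => 0).
Proof. intros [[_ [H _]] _]. exact H. Qed.

Lemma cs_plus X f g : closed_subspace X -> X f -> X g -> X (fun t => f t + g t).
Proof. intros [[_ [_ [H _]]] _]. apply H. Qed.

Lemma cs_scal X a f : closed_subspace X -> X f -> X (fun t => a * f t).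
Proof. intros [[_ [_ [_ H]]] _]. apply H. Qed.

Lemma cs_sub X f g : closed_subspace X -> X f -> X g -> X (fun t => f t - g t).
Proof.
  intros HX Hf Hg. replace (fun t => f t - g t) with (fun t => f t + (-1) * g t) by (apply functional_extensionality; intro; ring).
  apply cs_plus; auto. apply cs_scal; auto.
Qed.

Lemma cs_lim X f : closed_subspace X -> cont f -> (forall e, 0 < e -> exists g, X g /\ nb (fun t => f t - g t) e) -> X f.
Proof.
  intros HX Hf H.
  assert (H' : forall n : nat, exists g, X g /\ nb (fun t => f t - g t) (/ INR (S n))).
  { intro n. apply H. apply Rinv_0_lt_compat, lt_0_INR; lia. }
  destruct (choice _ H') as [u Hu]. apply (proj2 HX u f); auto. intro; apply Hu.
  apply (is_lim_seq_le_le (fun _ => 0) _ (fun n => / INR (S n))).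
  - intro n. assert (Hc : cont (fun t => u n t - f t)). { apply cont_sub; auto. apply (cs_cont X); auto; apply Hu. } split.
    + eapply Rle_trans; [apply Rabs_pos|apply (supnorm_nb _ Hc (fun _ => false))].
    + apply nb_supnorm. intro t. rewrite Rabs_minus_sym. apply Hu.
  - apply is_lim_seq_const.
  - apply (is_lim_seq_incr_1 (fun n => / INR n)). replace (Finite 0) with (Rbar_inv p_infty) by reflexivity.
    apply is_lim_seq_inv. apply is_lim_seq_INR. discriminate.
Qed.

Lemma nb_le f a b : nb f a -> a <= b -> nb f b.
Proof. intros H Hab t. specialize (H t). lra. Qed.

Lemma nb_plus f g a b : nb f a -> nb g b -> nb (fun t => f t + g t) (a + b).
Proof. intros Hf Hg t. eapply Rle_trans; [apply Rabs_triang|]. apply Rplus_le_compat; auto. Qed.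

Lemma nb_sub f g a b : nb f a -> nb g b -> nb (fun t => f t - g t) (a + b).
Proof. intros Hf Hg t. unfold Rminus. eapply Rle_trans; [apply Rabs_triang|]. rewrite Rabs_Ropp. apply Rplus_le_compat; auto. Qed.

Lemma nb_scal c f a : nb f a -> nb (fun t => c * f t) (Rabs c * a).
Proof. intros H t. rewrite Rabs_mult. apply Rmult_le_compat_l; auto using Rabs_pos. Qed.

Lemma nb_ext f g a : nb f a -> (forall t, f t = g t) -> nb g a.
Proof. intros H E t. rewrite <- E. auto. Qed.

Lemma nb_cont f : cont f -> exists B, nb f B.
Proof. intro Hf. exists (supnorm f). apply supnorm_nb; auto. Qed.

Lemma half_pow_small a d : 0 < d -> exists n, a * / 2 ^ n < d.
Proof.
  intro Hd. destruct (INR_unbounded (Rabs a / d)) as [r Hr]. exists (r + 4)%nat.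
  assert (H2 : 0 < 2 ^ (r + 4)) by (apply pow_lt; lra).
  apply Rmult_lt_reg_r with (2 ^ (r + 4)); auto. rewrite Rmult_assoc, Rinv_l by lra.
  assert (INR r <= 2 ^ (r + 4)).
  { pose proof (proj1 (pow2_ge (r + 4) ltac:(lia))). rewrite plus_INR in H. simpl (INR 4) in H. lra. }
  apply Rmult_lt_compat_r with (r := d) in Hr; auto. unfold Rdiv in Hr. rewrite Rmult_assoc, Rinv_l in Hr by lra.
  pose proof (Rle_abs a). nra.
Qed.

(* The Baire category half of the open mapping theorem for the addition map on Z x W. *)
Lemma baire_step Z W Y : closed_subspace Z -> closed_subspace W -> closed_subspace Y ->
  (forall f, Y f <-> exists g h, Z g /\ W h /\ forall t, f t = g t + h t) ->
  exists (k : nat) y0 r, 0 < r /\ Y y0 /\ forall y, Y y -> nb (fun t => y t - y0 t) r -> forall e, 0 < e ->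
    exists z w, Z z /\ W w /\ nb z (INR k) /\ nb (fun t => y t - (z t + w t)) e.
Proof.
  intros HZ HW HY Hdec. apply NNPP. intro Hno.
  assert (Hstep : forall (k : nat) y0 r, 0 < r -> Y y0 -> exists y e, Y y /\ nb (fun t => y t - y0 t) r /\ 0 < e /\
     forall z w, Z z -> W w -> nb z (INR k) -> ~ nb (fun t => y t - (z t + w t)) e).
  { intros k y0 r Hr Hy0. apply NNPP. intro H. apply Hno. exists k, y0, r. split; auto. split; auto.
    intros y Hy Hyr e He. apply NNPP. intro H'. apply H. exists y, e. repeat match goal with |- _ /\ _ => split end; auto.
    intros z w Hz Hw Hzk Hn. apply H'. exists z, w. auto. }
  destruct (dep_choice (fun q : nat * ((Cantor -> R) * R) => Y (fst (snd q)) /\ 0 < snd (snd q))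
    (fun q q' => fst q' = S (fst q) /\ nb (fun t => fst (snd q') t - fst (snd q) t) (snd (snd q) / 2) /\
       snd (snd q') <= snd (snd q) / 2 /\
       forall z w, Z z -> W w -> nb z (INR (fst q)) -> ~ nb (fun t => fst (snd q') t - (z t + w t)) (snd (snd q'))))
    with (a0 := (0%nat, (fun _ : Cantor => 0, 1))) as [u [Hu0 [Hu1 Hu2]]].
  { intros [k [y0 r]] [Hy0 Hr]. simpl in *. destruct (Hstep k y0 (r / 2) ltac:(lra) Hy0) as [y [e [Hy [Hyr [He Hze]]]]].
    exists (S k, (y, Rmin e (r / 2))). simpl. split; [split; auto; apply Rmin_glb_lt; lra|]. split; auto. split; auto. split; [apply Rmin_r|].
    intros z w Hz Hw Hzk Hn. apply (Hze z w Hz Hw Hzk). eapply nb_le; [exact Hn|apply Rmin_l]. }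
  { simpl. split; [apply cs_0; auto|lra]. }
  assert (Hfst : forall n, fst (u n) = n). { induction n as [|n IH]; [rewrite Hu0; reflexivity|]. rewrite (proj1 (Hu2 n)), IH; reflexivity. }
  set (y := fun n => fst (snd (u n))). set (r := fun n => snd (snd (u n))).
  assert (Hr : forall n, r n <= 1 * / 2 ^ n).
  { induction n as [|n IH]. unfold r; rewrite Hu0; simpl; lra. destruct (Hu2 n) as [_ [_ [H _]]]. unfold r in *. simpl.
    rewrite Rinv_mult. lra. }
  assert (Hcau : forall n m, (n <= m)%nat -> nb (fun t => y m t - y n t) (r n - r m)).
  { intros n m H. induction H as [|m H IH]; intro t.
    - rewrite !Rminus_diag, Rabs_R0. lra.
    - destruct (Hu2 m) as [_ [H1 [H2 _]]]. specialize (IH t). specialize (H1 t). simpl in *. fold (y m) (y (S m)) (r m) (r (S m)) in *.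
      replace (y (S m) t - y n t) with ((y (S m) t - y m t) + (y m t - y n t)) by ring.
      eapply Rle_trans; [apply Rabs_triang|]. lra. }
  assert (HY' : forall n, Y (y n)) by (intro; apply Hu1).
  destruct (uniform_complete y r) as [f [Hf Hfn]].
  { intro n. apply (cs_cont Y); auto. }
  { intros n m H. eapply nb_le; [apply Hcau; auto|]. destruct (Hu1 m) as [_ H1]. fold (r m) in H1. lra. }
  { intros d Hd. destruct (half_pow_small 1 d Hd) as [n Hn]. exists n. specialize (Hr n). lra. }
  assert (HYf : Y f).
  { apply cs_lim; auto. intros e He. destruct (half_pow_small 1 e He) as [n Hn]. exists (y n). split; auto.
    eapply nb_le; [apply Hfn|]. specialize (Hr n). lra. }
  apply Hdec in HYf. destruct HYf as [z [w [Hz [Hw E]]]].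
  destruct (nb_cont z (cs_cont Z z HZ Hz)) as [B HB]. destruct (INR_unbounded B) as [k Hk].
  destruct (Hu2 k) as [_ [_ [_ H]]]. apply (H z w); auto.
  - rewrite Hfst. eapply nb_le; [exact HB|lra].
  - intro t. fold (y (S k)) (r (S k)). rewrite <- E, Rabs_minus_sym. apply Hfn.
Qed.

(** The rest of the open mapping theorem. Differences recentre the ball at 0, scaling gives the
    radii r / 2^n, and successive approximation removes the error at the cost 2k (1 + 1/2 + ...) =
    4k. Since the sum is direct, the limit is the given summand. The added 1 keeps [C] positive. *)
Lemma sum_bounded Z W Y : closed_subspace Z -> closed_subspace W -> closed_subspace Y ->
  (forall f, Z f -> W f -> forall t, f t = 0) ->
  (forall f, Y f <-> exists g h, Z g /\ W h /\ forall t, f t = g t + h t) ->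
  exists C, 0 < C /\ forall z w l, Z z -> W w -> 0 < l -> nb (fun t => z t + w t) l -> nb z (C * l).
Proof.
  intros HZ HW HY H0 Hdec.
  destruct (baire_step Z W Y HZ HW HY Hdec) as [k [y0 [r [Hr [Hy0 Hball]]]]].
  assert (Hnn : 0 <= INR k) by apply pos_INR.
  assert (H1 : forall y, Y y -> nb y r -> forall e, 0 < e -> exists z w, Z z /\ W w /\ nb z (2 * INR k) /\ nb (fun t => y t - (z t + w t)) e).
  { intros y Hy Hyr e He.
    destruct (Hball (fun t => y t + y0 t) (cs_plus Y y y0 HY Hy Hy0)) with (e := e / 2) as [z1 [w1 [Hz1 [Hw1 [B1 E1]]]]]; [|lra|].
    { eapply nb_ext; [exact Hyr|]. intro; simpl; ring. }
    destruct (Hball y0 Hy0) with (e := e / 2) as [z2 [w2 [Hz2 [Hw2 [B2 E2]]]]]; [|lra|].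
    { intro t. rewrite Rminus_diag, Rabs_R0. lra. }
    exists (fun t => z1 t - z2 t), (fun t => w1 t - w2 t).
    split; [apply cs_sub; auto|]. split; [apply cs_sub; auto|]. split.
    - eapply nb_le; [apply nb_sub; eauto|lra].
    - eapply nb_le; [eapply nb_ext; [apply (nb_sub _ _ _ _ E1 E2)|]|lra]. intro; simpl; ring. }
  assert (H2 : forall n y, Y y -> nb y (r * / 2 ^ n) -> exists z w, Z z /\ W w /\ nb z (2 * INR k * / 2 ^ n) /\ nb (fun t => y t - (z t + w t)) (r * / 2 ^ S n)).
  { intros n y Hy Hyn. assert (Hp : 0 < 2 ^ n) by (apply pow_lt; lra). assert (Hpi : 0 < / 2 ^ n) by (apply Rinv_0_lt_compat; auto).
    destruct (H1 (fun t => 2 ^ n * y t) (cs_scal Y _ y HY Hy)) with (e := r / 2) as [z [w [Hz [Hw [B E]]]]]; [|lra|].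
    { eapply nb_le; [apply nb_scal; exact Hyn|]. rewrite Rabs_pos_eq by lra. right; field; lra. }
    exists (fun t => / 2 ^ n * z t), (fun t => / 2 ^ n * w t).
    split; [apply cs_scal; auto|]. split; [apply cs_scal; auto|]. split.
    - eapply nb_le; [apply nb_scal; exact B|]. rewrite Rabs_pos_eq by lra. right; ring.
    - eapply nb_ext; [eapply nb_le; [apply (nb_scal (/ 2 ^ n)); exact E|]|].
      + rewrite Rabs_pos_eq by lra. simpl. right; field; lra.
      + intro t; simpl. field; lra. }
  assert (H3 : forall z0 w0, Z z0 -> W w0 -> nb (fun t => z0 t + w0 t) r -> nb z0 (4 * INR k)).
  { intros z0 w0 Hz0 Hw0 Hr0.
    destruct (dep_choice (fun q : nat * ((Cantor -> R) * (Cantor -> R)) => Z (fst (snd q)) /\ W (snd (snd q)) /\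
         nb (fun t => z0 t + w0 t - fst (snd q) t - snd (snd q) t) (r * / 2 ^ fst q))
       (fun q q' => fst q' = S (fst q) /\ nb (fun t => fst (snd q') t - fst (snd q) t) (2 * INR k * / 2 ^ fst q)))
      with (a0 := (0%nat, (fun _ : Cantor => 0, fun _ : Cantor => 0))) as [u [Hu0 [Hu1 Hu2]]].
    { intros [n [s v]] [Hs [Hv Hn]]. simpl in Hs, Hv, Hn.
      destruct (H2 n (fun t => z0 t + w0 t - s t - v t)) as [z [w [Hz [Hw [B E]]]]].
      { apply Hdec. exists (fun t => z0 t - s t), (fun t => w0 t - v t). split; [apply cs_sub; auto|]. split; [apply cs_sub; auto|]. intro; ring. }
      { exact Hn. }
      exists (S n, (fun t => s t + z t, fun t => v t + w t)). simpl fst; simpl snd. split; [|split; auto].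
      - split; [apply cs_plus; auto|]. split; [apply cs_plus; auto|]. eapply nb_ext; [exact E|]. intro; simpl; ring.
      - eapply nb_ext; [exact B|]. intro; simpl; ring. }
    { simpl. split; [apply cs_0; auto|]. split; [apply cs_0; auto|]. eapply nb_ext; [eapply nb_le; [exact Hr0|]|]. right; field. intro; simpl; ring. }
    assert (Hfst : forall n, fst (u n) = n). { induction n as [|n IH]; [rewrite Hu0; reflexivity|]. rewrite (proj1 (Hu2 n)), IH; reflexivity. }
    set (s := fun n => fst (snd (u n))). set (v := fun n => snd (snd (u n))).
    assert (Hcau : forall n m, (n <= m)%nat -> nb (fun t => s m t - s n t) (4 * INR k * (/ 2 ^ n - / 2 ^ m))).
    { intros n m H. induction H as [|m H IH]; intro t.
      - rewrite !Rminus_diag, Rabs_R0. lra.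
      - destruct (Hu2 m) as [_ H4]. specialize (IH t). specialize (H4 t). simpl in *. fold (s m) (s (S m)) in *. rewrite Hfst in H4.
        replace (s (S m) t - s n t) with ((s (S m) t - s m t) + (s m t - s n t)) by ring.
        eapply Rle_trans; [apply Rabs_triang|]. rewrite Rinv_mult. lra. }
    assert (Hpos : forall n, 0 < / 2 ^ n) by (intro; apply Rinv_0_lt_compat, pow_lt; lra).
    assert (HsZ : forall n, Z (s n)) by (intro; apply Hu1).
    destruct (uniform_complete s (fun n => 4 * INR k * / 2 ^ n)) as [z [Hz Hzn]].
    { intro n. apply (cs_cont Z); auto. }
    { intros n m H. eapply nb_le; [apply Hcau; auto|]. specialize (Hpos m). nra. }
    { intros d Hd. destruct (half_pow_small (4 * INR k) d Hd) as [n Hn]. eauto. }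
    assert (HZz : Z z).
    { apply cs_lim; auto. intros e He. destruct (half_pow_small (4 * INR k) e He) as [n Hn]. exists (s n). split; auto.
      eapply nb_le; [apply Hzn|lra]. }
    assert (HWw : W (fun t => z0 t + w0 t - z t)).
    { apply cs_lim; auto. apply (cont_sub (fun t => z0 t + w0 t)); auto. apply cont_plus; [apply (cs_cont Z)|apply (cs_cont W)]; auto.
      intros e He. destruct (half_pow_small (4 * INR k + r) e He) as [n Hn]. exists (v n). split; [apply Hu1|].
      destruct (Hu1 n) as [_ [_ H4]]. rewrite Hfst in H4. fold (s n) (v n) in H4.
      eapply nb_ext; [eapply nb_le; [apply (nb_sub _ _ _ _ H4 (Hzn n))|]|]. lra. intro; simpl; ring. }
    assert (Hzz : forall t, z t = z0 t).
    { intro t. assert (E : z t - z0 t = 0); [|lra]. apply (H0 (fun t => z t - z0 t)). apply cs_sub; auto.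
      assert (HW' : W (fun t => w0 t - (z0 t + w0 t - z t))) by (apply cs_sub; auto).
      replace (fun t => z t - z0 t) with (fun t => w0 t - (z0 t + w0 t - z t)); auto. apply functional_extensionality; intro; ring. }
    eapply nb_ext; [|exact Hzz]. specialize (Hzn 0%nat). assert (Hs0 : s 0%nat = (fun _ => 0)) by (unfold s; rewrite Hu0; reflexivity).
    rewrite Hs0 in Hzn. eapply nb_ext; [eapply nb_le; [exact Hzn|]|]. simpl; right; field. intro; simpl; ring. }
  exists (4 * INR k / r + 1). assert (0 <= 4 * INR k / r) by (apply Rdiv_le_0_compat; lra). split; [lra|].
  intros z w l Hz Hw Hl Hn.
  assert (Hrl : 0 < r / l) by (apply Rdiv_lt_0_compat; auto).
  assert (H4 : nb (fun t => r / l * z t) (4 * INR k)).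
  { apply (H3 _ (fun t => r / l * w t)); try (apply cs_scal; auto).
    eapply nb_ext; [eapply nb_le; [apply (nb_scal (r / l)); exact Hn|]|].
    rewrite Rabs_pos_eq by lra. right; field; lra. intro; simpl; ring. }
  eapply nb_ext; [eapply nb_le; [apply (nb_scal (l / r)); exact H4|]|].
  - rewrite Rabs_pos_eq by (left; apply Rdiv_lt_0_compat; auto). rewrite Rmult_plus_distr_r.
    replace (l / r * (4 * INR k)) with (4 * INR k / r * l) by (field; lra). lra.
  - intro t; simpl. field; lra.
Qed.

(** * The closed span of a set of nodes *)

Definition phi : nat -> Cantor -> R :=
  proj1_sig (constructive_indefinite_description _ norming_embedding).

Lemma phi_cont n : cont (phi n).
Proof. unfold phi. destruct (constructive_indefinite_description _ _) as [p [H1 [H2 H3]]]. simpl. auto. Qed.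

Definition comb (x : nat -> R) (b : nat) : Cantor -> R := fun t => bsum b (fun n => x n * phi n t).

Lemma phi_point f : K f -> exists t, forall x b, bk 0 b x -> comb x b t = ap f x.
Proof. unfold comb, phi. destruct (constructive_indefinite_description _ _) as [p [H1 [H2 H3]]]. simpl. auto. Qed.

Lemma comb_nb x b : bk 0 b x -> nb (comb x b) (nrm x).
Proof. unfold comb, phi, nb. destruct (constructive_indefinite_description _ _) as [p [H1 [H2 H3]]]. simpl. auto. Qed.

Lemma comb_cont x b : cont (comb x b).
Proof. unfold comb. apply (cont_bsum b (fun n t => x n * phi n t)). intro k. apply cont_scal, phi_cont. Qed.

Lemma comb_extend x b b' : bk 0 b x -> (b <= b')%nat -> comb x b' = comb x b.
Proof.
  intros H Hb. apply functional_extensionality; intro t. unfold comb. apply bsum_tail; auto.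
  intros k Hk. rewrite (bk_out _ _ _ _ H) by lia. ring.
Qed.

Lemma comb_plus x y b t : comb (fun n => x n + y n) b t = comb x b t + comb y b t.
Proof. unfold comb. rewrite <- bsum_plus. apply bsum_ext; intros; ring. Qed.

Lemma comb_scal a x b t : comb (fun n => a * x n) b t = a * comb x b t.
Proof. unfold comb. rewrite <- bsum_scal. apply bsum_ext; intros; ring. Qed.

Lemma comb_sub x y b t : comb (fun n => x n - y n) b t = comb x b t - comb y b t.
Proof.
  replace (fun n => x n - y n) with (fun n => x n + (-1) * y n) by (apply functional_extensionality; intro; ring).
  rewrite comb_plus, (comb_scal (-1) y). ring.
Qed.

Lemma nrm_comb x b c : bk 0 b x -> nb (comb x b) c -> nrm x <= c.
Proof. intros Hx H. apply nrm_le. intros f Hf. destruct (phi_point f Hf) as [t Ht]. rewrite <- (Ht x b Hx). apply H. Qed.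

(** Evaluation here extends the n-th coordinate from finitely supported vectors to all continuous
    functions. *)
Definition point (n : nat) : Cantor :=
  proj1_sig (constructive_indefinite_description _ (phi_point (Gr n (S n) n nil) (KG _ _ _ _))).

Lemma comb_point x b n : bk 0 b x -> comb x b (point n) = x n.
Proof. intro H. unfold point. destruct (constructive_indefinite_description _ _) as [t Ht]. simpl. rewrite Ht by auto. apply ap_unit. Qed.

Definition in_tree (T : TrSpace) (x : nat -> R) : Prop := forall n, x n <> 0 -> T (node n) = true.

(** [T] may be any set of nodes; the levels of one branch are used in [ill_founded_not_HI]. *)
Definition tree_space (T : TrSpace) (f : Cantor -> R) : Prop :=
  cont f /\ forall e, 0 < e -> exists x b, bk 0 b x /\ in_tree T x /\ nb (fun t => f t - comb x b t) e.

Lemma bk_plus a b x y : bk a b x -> bk a b y -> bk a b (fun n => x n + y n).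
Proof. intros Hx Hy n Hn. destruct (Req_dec (x n) 0) as [E|E]; [|auto]. apply Hy. lra. Qed.

Lemma tree_space_closed T : closed_subspace (tree_space T).
Proof.
  split; [split; [|split; [|split]]|].
  - intros f [H _]. exact H.
  - split; [apply cont_const|]. intros e He. exists (fun _ => 0), 0%nat. split; [intros n Hn; lra|]. split; [intros n Hn; lra|].
    intro t. unfold comb. simpl. rewrite Rminus_diag, Rabs_R0. lra.
  - intros f g [Hf1 Hf2] [Hg1 Hg2]. split; [apply cont_plus; auto|]. intros e He.
    destruct (Hf2 (e / 2) ltac:(lra)) as [x [b [Hx [Tx Ex]]]]. destruct (Hg2 (e / 2) ltac:(lra)) as [y [c [Hy [Ty Ey]]]].
    exists (fun n => x n + y n), (Nat.max b c). split; [apply bk_plus; eapply bk_weaken; eauto; lia|]. split.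
    + intros n Hn. destruct (Req_dec (x n) 0) as [E|E]; [apply Ty; lra|auto].
    + eapply nb_ext; [eapply nb_le; [apply (nb_plus _ _ _ _ Ex Ey)|lra]|]. intro t; simpl.
      rewrite comb_plus, (comb_extend x b (Nat.max b c)), (comb_extend y c (Nat.max b c)) by (auto; lia). ring.
  - intros a f [Hf1 Hf2]. split; [apply cont_scal; auto|]. intros e He. pose proof (Rabs_pos a).
    destruct (Hf2 (e / (Rabs a + 1))) as [x [b [Hx [Tx Ex]]]]; [apply Rdiv_lt_0_compat; lra|].
    exists (fun n => a * x n), b. split; [apply bk_scal; auto|]. split; [intros n Hn; apply Tx; intro E; apply Hn; rewrite E; ring|].
    eapply nb_ext; [eapply nb_le; [apply (nb_scal a); exact Ex|]|].
    + apply Rle_trans with ((Rabs a + 1) * (e / (Rabs a + 1))).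
      apply Rmult_le_compat_r; [left; apply Rdiv_lt_0_compat; lra|lra]. right; field; lra.
    + intro t; simpl. rewrite comb_scal. ring.
  - intros u f Hu Hf Hlim. split; auto. intros e He.
    apply is_lim_seq_spec in Hlim. destruct (Hlim (mkposreal (e / 2) ltac:(lra))) as [N HN]. specialize (HN N (Nat.le_refl N)). simpl in HN.
    rewrite Rminus_0_r in HN. destruct (Hu N) as [HuN HuN2].
    destruct (HuN2 (e / 2) ltac:(lra)) as [x [b [Hx [Tx Ex]]]]. exists x, b. split; auto. split; auto.
    assert (Hc := supnorm_nb _ (cont_sub _ _ HuN Hf)).
    eapply nb_ext; [eapply nb_le; [apply (nb_sub _ _ _ _ Ex Hc)|]|].
    + pose proof (Rle_abs (supnorm (fun t => u N t - f t))). lra.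
    + intro t; simpl; ring.
Qed.

Definition tree_SB (T : TrSpace) : SB := exist _ (tree_space T) (tree_space_closed T).

Lemma tree_space_comb T x b : bk 0 b x -> in_tree T x -> tree_space T (comb x b).
Proof.
  intros Hx HT. split; [apply comb_cont|]. intros e He. exists x, b. split; auto. split; auto.
  intro t. rewrite Rminus_diag, Rabs_R0. lra.
Qed.

(** An evaluation lowers the dimension by at most one: generators of its kernel and one function
    [f0] off the kernel span the previous space. *)
Lemma infinite_dim_kernel Z p : closed_subspace Z -> forall k, infinite_dim Z ->
  exists f, Z f /\ (forall i, (i < k)%nat -> f (p i) = 0) /\ exists t, f t <> 0.
Proof.
  intros HZ.
  assert (H : forall k, infinite_dim Z -> infinite_dim (fun f => Z f /\ forall i, (i < k)%nat -> f (p i) = 0)).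
  { induction k as [|k IH]; intro Hinf; intros [l [Hl1 Hl2]].
    - apply Hinf. exists l. split; [intros f Hf; apply Hl1; auto|]. intros g Hg. apply Hl2. split; auto. intros; lia.
    - specialize (IH Hinf). apply IH.
      destruct (classic (exists f0, (Z f0 /\ forall i, (i < k)%nat -> f0 (p i) = 0) /\ f0 (p k) <> 0)) as [[f0 [[Hf0 Hf0'] Hne]]|Hno].
      + exists (f0 :: l). split.
        * intros f [<-|Hf]; [auto|]. destruct (Hl1 f Hf) as [G1 G2]. split; auto.
        * intros g [Hg Hg']. set (c := g (p k) / f0 (p k)).
          destruct (Hl2 (fun t => g t - c * f0 t)) as [a Ha].
          { split. apply cs_sub; auto. apply cs_scal; auto. intros i Hi. destruct (Nat.eq_dec i k) as [->|Hik].
            unfold c; field; auto. rewrite Hg', Hf0' by lia. ring. }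
          exists (fun i => match i with O => c | S i => a i end). intro t. specialize (Ha t). simpl length.
          rewrite <- cons_seq. simpl. rewrite <- seq_shift, map_map. rewrite <- Ha. ring.
      + exists l. split. { intros f Hf. destruct (Hl1 f Hf) as [G1 G2]. split; auto. }
        intros g [Hg Hg']. apply Hl2. split; auto. intros i Hi. destruct (Nat.eq_dec i k) as [->|Hik]; [|apply Hg'; lia].
        apply NNPP. intro. apply Hno. exists g. auto. }
  intros k Hinf. apply NNPP. intro Hno. apply (H k Hinf). exists nil. split; [simpl; tauto|].
  intros g [Hg Hg']. exists (fun _ => 0). intro t. simpl. apply NNPP. intro Hne. apply Hno. exists g. eauto.
Qed.

Lemma nrm_head k x d : bk 0 k x -> (forall i, (i < k)%nat -> Rabs (x i) <= d) -> nrm x <= INR k * d.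
Proof.
  intros Hx Hd. apply nrm_le. intros f Hf. eapply Rle_trans; [apply (ap_l1 f k x Hf Hx)|].
  unfold l1n. rewrite <- bsum_const. apply bsum_le; auto.
Qed.

(** Gliding hump: an element of [Z] vanishing at the first [k] coordinate points has an approximant
    with small first [k] coordinates, which can be cut off. *)
Lemma near_block T Z k eta : closed_subspace Z -> infinite_dim Z -> (forall f, Z f -> tree_space T f) -> 0 < eta ->
  exists z x b, Z z /\ (k <= b)%nat /\ bk k b x /\ in_tree T x /\ nrm x = 1 /\ nb (fun t => z t - comb x b t) eta.
Proof.
  intros HZ Hinf Hsub Heta.
  destruct (infinite_dim_kernel Z point HZ k Hinf) as [f [Hf [Hf0 [t0 Ht0]]]].
  set (s := Rabs (f t0)). assert (Hs : 0 < s) by (apply Rabs_pos_lt; auto).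
  (* The first bound keeps the norm after cutting at least s/2; the second keeps the error below
     [eta] after division by that norm. Then [d] is chosen so that [k] coordinates and the
     approximation error together give [d']. *)
  set (d' := Rmin (s / 2) (eta * s / 2)).
  assert (Hd' : 0 < d'). { unfold d'. apply Rmin_glb_lt; [lra|]. assert (0 < eta * s) by (apply Rmult_lt_0_compat; auto). lra. }
  set (d := d' / (INR k + 1)). pose proof (pos_INR k) as Hk0.
  assert (Hd : 0 < d) by (unfold d; apply Rdiv_lt_0_compat; lra).
  assert (Hdd : INR k * d + d = d') by (unfold d; field; lra).
  destruct (Hsub f Hf) as [Hfc Hfa]. destruct (Hfa d Hd) as [x [b [Hx [Tx Ex]]]].
  set (B := Nat.max b k). assert (HxB : bk 0 B x) by (eapply bk_weaken; eauto; unfold B; lia).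
  rewrite <- (comb_extend x b B Hx ltac:(unfold B; lia)) in Ex.
  set (h := restr 0 k x). set (u := fun n => x n - h n).
  assert (Hh : bk 0 k h) by apply bk_restr.
  assert (HhB : bk 0 B h) by (eapply bk_weaken; eauto; unfold B; lia).
  assert (Hhn : nrm h <= INR k * d).
  { apply nrm_head; auto. intros i Hi. unfold h, restr. destruct (Nat.ltb_spec i k); [|lia]. simpl.
    specialize (Ex (point i)). cbv beta in Ex. rewrite (comb_point x B i HxB), Hf0, Rminus_0_l, Rabs_Ropp in Ex by auto. exact Ex. }
  assert (Hu : bk k B u).
  { intros n Hn. unfold u, h, restr in Hn. destruct (Nat.ltb_spec n k); simpl in Hn; [lra|].
    split; auto. apply HxB. lra. }
  assert (HuB : bk 0 B u) by (eapply bk_weaken; eauto; lia).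
  assert (Eu : nb (fun t => f t - comb u B t) d').
  { eapply nb_ext; [eapply nb_le; [apply (nb_plus _ _ _ _ Ex (comb_nb h B HhB))|lra]|]. intro t; simpl.
    unfold u. rewrite comb_sub. ring. }
  assert (Hnu : s / 2 <= nrm u).
  { specialize (Eu t0). simpl in Eu. pose proof (comb_nb u B HuB t0).
    pose proof (Rabs_triang (f t0 - comb u B t0) (comb u B t0)) as Ht. replace (f t0 - comb u B t0 + comb u B t0) with (f t0) in Ht by ring.
    fold s in Ht. assert (d' <= s / 2) by apply Rmin_l. lra. }
  set (a := / nrm u). assert (Ha : 0 < a) by (apply Rinv_0_lt_compat; lra).
  exists (fun t => a * f t), (vscal a u), B. split; [apply cs_scal; auto|]. split; [unfold B; lia|].
  split; [apply bk_scal; auto|]. split.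
  { intros n Hn. apply Tx. unfold vscal, u, h, restr in Hn. destruct (andb _ _); intro E; rewrite E in Hn; apply Hn; ring. }
  split.
  { unfold vscal. rewrite nrm_scal by (eapply bk_fs; eauto). rewrite Rabs_pos_eq by lra. unfold a. apply Rinv_l. lra. }
  eapply nb_ext; [eapply nb_le; [apply (nb_scal a); exact Eu|]|].
  - rewrite Rabs_pos_eq by lra. assert (d' <= eta * s / 2) by apply Rmin_r.
    apply Rmult_le_reg_l with (nrm u); [lra|]. unfold a. rewrite <- Rmult_assoc, Rinv_r by lra. nra.
  - intro t; simpl. unfold vscal. rewrite comb_scal. ring.
Qed.

Lemma comb_vsum n b (y : nat -> nat -> R) t : comb (vsum n y) b t = bsum n (fun k => comb (y k) b t).
Proof.
  unfold comb, vsum. rewrite bsum_swap. apply bsum_ext. intros k Hk. rewrite Rmult_comm, <- bsum_scal. apply bsum_ext. intros; ring.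
Qed.

(** The i-th block is within eta / 2^(i+1) of [Z]. As coefficients are bounded by the norm, each
    combination is within [eta] times its norm of [Z]. *)
Lemma near_tailsub T Z eta : closed_subspace Z -> infinite_dim Z -> (forall f, Z f -> tree_space T f) -> 0 < eta ->
  exists Z', tailsub Z' /\ supported T Z' /\ forall u, Z' u -> exists z, Z z /\
    forall b, bk 0 b u -> nb (fun t => z t - comb u b t) (eta * nrm u).
Proof.
  intros HZ Hinf Hsub Heta.
  destruct (@block_choice nat (Cantor -> R) (fun k b i x z i' => i' = S i /\ Z z /\ in_tree T x /\ nrm x = 1 /\
      nb (fun t => z t - comb x b t) (eta * / 2 ^ S i))) with (k0 := 0%nat) (s0 := 0%nat) as [c [x [z [u [Hc [Hu0 [Hb Hx]]]]]]].
  { intros k i. destruct (near_block T Z k (eta * / 2 ^ S i) HZ Hinf Hsub) as [z [x [b [H1 [H2 [H3 [H4 [H5 H6]]]]]]]].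
    - apply Rmult_lt_0_compat; auto. apply Rinv_0_lt_compat, pow_lt; lra.
    - exists b, x, z, (S i). auto 10. }
  assert (Hu : forall k, u k = k). { induction k as [|k IH]; auto. rewrite (proj1 (Hx k)). congruence. }
  assert (Hn : forall k, nrm (x k) = 1) by (intro; apply Hx).
  exists (bspan x). split; [apply (bspan_tailsub c); auto|]. split.
  { intros y n [m [a ->]] Hne. apply NNPP. intro HT. apply Hne. unfold vsum. apply bsum_0. intros k Hk. unfold vscal.
    destruct (Req_dec (x k n) 0) as [E|E]; [rewrite E; ring|]. exfalso. apply HT. apply (proj1 (proj2 (proj2 (Hx k)))). auto. }
  intros y [n [a ->]]. set (y := vsum n (fun k => vscal (a k) (x k))).
  exists (fun t => bsum n (fun k => a k * z k t)). split.
  { clear -HZ Hx. induction n as [|n IH]; simpl. apply cs_0; auto.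
    apply (cs_plus Z (fun t => bsum n (fun k => a k * z k t))); auto. apply cs_scal; auto. apply Hx. }
  assert (Hyb : bk 0 (c n) y). { eapply bk_weaken; [apply (bk_vsum c); apply (blocks_scal c); auto| |]; lia. }
  assert (Hy0 : 0 <= nrm y) by (apply nrm_ge0; eapply bk_fs; eauto).
  intros b Hyb'.
  assert (E : comb y b = comb y (c n)).
  { destruct (le_ge_dec b (c n)). symmetry; apply comb_extend; auto. apply comb_extend; auto. }
  rewrite E. intro t. unfold y at 1. rewrite comb_vsum.
  replace (bsum n (fun k => a k * z k t) - bsum n (fun k => comb (vscal (a k) (x k)) (c n) t)) with
    (bsum n (fun k => a k * z k t + (-1) * comb (vscal (a k) (x k)) (c n) t)) by (rewrite bsum_plus, bsum_scal; ring).
  eapply Rle_trans; [apply bsum_abs|]. apply Rle_trans with (bsum n (fun k => (eta * nrm y) * / 2 ^ S k)).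
  - apply bsum_le. intros k Hk. unfold vscal. rewrite comb_scal.
    rewrite (comb_extend (x k) (c (S k)) (c n)).
    2:{ eapply bk_weaken; [apply Hb|lia|lia]. } 2:{ apply (blocks_mono c x); auto. }
    replace (a k * z k t + -1 * (a k * comb (x k) (c (S k)) t)) with (a k * (z k t - comb (x k) (c (S k)) t)) by ring.
    rewrite Rabs_mult. pose proof (bspan_coef c x n a k Hb Hn Hk) as H1. fold y in H1.
    destruct (Hx k) as [_ [_ [_ [_ H2]]]]. specialize (H2 t). simpl in H2. rewrite Hu in H2.
    apply Rle_trans with (nrm y * (eta * / 2 ^ S k)). apply Rmult_le_compat; auto using Rabs_pos. right; ring.
  - apply geom_half_le. apply Rmult_le_pos; lra.
Qed.

(** Vectors [z], [w] of the summands are close to [u], [v] with |u - v| <= eta |u + v|. Then z - w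
    is small, the bound [C] makes [z] small, and z + w = 2z - (z - w) is too small for u + v. *)
Theorem tree_space_indecomposable T : is_tree T -> well_founded_tree T ->
  forall Y, closed_subspace Y -> (forall f, Y f -> tree_space T f) ->
    ~ exists Z W, closed_subspace Z /\ closed_subspace W /\ infinite_dim Z /\ infinite_dim W /\
        (forall f, Z f -> W f -> forall t, f t = 0) /\
        (forall f, Y f <-> exists g h, Z g /\ W h /\ forall t, f t = g t + h t).
Proof.
  intros HT Hwf Y HY Hsub [Z [W [HZ [HW [HZi [HWi [H0 Hdec]]]]]]].
  destruct (sum_bounded Z W Y HZ HW HY H0 Hdec) as [C [HC Hbd]].
  assert (HZs : forall f, Z f -> tree_space T f).
  { intros f Hf. apply Hsub, Hdec. exists f, (fun _ => 0). split; auto. split; [apply cs_0; auto|intro; ring]. }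
  assert (HWs : forall f, W f -> tree_space T f).
  { intros f Hf. apply Hsub, Hdec. exists (fun _ => 0), f. split; [apply cs_0; auto|]. split; auto. intro; ring. }
  (* Yields |z + w| <= 3 eta (2C + 1) p = 3p/100; the approximation errors add at most 2 eta p. *)
  set (eta := / (100 * (2 * C + 1))).
  assert (Heta : 0 < eta) by (apply Rinv_0_lt_compat; lra).
  assert (HetaC : eta * (2 * C + 1) = / 100) by (unfold eta; field; lra).
  assert (Heta1 : eta <= / 100) by nra.
  destruct (near_tailsub T Z eta HZ HZi HZs Heta) as [Z' [HZ' [SZ' NZ']]].
  destruct (near_tailsub T W eta HW HWi HWs Heta) as [W' [HW' [SW' NW']]].
  destruct (block_HI Z' W' HZ' HW' (well_founded_singular T Z' HT Hwf HZ' SZ') (well_founded_singular T W' HT Hwf HW' SW') eta Heta)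
    as [u [v [Hu [Hv [Hp Hdiff]]]]].
  destruct (NZ' u Hu) as [z [Hz Nz]]. destruct (NW' v Hv) as [w [Hw Nw]].
  pose proof (ts_fs Z' HZ' u Hu) as Fu. pose proof (ts_fs W' HW' v Hv) as Fv.
  destruct Fu as [b1 Hb1]. destruct Fv as [b2 Hb2].
  set (b := Nat.max b1 b2).
  assert (Hub : bk 0 b u) by (eapply bk_weaken; eauto; unfold b; lia).
  assert (Hvb : bk 0 b v) by (eapply bk_weaken; eauto; unfold b; lia).
  assert (Fu := bk_fs _ _ _ Hub). assert (Fv := bk_fs _ _ _ Hvb).
  set (p := nrm (fun n => u n + v n)) in *. set (q := nrm (fun n => u n - v n)) in *.
  assert (Hq0 : 0 <= q) by (apply nrm_ge0, fs_sub; auto).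
  assert (Hqp : q <= p). { apply Rle_trans with (eta * p); auto. rewrite <- (Rmult_1_l p) at 2. apply Rmult_le_compat_r; lra. }
  assert (Hnu : nrm u <= p).
  { apply Rle_trans with (nrm (fun n => / 2 * (u n + v n)) + nrm (fun n => / 2 * (u n - v n))).
    - replace u with (fun n => / 2 * (u n + v n) + / 2 * (u n - v n)) at 1 by (apply functional_extensionality; intro; field).
      apply nrm_plus; apply fs_scal; [apply fs_plus|apply fs_sub]; auto.
    - rewrite (nrm_scal (/ 2) (fun n => u n + v n)), (nrm_scal (/ 2) (fun n => u n - v n)) by (first [apply fs_sub|apply fs_plus]; auto). fold p q. rewrite Rabs_pos_eq by lra. lra. }
  assert (Hnv : nrm v <= p).
  { apply Rle_trans with (nrm (fun n => / 2 * (u n + v n)) + nrm (fun n => - / 2 * (u n - v n))).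
    - replace v with (fun n => / 2 * (u n + v n) + - / 2 * (u n - v n)) at 1 by (apply functional_extensionality; intro; field).
      apply nrm_plus; apply fs_scal; [apply fs_plus|apply fs_sub]; auto.
    - rewrite (nrm_scal (/ 2) (fun n => u n + v n)), (nrm_scal (- / 2) (fun n => u n - v n)) by (first [apply fs_sub|apply fs_plus]; auto). fold p q. rewrite Rabs_Ropp, Rabs_pos_eq by lra. lra. }
  assert (Nz' : nb (fun t => z t - comb u b t) (eta * p)) by (eapply nb_le; [apply Nz; auto|nra]).
  assert (Nw' : nb (fun t => w t - comb v b t) (eta * p)) by (eapply nb_le; [apply Nw; auto|nra]).
  assert (H1 : nb (fun t => z t - w t) (3 * eta * p)).
  { assert (Hc : nb (comb (fun n => u n - v n) b) (eta * p)).
    { eapply nb_le; [apply comb_nb|exact Hdiff]. intros n Hn. destruct (Req_dec (u n) 0); [apply Hvb; lra|auto]. }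
    eapply nb_ext; [eapply nb_le; [apply (nb_plus _ _ _ _ (nb_sub _ _ _ _ Nz' Nw') Hc)|lra]|]. intro t; simpl. rewrite comb_sub. ring. }
  assert (Hpe : 0 < 3 * eta * p) by (apply Rmult_lt_0_compat; lra).
  assert (H2 : nb z (C * (3 * eta * p))).
  { apply (Hbd z (fun t => -1 * w t)); auto. apply cs_scal; auto. eapply nb_ext; [exact H1|]. intro; simpl; ring. }
  assert (H3 : nb (fun t => z t + w t) (3 / 100 * p)).
  { eapply nb_ext; [eapply nb_le; [apply (nb_sub _ _ _ _ (nb_plus _ _ _ _ H2 H2) H1)|]|].
    - right. replace (3 / 100) with (3 * (eta * (2 * C + 1))) by (rewrite HetaC; field). ring.
    - intro; simpl; ring. }
  assert (H4 : nb (comb (fun n => u n + v n) b) (p / 2)).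
  { eapply nb_ext; [eapply nb_le; [apply (nb_sub _ _ _ _ H3 (nb_plus _ _ _ _ Nz' Nw'))|]|].
    - nra.
    - intro t; simpl. rewrite comb_plus. ring. }
  apply nrm_comb in H4; [fold p in H4; lra|]. apply bk_plus; auto.
Qed.

(** * Infinite dimension *)

Fixpoint lspan (l : list (Cantor -> R)) (g : Cantor -> R) : Prop :=
  match l with
  | nil => forall t, g t = 0
  | h :: l => exists a g', lspan l g' /\ forall t, g t = a * h t + g' t
  end.

Lemma span_lspan l : forall g, span_of l g -> lspan l g.
Proof.
  induction l as [|h l IH]; intros g [a Ha]; [exact Ha|].
  exists (a 0%nat), (fun t => fold_right Rplus 0 (map (fun i => a (S i) * nth i l (fun _ => 0) t) (seq 0 (length l)))).
  split.
  - apply IH. exists (fun i => a (S i)). reflexivity.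
  - intro t. rewrite Ha. simpl length. rewrite <- cons_seq. simpl. rewrite <- seq_shift, map_map. reflexivity.
Qed.

Lemma lspan_project l h p : h p <> 0 -> forall g, lspan l g ->
  lspan (map (fun k t => k t - k p / h p * h t) l) (fun t => g t - g p / h p * h t).
Proof.
  intro Hh. induction l as [|k l IH]; intros g Hg; simpl in *.
  - intro t. rewrite !Hg. field; auto.
  - destruct Hg as [a [g' [Hg' E]]]. exists a, (fun t => g' t - g' p / h p * h t). split; auto.
    intro t. rewrite !E. field; auto.
Qed.

(** Elimination: a generator that does not vanish at [p] clears the others at [p] and is dropped. *)
Lemma lspan_kernel l p : forall g0, lspan l g0 -> g0 p <> 0 ->
  exists l', length l = S (length l') /\ forall g, lspan l g -> g p = 0 -> lspan l' g.
Proof.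
  induction l as [|h l IH]; intros g0 Hg0 Hne; simpl in Hg0; [exfalso; auto|].
  destruct (Req_dec (h p) 0) as [Eh|Eh].
  - destruct Hg0 as [a [g' [Hg' E]]]. destruct (IH g' Hg') as [l' [Hl Hk]].
    { intro E'. apply Hne. rewrite E, Eh, E'. ring. }
    exists (h :: l'). split; [simpl; lia|]. intros g [b [k [Hk' Ek]]] Hgp. exists b, k. split; auto. apply Hk; auto.
    rewrite Ek, Eh in Hgp. lra.
  - exists (map (fun k t => k t - k p / h p * h t) l). split; [rewrite length_map; reflexivity|].
    intros g [b [k [Hk' Ek]]] Hgp. assert (H := lspan_project l h p Eh k Hk').
    replace g with (fun t => k t - k p / h p * h t); auto. apply functional_extensionality; intro t.
    rewrite Ek in *. apply Rmult_eq_reg_r with (h p); auto. replace (k p) with (- b * h p) by lra. field; auto.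
Qed.

(** Passing to the functions that vanish at the last point removes one generator and one member of
    the system. *)
Lemma no_large_dual_system l : forall (g : nat -> Cantor -> R) (p : nat -> Cantor),
  (forall i, (i <= length l)%nat -> lspan l (g i)) ->
  (forall i j, g i (p j) = if (i =? j)%nat then 1 else 0) -> False.
Proof.
  remember (length l) as n eqn:En. revert l En. induction n as [|n IH]; intros l En g p Hg Hd.
  - destruct l; [|discriminate]. specialize (Hg 0%nat (Nat.le_refl _) (p 0%nat)). rewrite Hd in Hg. simpl in Hg. lra.
  - destruct (lspan_kernel l (p (S n)) (g (S n)) (Hg _ (Nat.le_refl _))) as [l' [Hl Hk]].
    { rewrite Hd, Nat.eqb_refl. lra. }
    apply (IH l' ltac:(lia) g p); auto. intros i Hi. apply Hk. apply Hg; lia. rewrite Hd.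
    destruct (Nat.eqb_spec i (S n)); [lia|reflexivity].
Qed.

Lemma bk_unit n : bk 0 (S n) (unit_vec n).
Proof. intros k Hk. unfold unit_vec in Hk. destruct (Nat.eqb_spec k n); [lia|lra]. Qed.

Lemma tree_space_infinite_dim T : (forall N, exists m, (N <= m)%nat /\ T (node m) = true) -> infinite_dim (tree_space T).
Proof.
  intros HT [l [Hl1 Hl2]]. destruct (choice _ HT) as [h Hh].
  set (m := fun k => Nat.iter k (fun r => h (S r)) (h 0%nat)).
  assert (Hm : forall k, T (node (m k)) = true). { intro k. destruct k; simpl; apply Hh. }
  assert (Hlt : forall i j, (i < j)%nat -> (m i < m j)%nat).
  { assert (H1 : forall k, (m k < m (S k))%nat). { intro k. simpl. destruct (Hh (S (m k))) as [H1 _]. unfold m in *. lia. }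
    intros i j Hij. induction Hij as [|j Hij IH]; auto. specialize (H1 j). lia. }
  apply (no_large_dual_system l (fun i => comb (unit_vec (m i)) (S (m i))) (fun j => point (m j))).
  - intros i _. apply span_lspan, Hl2. apply tree_space_comb. apply bk_unit.
    intros n Hn. unfold unit_vec in Hn. destruct (Nat.eqb_spec n (m i)) as [E|E]; [rewrite E; auto|lra].
  - intros i j. rewrite comb_point by apply bk_unit. unfold unit_vec.
    destruct (Nat.eqb_spec i j) as [->|Hne]; [rewrite Nat.eqb_refl; reflexivity|].
    destruct (Nat.eqb_spec (m j) (m i)) as [E|]; auto. exfalso.
    destruct (lt_eq_lt_dec i j) as [[H|H]|H]; [specialize (Hlt _ _ H); lia|contradiction|specialize (Hlt _ _ H); lia].
Qed.

Lemma infinite_tree_nodes T : infinite_tree T -> forall N, exists m, (N <= m)%nat /\ T (node m) = true.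
Proof.
  intros HT N. apply NNPP. intro Hno. apply HT. exists (map node (seq 0 N)). intros s Hs.
  apply in_map_iff. exists (idx s). split; [apply node_idx|]. apply in_seq. split; [lia|].
  simpl. apply Nat.nle_gt. intro. apply Hno. exists (idx s). rewrite node_idx. auto.
Qed.

Lemma well_founded_HI T : is_tree T -> well_founded_tree T -> infinite_tree T -> HI (tree_SB T).
Proof.
  intros HT Hwf Hinf. split.
  - apply tree_space_infinite_dim. apply infinite_tree_nodes; auto.
  - apply tree_space_indecomposable; auto.
Qed.

(** * Branches *)

Definition bnode (x : nat -> nat) (k : nat) : nat := idx (map x (seq 0 k)).

Lemma bnode_pre x k k' : (k <= k')%nat -> pre (bnode x k) (bnode x k') = true.
Proof.
  intro H. apply pre_iff. unfold bnode. rewrite !node_idx. exists (map x (seq k (k' - k))).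
  rewrite <- map_app. replace (seq 0 k ++ seq k (k' - k)) with (seq 0 (k + (k' - k))) by (rewrite seq_app; reflexivity).
  f_equal. f_equal. lia.
Qed.

Lemma bnode_inj x k k' : bnode x k = bnode x k' -> k = k'.
Proof. intro H. apply idx_inj in H. apply (f_equal (@length nat)) in H. rewrite !length_map, !length_seq in H. exact H. Qed.

Lemma bnode_lt x k k' : (k < k')%nat -> (bnode x k < bnode x k')%nat.
Proof.
  intro H. pose proof (pre_le _ _ (bnode_pre x k k' ltac:(lia))).
  assert (bnode x k <> bnode x k') by (intro E; apply bnode_inj in E; lia). lia.
Qed.

Lemma bnode_ge x k : (k <= bnode x k)%nat.
Proof. induction k as [|k IH]; [lia|]. pose proof (bnode_lt x k (S k) ltac:(lia)). lia. Qed.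

Definition on_branch (x : nat -> nat) (v : nat -> R) : Prop := forall n, v n <> 0 -> exists k, n = bnode x k.

(** The chain ending at [bnode x b] contains every node of the branch of index below [b], so one
    functional with the signs of [v] reaches the l_1 norm. *)
Lemma branch_norm x b v : bk 0 b v -> on_branch x v -> l1n b v <= nrm v.
Proof.
  intros Hv Hx. set (p := bnode x b). pose proof (bnode_ge x b) as Hbp. fold p in Hbp.
  set (s := map (fun n => if Rle_dec 0 (v n) then true else false) (seq 0 b)).
  apply Rle_trans with (Rabs (ap (Gr 0 b p s) v)).
  2:{ apply nrm_ub. eapply bk_fs; eauto. constructor. }
  eapply Rle_trans; [|apply Rle_abs]. simpl ap.
  change (l1n b v <= bsum (S p) (fun n => gc p s n * restr 0 b v n)). rewrite restr_in by auto.
  rewrite (bsum_tail b (S p)).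
  - unfold l1n. apply bsum_le. intros n Hn. destruct (Req_dec (v n) 0) as [E|E]; [rewrite E, Rabs_R0; lra|].
    destruct (Hx n E) as [k ->]. unfold gc.
    assert (Hpre : pre (bnode x k) p = true). { apply bnode_pre. pose proof (bnode_ge x k). lia. }
    rewrite Hpre. unfold s. rewrite nth_map_seq by auto.
    destruct (Rle_dec 0 (v (bnode x k))). rewrite Rabs_pos_eq by auto. lra. rewrite Rabs_left by lra. lra.
  - lia.
  - intros k Hk. rewrite (bk_out _ _ _ _ Hv) by lia. ring.
Qed.

Definition bvec (x : nat -> nat) (a : nat -> R) (N : nat) : nat -> R :=
  vsum N (fun k => vscal (a k) (unit_vec (bnode x k))).

Lemma bk_bvec x a N : bk 0 (bnode x N) (bvec x a N).
Proof.
  intros n Hn. split; [lia|]. apply NNPP. intro H. apply Hn. unfold bvec, vsum. apply bsum_0. intros k Hk.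
  unfold vscal, unit_vec. destruct (Nat.eqb_spec n (bnode x k)) as [E|]; [|ring].
  pose proof (bnode_lt x k N Hk). lia.
Qed.

Lemma bvec_branch x a N n : bvec x a N n <> 0 -> exists k, n = bnode x k.
Proof.
  intro Hn. apply NNPP. intro H. apply Hn. unfold bvec, vsum. apply bsum_0. intros k Hk.
  unfold vscal, unit_vec. destruct (Nat.eqb_spec n (bnode x k)) as [E|]; [exfalso; eauto|ring].
Qed.

Lemma bvec_l1 x a N b : (bnode x N <= b)%nat -> bsum N (fun k => Rabs (a k)) = l1n b (bvec x a N).
Proof.
  intro Hb. induction N as [|N IH].
  - simpl. symmetry. apply bsum_0. intros. unfold bvec, vsum. simpl. apply Rabs_R0.
  - pose proof (pre_le _ _ (bnode_pre x N (S N) ltac:(lia))).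
    assert (Hne : bnode x N <> bnode x (S N)) by (intro E'; apply bnode_inj in E'; lia).
    simpl. rewrite IH by lia. unfold l1n.
    assert (E : Rabs (a N) = bsum b (fun n => Rabs (a N) * unit_vec (bnode x N) n)).
    { rewrite bsum_scal, (bsum_single b (bnode x N)); [|lia|].
      - unfold unit_vec. rewrite Nat.eqb_refl. ring.
      - intros k Hk Hkn. unfold unit_vec. destruct (Nat.eqb_spec k (bnode x N)); [contradiction|reflexivity]. }
    rewrite E, <- bsum_plus. apply bsum_ext. intros n Hn. unfold bvec, vsum. simpl. unfold vscal at 3.
    destruct (Nat.eqb_spec n (bnode x N)) as [->|Hnn].
    + fold (vsum N (fun k => vscal (a k) (unit_vec (bnode x k))) (bnode x N)). fold (bvec x a N).
      rewrite (bk_out _ _ _ _ (bk_bvec x a N)) by lia. unfold unit_vec. rewrite Nat.eqb_refl, Rabs_R0, !Rplus_0_l, !Rmult_1_r. reflexivity.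
    + unfold unit_vec at 2 4. destruct (Nat.eqb_spec n (bnode x N)); [contradiction|]. rewrite !Rmult_0_r, !Rplus_0_r. reflexivity.
Qed.

Lemma l1_facts a : l1 a -> (forall N, bsum N (fun k => Rabs (a k)) <= l1norm a) /\
  forall d, 0 < d -> exists N, l1norm a - bsum N (fun k => Rabs (a k)) < d.
Proof.
  intro Ha. assert (Hs : is_series (fun k => Rabs (a k)) (l1norm a)) by (apply Series_correct; exact Ha).
  assert (Hl : is_lim_seq (fun n => bsum (S n) (fun k => Rabs (a k))) (Finite (l1norm a))).
  { apply (is_lim_seq_ext (sum_n (fun k => Rabs (a k)))); [|exact Hs].
    intro n. induction n as [|n IH]. rewrite sum_O. simpl. ring. rewrite sum_Sn, IH. reflexivity. }
  assert (Hinc : forall n m, (n <= m)%nat -> bsum n (fun k => Rabs (a k)) <= bsum m (fun k => Rabs (a k))).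
  { intros n m H. induction H as [|m H IH]; [lra|]. simpl. pose proof (Rabs_pos (a m)). lra. }
  split.
  - intro N. assert (Rbar_le (Finite (bsum N (fun k => Rabs (a k)))) (Finite (l1norm a))); auto.
    apply (is_lim_seq_le_loc (fun _ => bsum N (fun k => Rabs (a k))) (fun n => bsum (S n) (fun k => Rabs (a k)))); [|apply is_lim_seq_const|exact Hl].
    exists N. intros n Hn. apply Hinc. lia.
  - intros d Hd. apply is_lim_seq_spec in Hl. destruct (Hl (mkposreal d Hd)) as [N HN]. specialize (HN N (Nat.le_refl N)). simpl in HN.
    exists (S N). simpl. apply Rabs_def2 in HN. lra.
Qed.

Lemma bvec_sub_nb x a n m b : (n <= m)%nat -> (bnode x m <= b)%nat ->
  nb (fun t => comb (bvec x a m) b t - comb (bvec x a n) b t) (bsum m (fun k => Rabs (a k)) - bsum n (fun k => Rabs (a k))).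
Proof.
  intros H Hb. induction H as [|m H IH]; intro t.
  - rewrite !Rminus_diag, Rabs_R0. lra.
  - pose proof (bnode_lt x m (S m) ltac:(lia)). specialize (IH ltac:(lia) t). simpl in IH.
    assert (E : comb (bvec x a (S m)) b t = comb (bvec x a m) b t + a m * comb (unit_vec (bnode x m)) b t).
    { unfold bvec. rewrite !comb_vsum. simpl. unfold vscal at 2. rewrite comb_scal. reflexivity. }
    rewrite E. simpl.
    replace (comb (bvec x a m) b t + a m * comb (unit_vec (bnode x m)) b t - comb (bvec x a n) b t) with
      ((comb (bvec x a m) b t - comb (bvec x a n) b t) + a m * comb (unit_vec (bnode x m)) b t) by ring.
    eapply Rle_trans; [apply Rabs_triang|]. rewrite Rabs_mult.
    assert (Rabs (comb (unit_vec (bnode x m)) b t) <= 1).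
    { assert (Hbu : bk 0 b (unit_vec (bnode x m))).
      { eapply bk_weaken; [apply bk_unit|lia|lia]. }
      eapply Rle_trans; [apply comb_nb; auto|].
      apply nrm_le. intros f Hf. eapply Rle_trans; [apply (ap_l1 f b); auto|].
      unfold l1n. rewrite (bsum_single b (bnode x m)).
      - unfold unit_vec. rewrite Nat.eqb_refl, Rabs_R1. lra.
      - apply (Hbu (bnode x m)). unfold unit_vec. rewrite Nat.eqb_refl. lra.
      - intros k _ Hk. unfold unit_vec. destruct (Nat.eqb_spec k (bnode x m)); [contradiction|apply Rabs_R0]. }
    pose proof (Rabs_pos (a m)). nra.
Qed.

Definition bcomb x a N : Cantor -> R := comb (bvec x a N) (bnode x N).

Lemma bcomb_nb x a n m : (n <= m)%nat ->
  nb (fun t => bcomb x a m t - bcomb x a n t) (bsum m (fun k => Rabs (a k)) - bsum n (fun k => Rabs (a k))).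
Proof.
  intro H. unfold bcomb. rewrite <- (comb_extend (bvec x a n) (bnode x n) (bnode x m)).
  apply bvec_sub_nb; auto. apply bk_bvec. apply pre_le, bnode_pre; auto.
Qed.

Lemma bcomb_bsum x a N t : bcomb x a N t = bsum N (fun k => a k * phi (bnode x k) t).
Proof.
  unfold bcomb, bvec. rewrite comb_vsum. apply bsum_ext. intros k Hk. unfold vscal. rewrite comb_scal. f_equal.
  unfold comb. assert (bnode x k < bnode x N)%nat.
  { apply bnode_lt; auto. }
  rewrite (bsum_single _ (bnode x k)); auto. unfold unit_vec. rewrite Nat.eqb_refl. ring.
  intros i _ Hi. unfold unit_vec. destruct (Nat.eqb_spec i (bnode x k)); [contradiction|ring].
Qed.

Lemma small_zero r : (forall d, 0 < d -> Rabs r <= d) -> r = 0.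
Proof.
  intro H. apply NNPP. intro Hne. pose proof (Rabs_pos_lt r Hne). specialize (H (Rabs r / 2) ltac:(lra)). lra.
Qed.

(** The partial sums along the branch carry the l_1 norm, so the limit map is isometric. Linearity
    passes from partial sums to limits; outside l_1 the values do not matter. *)
Lemma ill_founded_l1 T : ill_founded T -> embeds_l1 (tree_SB T).
Proof.
  intros [x Hx].
  assert (Hex : forall a, exists f, l1 a -> cont f /\ forall N, nb (fun t => f t - bcomb x a N t) (l1norm a - bsum N (fun k => Rabs (a k)))).
  { intro a. destruct (classic (l1 a)) as [Ha|Ha]; [|exists (fun _ => 0); tauto].
    destruct (l1_facts a Ha) as [H1 H2].
    destruct (uniform_complete (bcomb x a) (fun N => l1norm a - bsum N (fun k => Rabs (a k)))) as [f Hf].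
    - intro; apply comb_cont.
    - intros n m H. eapply nb_le; [apply bcomb_nb; auto|]. specialize (H1 m). lra.
    - exact H2.
    - exists f. auto. }
  destruct (choice _ Hex) as [L HL]. exists L.
  assert (Htail : forall a, l1 a -> forall d, 0 < d -> exists N, forall M, (N <= M)%nat -> l1norm a - bsum M (fun k => Rabs (a k)) < d).
  { intros a Ha d Hd. destruct (proj2 (l1_facts a Ha) d Hd) as [N HN]. exists N. intros M HM.
    assert (bsum N (fun k => Rabs (a k)) <= bsum M (fun k => Rabs (a k))); [|lra].
    clear HN. induction HM as [|M HM IH]; [lra|]. simpl. pose proof (Rabs_pos (a M)). lra. }
  split; [|split; [|split]].
  - intros a Ha. destruct (HL a Ha) as [H1 H2]. split; auto. intros e He.
    destruct (Htail a Ha e He) as [N HN]. exists (bvec x a N), (bnode x N). split; [apply bk_bvec|]. split.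
    + intros n Hn. destruct (bvec_branch x a N n Hn) as [k ->]. unfold bnode. rewrite node_idx. apply Hx.
    + eapply nb_le; [apply H2|]. left. apply HN; auto.
  - intros a b Ha Hb t.
    assert (Hab : l1 (fun n => a n + b n)).
    { apply (ex_series_le (fun n => Rabs (a n + b n)) (fun n => Rabs (a n) + Rabs (b n))).
      - intro n. unfold norm; simpl. unfold abs; simpl. rewrite Rabs_Rabsolu. apply Rabs_triang.
      - apply (ex_series_plus (fun n => Rabs (a n)) (fun n => Rabs (b n))); auto. }
    enough (L (fun n => a n + b n) t - (L a t + L b t) = 0) by lra. apply small_zero. intros d Hd.
    destruct (Htail _ Hab (d / 3) ltac:(lra)) as [N1 HN1], (Htail _ Ha (d / 3) ltac:(lra)) as [N2 HN2], (Htail _ Hb (d / 3) ltac:(lra)) as [N3 HN3].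
    set (N := Nat.max N1 (Nat.max N2 N3)).
    specialize (HN1 N ltac:(lia)). specialize (HN2 N ltac:(lia)). specialize (HN3 N ltac:(lia)).
    pose proof (proj2 (HL _ Hab) N t) as E1. pose proof (proj2 (HL _ Ha) N t) as E2. pose proof (proj2 (HL _ Hb) N t) as E3.
    cbv beta in E1, E2, E3. rewrite bcomb_bsum in E1, E2, E3.
    rewrite (bsum_ext N (fun k => (a k + b k) * phi (bnode x k) t) (fun k => a k * phi (bnode x k) t + b k * phi (bnode x k) t)) in E1 by (intros; ring).
    rewrite bsum_plus in E1. apply Rabs_le_between in E1, E2, E3. apply Rabs_le_between. lra.
  - intros c a Ha t.
    assert (Hca : l1 (fun n => c * a n)).
    { apply (ex_series_ext (fun n => Rabs c * Rabs (a n))). intro; symmetry; apply Rabs_mult.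
      apply (ex_series_scal (Rabs c) (fun n => Rabs (a n))). exact Ha. }
    enough (L (fun n => c * a n) t - c * L a t = 0) by lra. apply small_zero. intros d Hd. pose proof (Rabs_pos c) as Hc.
    destruct (Htail _ Hca (d / 2) ltac:(lra)) as [N1 HN1], (Htail _ Ha (d / 2 / (Rabs c + 1))) as [N2 HN2]; [apply Rdiv_lt_0_compat; lra|].
    set (N := Nat.max N1 N2). specialize (HN1 N ltac:(lia)). specialize (HN2 N ltac:(lia)).
    pose proof (proj2 (HL _ Hca) N t) as E1. pose proof (proj2 (HL _ Ha) N t) as E2.
    cbv beta in E1, E2. rewrite bcomb_bsum in E1, E2.
    rewrite (bsum_ext N (fun k => (c * a k) * phi (bnode x k) t) (fun k => c * (a k * phi (bnode x k) t))) in E1 by (intros; ring).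
    rewrite bsum_scal in E1. set (u := bsum N (fun k => a k * phi (bnode x k) t)) in *.
    replace (L (fun n => c * a n) t - c * L a t) with ((L (fun n => c * a n) t - c * u) - c * (L a t - u)) by ring.
    eapply Rle_trans; [apply Rabs_triang|]. rewrite Rabs_Ropp, Rabs_mult.
    assert (Rabs c * Rabs (L a t - u) <= (Rabs c + 1) * (d / 2 / (Rabs c + 1))).
    { apply Rmult_le_compat; auto using Rabs_pos; lra. }
    replace ((Rabs c + 1) * (d / 2 / (Rabs c + 1))) with (d / 2) in H by (field; lra). lra.
  - exists 1, 1. split; [lra|]. split; [lra|]. intros a Ha. destruct (HL a Ha) as [H1 H2]. rewrite !Rmult_1_l. split.
    + apply Rnot_lt_le. intro Hlt. destruct (Htail a Ha ((l1norm a - supnorm (L a)) / 2) ltac:(lra)) as [N HN]. specialize (HN N (Nat.le_refl N)).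
      assert (Hn : nrm (bvec x a N) <= supnorm (L a) + (l1norm a - bsum N (fun k => Rabs (a k)))).
      { apply (nrm_comb _ (bnode x N)); [apply bk_bvec|]. fold (bcomb x a N).
        eapply nb_ext; [apply (nb_sub _ _ _ _ (supnorm_nb _ H1) (H2 N))|]. intro; simpl; ring. }
      assert (Hb : l1n (bnode x N) (bvec x a N) <= nrm (bvec x a N)).
      { apply (branch_norm x). apply bk_bvec. intros n Hne. apply (bvec_branch x a N n Hne). }
      rewrite <- (bvec_l1 x a N (bnode x N)) in Hb by lia. lra.
    + apply nb_supnorm. specialize (H2 0%nat). eapply nb_ext; [eapply nb_le; [exact H2|simpl; lra]|].
      intro t; simpl. rewrite bcomb_bsum. simpl. ring.
Qed.

(** * Ill-founded trees give decomposable subspaces *)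

Definition branch_part (x : nat -> nat) (P : nat -> Prop) : TrSpace := fun s =>
  if excluded_middle_informative (exists k, P k /\ s = map x (seq 0 k)) then true else false.

Lemma branch_part_iff x P s : branch_part x P s = true <-> exists k, P k /\ s = map x (seq 0 k).
Proof. unfold branch_part. destruct (excluded_middle_informative _); split; auto; try congruence; tauto. Qed.

Lemma branch_part_node x P n : branch_part x P (node n) = true <-> exists k, P k /\ n = bnode x k.
Proof.
  rewrite branch_part_iff. split; intros [k [Hk E]]; exists k; split; auto.
  - unfold bnode. rewrite <- E. symmetry; apply idx_node.
  - rewrite E. apply node_idx.
Qed.

Lemma tree_space_mono T T' f : (forall s, T s = true -> T' s = true) -> tree_space T f -> tree_space T' f.
Proof.
  intros H [H1 H2]. split; auto. intros e He. destruct (H2 e He) as [v [b [Hv [Tv Ev]]]]. exists v, b. split; auto.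
  split; auto. intros n Hn. auto.
Qed.

Definition select (T : TrSpace) (v : nat -> R) : nat -> R := fun n => if T (node n) then v n else 0.

Lemma bk_select T a b v : bk a b v -> bk a b (select T v).
Proof. intros H n Hn. apply H. unfold select in Hn. destruct (T (node n)); auto. Qed.

Lemma select_in T v : in_tree T (select T v).
Proof. intros n Hn. unfold select in Hn. destruct (T (node n)); auto. Qed.

(** Along a branch the norm is the l_1 norm, for which coordinate projections are contractions. *)
Lemma select_norm x T b v : bk 0 b v -> on_branch x v -> nrm (select T v) <= nrm v.
Proof.
  intros Hv Hx. eapply Rle_trans; [|apply (branch_norm x b); auto].
  apply nrm_le. intros f Hf. eapply Rle_trans; [apply (ap_l1 f b); auto; apply bk_select; auto|].
  apply bsum_le. intros k _. unfold select. destruct (T (node k)); [lra|]. rewrite Rabs_R0. apply Rabs_pos.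
Qed.

Lemma bk_sub a b u v : bk a b u -> bk a b v -> bk a b (fun n => u n - v n).
Proof. intros Hu Hv n Hn. destruct (Req_dec (u n) 0); [apply Hv; lra|auto]. Qed.

(** The span of the branch is the direct sum of the spans of its even and its odd levels. *)
Lemma ill_founded_not_HI T : ill_founded T -> ~ HI (tree_SB T).
Proof.
  intros [x Hx] [_ HHI].
  set (TE := branch_part x (fun k => Nat.even k = true)). set (TO := branch_part x (fun k => Nat.even k = false)).
  set (TA := branch_part x (fun _ => True)).
  assert (HEA : forall s, TE s = true -> TA s = true).
  { intros s Hs. apply branch_part_iff in Hs. destruct Hs as [k [_ E]]. apply branch_part_iff. eauto. }
  assert (HOA : forall s, TO s = true -> TA s = true).
  { intros s Hs. apply branch_part_iff in Hs. destruct Hs as [k [_ E]]. apply branch_part_iff. eauto. }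
  assert (HA : forall v, in_tree TA v -> on_branch x v).
  { intros v Hv n Hn. apply Hv, branch_part_node in Hn. destruct Hn as [k [_ E]]. eauto. }
  assert (HEO : forall n, TE (node n) = true -> TO (node n) = true -> False).
  { intros n H1 H2. apply branch_part_node in H1, H2. destruct H1 as [k [E1 ->]], H2 as [k' [E2 E3]]. apply bnode_inj in E3. congruence. }
  assert (HAEO : forall n, TA (node n) = true -> TE (node n) = true \/ TO (node n) = true).
  { intros n H1. apply branch_part_node in H1. destruct H1 as [k [_ ->]]. destruct (Nat.even k) eqn:E; [left|right]; apply branch_part_node; eauto. }
  apply (HHI (tree_space TA) (tree_space_closed TA)).
  { intros f. apply tree_space_mono. intros s Hs. apply branch_part_iff in Hs. destruct Hs as [k [_ ->]]. apply Hx. }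
  exists (tree_space TE), (tree_space TO). split; [apply tree_space_closed|]. split; [apply tree_space_closed|]. split; [|split; [|split]].
  - apply tree_space_infinite_dim. intro N. exists (bnode x (2 * N)). split.
    + pose proof (bnode_ge x (2 * N)). lia. + apply branch_part_node. exists (2 * N)%nat. split; auto. rewrite Nat.even_mul. reflexivity.
  - apply tree_space_infinite_dim. intro N. exists (bnode x (S (2 * N))). split.
    + pose proof (bnode_ge x (S (2 * N))). lia. + apply branch_part_node. exists (S (2 * N))%nat. split; auto.
      rewrite Nat.even_succ, Nat.odd_mul. reflexivity.
  - intros f [Hfc HfE] [_ HfO] t. apply small_zero. intros d Hd.
    destruct (HfE (d / 3) ltac:(lra)) as [u [b [Hu [Tu Eu]]]]. destruct (HfO (d / 3) ltac:(lra)) as [v [c [Hv [Tv Ev]]]].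
    set (B := Nat.max b c).
    assert (HuB : bk 0 B u) by (eapply bk_weaken; eauto; unfold B; lia).
    assert (HvB : bk 0 B v) by (eapply bk_weaken; eauto; unfold B; lia).
    rewrite <- (comb_extend u b B) in Eu by (auto; unfold B; lia). rewrite <- (comb_extend v c B) in Ev by (auto; unfold B; lia).
    set (w := fun n => v n - u n). assert (HwB : bk 0 B w) by (apply bk_sub; auto).
    assert (Hw : nrm w <= 2 * (d / 3)).
    { apply (nrm_comb w B); auto. eapply nb_ext; [eapply nb_le; [apply (nb_sub _ _ _ _ Eu Ev)|lra]|]. intro s; simpl. unfold w. rewrite comb_sub. ring. }
    assert (Hsel : select TE w = vscal (-1) u).
    { apply functional_extensionality; intro n. unfold select, w, vscal. destruct (TE (node n)) eqn:E.
      - assert (v n = 0). { apply NNPP. intro Hn. apply (HEO n E). auto. } lra.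
      - assert (u n = 0). { apply NNPP. intro Hn. apply Tu in Hn. congruence. } lra. }
    assert (Hnu : nrm u <= 2 * (d / 3)).
    { eapply Rle_trans; [|exact Hw]. eapply Rle_trans; [|apply (select_norm x TE B w); auto].
      - rewrite Hsel. unfold vscal. rewrite nrm_scal by (eapply bk_fs; eauto). replace (Rabs (-1)) with 1 by (unfold Rabs; destruct Rcase_abs; lra). lra.
      - apply HA. intros n Hn. unfold w in Hn. destruct (Req_dec (u n) 0) as [E|E]; [apply HOA, Tv; lra|apply HEA, Tu; auto]. }
    eapply Rle_trans; [|apply Rle_trans with (d / 3 + 2 * (d / 3)); [|right; field]; apply Rle_refl].
    pose proof (nb_plus _ _ _ _ Eu (comb_nb u B HuB) t) as H. simpl in H.
    replace (f t - comb u B t + comb u B t) with (f t) in H by ring. lra.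
  - intro f. split.
    + intros [Hfc Hf].
      assert (Happ : forall n : nat, exists vb : (nat -> R) * nat, bk 0 (snd vb) (fst vb) /\ in_tree TA (fst vb) /\ nb (fun t => f t - comb (fst vb) (snd vb) t) (1 * / 2 ^ n)).
      { intro n. destruct (Hf (1 * / 2 ^ n)) as [v [b Hvb]]. rewrite Rmult_1_l. apply Rinv_0_lt_compat, pow_lt; lra. exists (v, b). exact Hvb. }
      destruct (choice _ Happ) as [V HV].
      set (v := fun n => fst (V n)). set (b := fun n => snd (V n)).
      (* By [select_norm] the even parts of the approximations form a Cauchy sequence. *)
      destruct (uniform_complete (fun n => comb (select TE (v n)) (b n)) (fun n => 2 * / 2 ^ n)) as [g [Hg Hgn]].
      * intro; apply comb_cont.
      * intros n m Hnm. set (B := Nat.max (b n) (b m)).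
        destruct (HV n) as [Bn [Tn En]], (HV m) as [Bm [Tm Em]]. fold (v n) (b n) in Bn, Tn, En. fold (v m) (b m) in Bm, Tm, Em.
        assert (HnB : bk 0 B (v n)) by (eapply bk_weaken; eauto; unfold B; lia).
        assert (HmB : bk 0 B (v m)) by (eapply bk_weaken; eauto; unfold B; lia).
        rewrite <- (comb_extend (v n) (b n) B) in En by (auto; unfold B; lia). rewrite <- (comb_extend (v m) (b m) B) in Em by (auto; unfold B; lia).
        rewrite <- (comb_extend (select TE (v n)) (b n) B) by (try apply bk_select; auto; unfold B; lia).
        rewrite <- (comb_extend (select TE (v m)) (b m) B) by (try apply bk_select; auto; unfold B; lia).
        set (w := fun i => v m i - v n i). assert (HwB : bk 0 B w) by (apply bk_sub; auto).
        assert (Hpow : / 2 ^ m <= / 2 ^ n). { apply Rinv_le_contravar. apply pow_lt; lra. apply Rle_pow; auto; lra. }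
        assert (Hw : nrm w <= 2 * / 2 ^ n).
        { apply (nrm_comb w B); auto. eapply nb_ext; [eapply nb_le; [apply (nb_sub _ _ _ _ En Em)|lra]|]. intro s; simpl. unfold w. rewrite comb_sub. ring. }
        eapply nb_ext; [eapply nb_le; [apply (comb_nb (select TE w) B); apply bk_select; auto|]|].
        -- eapply Rle_trans; [apply (select_norm x TE B w); auto|exact Hw]. apply HA. intros i Hi. unfold w in Hi.
           destruct (Req_dec (v n i) 0) as [E|E]; [apply Tm; lra|apply Tn; auto].
        -- intro t. simpl. rewrite <- comb_sub. f_equal. apply functional_extensionality; intro i. unfold select, w. destruct (TE (node i)); ring.
      * intros d Hd. destruct (half_pow_small 2 d Hd) as [n Hn]. eauto.
      * assert (HgE : tree_space TE g).
        { split; auto. intros e He. destruct (half_pow_small 2 e He) as [n Hn]. exists (select TE (v n)), (b n).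
          split; [apply bk_select, HV|]. split; [apply select_in|]. eapply nb_le; [apply Hgn|lra]. }
        exists g, (fun t => f t - g t). split; auto. split; [|intro; ring].
        split; [apply cont_sub; auto|]. intros e He. destruct (half_pow_small 3 e He) as [n Hn].
        destruct (HV n) as [Bn [Tn En]]. fold (v n) (b n) in Bn, Tn, En.
        exists (fun i => v n i - select TE (v n) i), (b n). split; [apply bk_sub; auto; apply bk_select; auto|]. split.
        -- intros i Hi. unfold select in Hi. destruct (TE (node i)) eqn:E; [lra|]. destruct (HAEO i) as [H|H]; auto; [apply Tn; lra|congruence].
        -- eapply nb_ext; [eapply nb_le; [apply (nb_sub _ _ _ _ En (Hgn n))|lra]|]. intro t; simpl. rewrite comb_sub. ring.
    + intros [g [h [Hg [Hh E]]]].
      replace f with (fun t => g t + h t) by (apply functional_extensionality; intro; auto).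
      apply cs_plus; [apply tree_space_closed|apply (tree_space_mono TE TA)|apply (tree_space_mono TO TA)]; auto.
Qed.

(** * Calculus of sigma-algebras *)

Lemma sa_ext {X} (S : (X -> Prop) -> Prop) (A B : X -> Prop) : sigma_algebra S -> (forall x, A x <-> B x) -> S A -> S B.
Proof. intros [H _]. apply H. Qed.

Lemma sa_not {X} (S : (X -> Prop) -> Prop) A : sigma_algebra S -> S A -> S (fun x => ~ A x).
Proof. intros [_ [_ [H _]]]. apply H. Qed.

Lemma sa_ex {X} (S : (X -> Prop) -> Prop) (F : nat -> X -> Prop) : sigma_algebra S -> (forall n, S (F n)) -> S (fun x => exists n, F n x).
Proof. intros [_ [_ [_ H]]]. apply H. Qed.

Lemma sa_const {X} (S : (X -> Prop) -> Prop) (P : Prop) : sigma_algebra S -> S (fun _ => P).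
Proof.
  intro HS. assert (HT : S (fun _ => True)) by apply HS.
  destruct (classic P) as [HP|HP].
  - apply (sa_ext S (fun _ => True)); auto. tauto.
  - apply (sa_ext S (fun _ => ~ True)); auto. tauto. apply sa_not; auto.
Qed.

Lemma sa_all {X} (S : (X -> Prop) -> Prop) (F : nat -> X -> Prop) : sigma_algebra S -> (forall n, S (F n)) -> S (fun x => forall n, F n x).
Proof.
  intros HS HF. apply (sa_ext S (fun x => ~ exists n, ~ F n x)); auto.
  - intro x. split; intro H.
    + intro n. apply NNPP. intro Hn. apply H. eauto.
    + intros [n Hn]. auto.
  - apply sa_not; auto. apply (sa_ex S (fun n x => ~ F n x)); auto. intro; apply sa_not; auto.
Qed.

Lemma sa_and {X} (S : (X -> Prop) -> Prop) (A B : X -> Prop) : sigma_algebra S -> S A -> S B -> S (fun x => A x /\ B x).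
Proof.
  intros HS HA HB. apply (sa_ext S (fun x => forall n : nat, match n with O => A x | _ => B x end)); auto.
  - intro x. split; intro H. exact (conj (H 0%nat) (H 1%nat)). intros [|n]; apply H.
  - apply (sa_all S (fun n x => match n with O => A x | _ => B x end)); auto. intros [|n]; auto.
Qed.

Lemma sa_imp {X} (S : (X -> Prop) -> Prop) (A B : X -> Prop) : sigma_algebra S -> S A -> S B -> S (fun x => A x -> B x).
Proof.
  intros HS HA HB. apply (sa_ext S (fun x => ~ (A x /\ ~ B x))); auto.
  - intro x. split; [|tauto]. intros H HAx. apply NNPP. tauto.
  - apply sa_not; auto. apply sa_and; auto. apply sa_not; auto.
Qed.

Lemma sa_sigma_gen {X} (G : (X -> Prop) -> Prop) : sigma_algebra (sigma_gen G).
Proof.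
  split; [|split; [|split]].
  - intros A B H HA S HS HG. apply (sa_ext S A); auto. apply HA; auto.
  - intros S HS HG. apply (sa_const S True); auto.
  - intros A HA S HS HG. apply sa_not; auto. apply HA; auto.
  - intros F HF S HS HG. apply sa_ex; auto. intro n. apply HF; auto.
Qed.

Lemma sa_preimage {X Y} (S : (X -> Prop) -> Prop) (f : X -> Y) : sigma_algebra S -> sigma_algebra (fun B => S (fun x => B (f x))).
Proof.
  intro HS. split; [|split; [|split]].
  - intros A B H HA. apply (sa_ext S (fun x => A (f x))); [auto|intro; apply H|exact HA].
  - apply (sa_const S True); auto.
  - intros A HA. apply (sa_not S (fun x => A (f x))); auto.
  - intros F HF. apply (sa_ex S (fun n x => F n (f x))); auto.
Qed.

Lemma sigma_gen_preimage {X Y} (S : (X -> Prop) -> Prop) (G : (Y -> Prop) -> Prop) (f : X -> Y) : sigma_algebra S ->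
  (forall B, G B -> S (fun x => B (f x))) -> forall B, sigma_gen G B -> S (fun x => B (f x)).
Proof. intros HS HG B HB. apply (HB (fun B => S (fun x => B (f x)))); auto. apply sa_preimage; auto. Qed.

(** * The map from trees to subspaces is Borel *)

Definition qn (m : nat) : R := let (i, r) := Cantor.of_nat m in let (j, l) := Cantor.of_nat r in (INR i - INR j) / INR (S l).

Lemma qn_dense r e : 0 < e -> exists m, Rabs (qn m - r) <= e.
Proof.
  intro He. destruct (inv_small e He) as [L HL].
  assert (HLp : 0 < INR (S L)) by (apply lt_0_INR; lia).
  destruct (INR_unbounded (Rabs r)) as [s Hs]. pose proof (Rle_abs (- r)) as Hr. rewrite Rabs_Ropp in Hr.
  destruct (least (fun i => (r + INR s) * INR (S L) <= INR i)) as [i [Hi Hmin]].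
  { destruct (INR_unbounded ((r + INR s) * INR (S L))) as [k Hk]. exists k. lra. }
  exists (Cantor.to_nat (i, Cantor.to_nat ((s * S L)%nat, L))). unfold qn. rewrite !Cantor.cancel_of_to, mult_INR.
  replace ((INR i - INR s * INR (S L)) / INR (S L) - r) with ((INR i - (r + INR s) * INR (S L)) * / INR (S L)) by (field; lra).
  assert (Hlt : INR i - (r + INR s) * INR (S L) <= 1).
  { destruct i as [|i]. change (INR 0) with 0. nra. assert (H := Hmin i ltac:(lia)). rewrite S_INR. lra. }
  assert (Hp : 0 < / INR (S L)) by (apply Rinv_0_lt_compat; auto).
  rewrite Rabs_pos_eq by (apply Rmult_le_pos; lra). nra.
Qed.

Lemma qn_0 : qn 0 = 0.
Proof. unfold qn. simpl. field. Qed.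

(** Nodes serve a second time, as codes of finite rational sequences; the default entry and
    [qn 0 = 0] make the support finite. *)
Definition rvec (k : nat) : nat -> R := fun n => qn (nth n (node k) 0%nat).

Lemma bk_rvec k : bk 0 (length (node k)) (rvec k).
Proof.
  intros n Hn. split; [lia|]. apply Nat.nle_gt. intro H. apply Hn. unfold rvec. rewrite nth_overflow by auto. apply qn_0.
Qed.

(** Zero coordinates receive the code 0 and stay zero, so the support remains in [T]. *)
Lemma rational_approx T f e : tree_space T f -> 0 < e ->
  exists k, in_tree T (rvec k) /\ nb (fun t => f t - comb (rvec k) (length (node k)) t) e.
Proof.
  intros [_ Hf] He. destruct (Hf (e / 2) ltac:(lra)) as [v [b [Hv [Tv Ev]]]].
  set (d := e / 2 / (INR b + 1)). pose proof (pos_INR b) as Hb0.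
  assert (Hd : 0 < d) by (unfold d; apply Rdiv_lt_0_compat; lra).
  assert (Hq : forall n, exists m, Rabs (v n - qn m) <= d /\ (v n = 0 -> m = 0%nat)).
  { intro n. destruct (Req_dec (v n) 0) as [E|E].
    - exists 0%nat. rewrite qn_0, E, Rminus_0_r, Rabs_R0. split; [lra|auto].
    - destruct (qn_dense (v n) d Hd) as [m Hm]. exists m. rewrite Rabs_minus_sym. tauto. }
  destruct (choice _ Hq) as [m Hm].
  set (l := map m (seq 0 b)). exists (idx l).
  assert (Hlen : length (node (idx l)) = b) by (rewrite node_idx; unfold l; rewrite length_map, length_seq; reflexivity).
  assert (Hr : forall n, (n < b)%nat -> rvec (idx l) n = qn (m n)).
  { intros n Hn. unfold rvec. rewrite node_idx. unfold l. rewrite nth_map_seq by auto. reflexivity. }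
  assert (Hbr := bk_rvec (idx l)). rewrite Hlen in *. split.
  - intros n Hn. pose proof (Hbr n Hn) as Hnb. rewrite Hr in Hn by lia. apply Tv. intro E. apply Hn. rewrite (proj2 (Hm n) E). apply qn_0.
  - set (w := fun n => v n - rvec (idx l) n). assert (Hw : bk 0 b w) by (apply bk_sub; auto).
    assert (Hnw : nrm w <= e / 2).
    { eapply Rle_trans; [apply (nrm_head b w d Hw)|].
      - intros i Hi. unfold w. rewrite Hr by auto. apply Hm.
      - unfold d. apply Rle_trans with ((INR b + 1) * (e / 2 / (INR b + 1))).
        apply Rmult_le_compat_r; [unfold d in Hd; lra|lra]. right; field; lra. }
    eapply nb_ext; [eapply nb_le; [apply (nb_plus _ _ _ _ Ev (comb_nb w b Hw))|lra]|]. intro t; simpl. unfold w. rewrite comb_sub. ring.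
Qed.

(** Rational vectors supported in [T] are dense in its space, so meeting an open set is a countable
    condition on the values of [T]. *)
Lemma tree_SB_borel B : effros_borel B -> tr_borel (fun T => B (tree_SB T)).
Proof.
  apply (sigma_gen_preimage tr_borel effros_gen tree_SB). apply sa_sigma_gen.
  clear B. intros B [U [HU HB]].
  apply (sa_ext tr_borel (fun T => exists k, U (comb (rvec k) (length (node k))) /\ forall n, rvec k n <> 0 -> T (node n) = true)).
  - apply sa_sigma_gen.
  - intro T. rewrite HB. split.
    + intros [k [Hk HT]]. exists (comb (rvec k) (length (node k))). split; auto. apply tree_space_comb; auto. apply bk_rvec.
    + intros [f [Hf HUf]]. destruct (HU f HUf) as [Hc [e [He Hball]]].
      destruct (rational_approx T f (e / 2) Hf ltac:(lra)) as [k [Tk Ek]]. exists k. split; auto.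
      apply Hball; [apply comb_cont|]. apply Rle_lt_trans with (e / 2); [|lra].
      apply nb_supnorm. intro t. rewrite Rabs_minus_sym. apply Ek.
  - apply (sa_ex tr_borel (fun k T => U (comb (rvec k) (length (node k))) /\ forall n, rvec k n <> 0 -> T (node n) = true)); [apply sa_sigma_gen|].
    intro k. apply sa_and; [apply sa_sigma_gen|apply sa_const, sa_sigma_gen|].
    apply (sa_all tr_borel (fun n T => rvec k n <> 0 -> T (node n) = true)); [apply sa_sigma_gen|]. intro n.
    apply sa_imp; [apply sa_sigma_gen|apply sa_const, sa_sigma_gen|].
    intros S HS HG. apply HG. exists (node n). reflexivity.
Qed.

(** * Suslin schemes *)

(** The Suslin operation over [G]; the sets [F s] need not decrease along [s]. *)
Definition Suslin {X : Type} (G : (X -> Prop) -> Prop) (C : X -> Prop) : Prop :=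
  exists F : list nat -> X -> Prop, (forall s, G (F s)) /\
    forall x, C x <-> exists z : nat -> nat, forall n, F (map z (seq 0 n)) x.

Lemma Suslin_ext {X} (G : (X -> Prop) -> Prop) C D : (forall x, C x <-> D x) -> Suslin G C -> Suslin G D.
Proof. intros H [F [HF HC]]. exists F. split; auto. intro x. rewrite <- H. apply HC. Qed.

Lemma Suslin_base {X} (G : (X -> Prop) -> Prop) C : G C -> Suslin G C.
Proof.
  intro H. exists (fun _ => C). split; auto. intro x. split.
  - intros Hx. exists (fun _ => 0%nat). auto.
  - intros [z Hz]. exact (Hz 0%nat).
Qed.

Lemma Suslin_union {X} (G : (X -> Prop) -> Prop) (C : nat -> X -> Prop) : G (fun _ => True) ->
  (forall i, Suslin G (C i)) -> Suslin G (fun x => exists i, C i x).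
Proof.
  intros HT HC. destruct (choice _ HC) as [F HF].
  exists (fun s => match s with nil => fun _ => True | i :: s => F i s end). split.
  - intros [|i s]; auto. apply HF.
  - intro x. split.
    + intros [i Hi]. apply HF in Hi. destruct Hi as [z Hz]. exists (fun k => match k with O => i | S k => z k end).
      intros [|n]; [exact I|]. rewrite map_seq_S. apply Hz.
    + intros [z Hz]. exists (z 0%nat). apply HF. exists (fun k => z (S k)). intro n. specialize (Hz (S n)). rewrite map_seq_S in Hz. exact Hz.
Qed.

(** One sequence codes a sequence of branches by pairing. At length [to_nat (i, m)] the first [m]
    entries of branch [i] have been read, and they are tested there. *)
Lemma Suslin_inter {X} (G : (X -> Prop) -> Prop) (C : nat -> X -> Prop) :
  (forall i, Suslin G (C i)) -> Suslin G (fun x => forall i, C i x).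
Proof.
  intros HC. destruct (choice _ HC) as [F HF].
  set (row := fun (s : list nat) i m => map (fun j => nth (Cantor.to_nat (i, j)) s 0%nat) (seq 0 m)).
  exists (fun s => let (i, m) := Cantor.of_nat (length s) in F i (row s i m)). split.
  - intro s. destruct (Cantor.of_nat (length s)) as [i m]. apply HF.
  - assert (Hrow : forall (z : nat -> nat) i m, row (map z (seq 0 (Cantor.to_nat (i, m)))) i m = map (fun j => z (Cantor.to_nat (i, j))) (seq 0 m)).
    { intros z i m. unfold row. apply map_ext_in. intros j Hj. apply in_seq in Hj.
      assert (Hlt : (Cantor.to_nat (i, j) < Cantor.to_nat (i, m))%nat).
      { pose proof (to_nat_mono i j i m (Nat.le_refl _) ltac:(lia)).
        assert (Cantor.to_nat (i, j) <> Cantor.to_nat (i, m)); [|lia]. intro E. apply Cantor.to_nat_inj in E. injection E; lia. }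
      apply nth_map_seq; auto. }
    intro x. split.
    + intro Hx. assert (Hz : forall i, exists z : nat -> nat, forall n, F i (map z (seq 0 n)) x) by (intro i; apply HF; auto).
      destruct (choice _ Hz) as [z Hz'].
      set (w := fun k => let (i, j) := Cantor.of_nat k in z i j). exists w. intro n.
      rewrite length_map, length_seq. destruct (Cantor.of_nat n) as [i m] eqn:E.
      assert (En : n = Cantor.to_nat (i, m)) by (rewrite <- E; symmetry; apply Cantor.cancel_to_of). rewrite En, Hrow.
      replace (map (fun j => w (Cantor.to_nat (i, j))) (seq 0 m)) with (map (z i) (seq 0 m)); auto.
      apply map_ext. intro j. unfold w. rewrite Cantor.cancel_of_to. reflexivity.
    + intros [z Hz] i. apply HF. exists (fun j => z (Cantor.to_nat (i, j))). intro m.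
      specialize (Hz (Cantor.to_nat (i, m))). rewrite length_map, length_seq, Cantor.cancel_of_to, Hrow in Hz. exact Hz.
Qed.

(** Asking the same of the complement closes the class under complements; it then contains all
    generated sets as soon as it contains the generators. *)
Lemma sa_bi_Suslin {X} (G : (X -> Prop) -> Prop) : G (fun _ => True) -> G (fun _ => False) ->
  sigma_algebra (fun C => Suslin G C /\ Suslin G (fun x => ~ C x)).
Proof.
  intros HT HF. split; [|split; [|split]].
  - intros A B H [H1 H2]. split; eapply Suslin_ext; eauto. intro x; simpl. rewrite H. tauto.
  - split. apply Suslin_base; auto. apply (Suslin_ext G (fun _ => False)); [tauto|]. apply Suslin_base; auto.
  - intros A [H1 H2]. split; auto. apply (Suslin_ext G A); auto. intro x. split; [tauto|apply NNPP].
  - intros C HC. split.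
    + apply Suslin_union; auto. apply HC.
    + apply (Suslin_ext G (fun x => forall i, ~ C i x)).
      * intro x. split. intros H [i Hi]. apply (H i Hi). intros H i Hi. apply H. eauto.
      * apply (Suslin_inter G (fun i x => ~ C i x)). apply HC.
Qed.

(** * Trees with prescribed branches *)

(* The extra first level makes the tree infinite without adding infinite branches. *)
Definition inf_tree (P : list nat -> Prop) : TrSpace := fun s =>
  match s with
  | nil => true
  | _ :: s => if excluded_middle_informative (s = nil \/ P s) then true else false
  end.

Lemma inf_tree_cons P k s : inf_tree P (k :: s) = true <-> s = nil \/ P s.
Proof. unfold inf_tree. destruct (excluded_middle_informative _); split; auto; try congruence; tauto. Qed.

Lemma inf_tree_is_tree P : (forall s u, P (s ++ u) -> P s) -> is_tree (inf_tree P).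
Proof.
  intros HP [|k s] u H; [reflexivity|]. simpl app in H. apply inf_tree_cons in H. apply inf_tree_cons.
  destruct H as [H|H]; [left; apply app_eq_nil in H; tauto|right; eauto].
Qed.

Lemma inf_tree_infinite P : infinite_tree (inf_tree P).
Proof.
  intros [l Hl]. set (L := map (fun k : nat => k :: nil) (seq 0 (S (length l)))).
  assert (Hn : NoDup L).
  { unfold L. apply FinFun.Injective_map_NoDup; [|apply seq_NoDup]. intros a b E. congruence. }
  assert (Hi : incl L l).
  { intros s Hs. apply in_map_iff in Hs. destruct Hs as [k [<- _]]. apply Hl. apply inf_tree_cons. auto. }
  pose proof (NoDup_incl_length Hn Hi) as H. unfold L in H. rewrite length_map, length_seq in H. lia.
Qed.

Lemma inf_tree_ill_founded P : (forall s u, P (s ++ u) -> P s) ->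
  (ill_founded (inf_tree P) <-> exists z : nat -> nat, forall n, P (map z (seq 0 n))).
Proof.
  intro HP.
  split.
  - intros [x Hx]. exists (fun k => x (S k)).
    assert (Hpos : forall n, P (map (fun k => x (S k)) (seq 0 (S n)))).
    { intro n. specialize (Hx (S (S n))). rewrite map_seq_S in Hx. apply inf_tree_cons in Hx. destruct Hx as [Hx|Hx]; auto. discriminate. }
    intros [|n]; auto. apply (HP nil _ (Hpos 0%nat)).
  - intros [z Hz]. exists (fun k => match k with O => 0%nat | S k => z k end). intros [|n]; [reflexivity|].
    rewrite map_seq_S. apply inf_tree_cons. right. apply Hz.
Qed.

Lemma inf_tree_borel {X} (S : (X -> Prop) -> Prop) (P : X -> list nat -> Prop) : sigma_algebra S ->
  (forall s, S (fun x => P x s)) -> forall C, tr_borel C -> S (fun x => C (inf_tree (P x))).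
Proof.
  intros HS HP. apply sigma_gen_preimage; auto. intros B [s Hs].
  apply (sa_ext S (fun x => inf_tree (P x) s = true)); auto. { intro x; symmetry; apply Hs. }
  destruct s as [|k s].
  - apply (sa_ext S (fun _ => True)); auto. { intro; simpl; tauto. } apply sa_const; auto.
  - apply (sa_ext S (fun x => ~ s = nil -> P x s)); auto.
    + intro x. rewrite inf_tree_cons. destruct (classic (s = nil)); tauto.
    + apply sa_imp; auto. apply sa_const; auto.
Qed.

Lemma HI_iff_well_founded P : (forall s u, P (s ++ u) -> P s) ->
  (HI (tree_SB (inf_tree P)) <-> well_founded_tree (inf_tree P)).
Proof.
  intro HP. split.
  - intros H Hill. apply (ill_founded_not_HI _ Hill H).
  - intro H. apply well_founded_HI; auto. apply inf_tree_is_tree; auto. apply inf_tree_infinite.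
Qed.

(** * Hardness *)

Definition boxes {X : Type} (Sig : (X -> Prop) -> Prop) (C : X * (nat -> nat) -> Prop) : Prop :=
  exists A u, Sig A /\ forall p, C p <-> A (fst p) /\ forall i, (i < length u)%nat -> snd p i = nth i u 0%nat.

(** The complement of a cylinder is the union of the other cylinders of the same length, so both are
    Suslin over boxes. *)
Lemma product_Suslin {X} (Sig : (X -> Prop) -> Prop) C : sigma_algebra Sig -> prod_sigma Sig baire_borel C -> Suslin (boxes Sig) C.
Proof.
  intros HS HC.
  assert (HT : forall P : Prop, boxes Sig (fun _ => P)).
  { intro P. exists (fun _ => P), nil. split; [apply sa_const; auto|]. intro p. simpl. split; [|tauto]. intro; split; auto. intros; lia. }
  set (S := fun C => Suslin (boxes Sig) C /\ Suslin (boxes Sig) (fun x => ~ C x)).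
  assert (Hsa : sigma_algebra S) by (apply sa_bi_Suslin; apply HT).
  apply (HC S Hsa). clear C HC. intros C [A [B [HA [HB HC]]]].
  apply (sa_ext S (fun p => A (fst p) /\ B (snd p))); auto. { intro p; symmetry; apply HC. }
  apply (sa_and S (fun p => A (fst p)) (fun p => B (snd p))); auto.
  - assert (Hbox : forall A, Sig A -> Suslin (boxes Sig) (fun p => A (fst p))).
    { intros A' HA'. apply Suslin_base. exists A', nil. split; auto. intro p. split; [|tauto]. intro; split; auto. simpl; intros; lia. }
    split; [auto|]. exact (Hbox (fun x => ~ A x) (sa_not Sig A HS HA)).
  - assert (Hcyl : forall u, Suslin (boxes Sig) (fun p => forall i, (i < length u)%nat -> snd p i = nth i u 0%nat)).
    { intro u. apply Suslin_base. exists (fun _ => True), u. split; [apply sa_const; auto|]. tauto. }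
    refine (sigma_gen_preimage S _ snd Hsa _ B HB). clear HB B HC. intros B [u Hu]. split.
    + eapply Suslin_ext; [|apply (Hcyl u)]. intro p; symmetry; apply Hu.
    + apply (Suslin_ext _ (fun p => exists k, (length (node k) = length u /\ node k <> u) /\ forall i, (i < length (node k))%nat -> snd p i = nth i (node k) 0%nat)).
      * intro p. rewrite Hu. split.
        -- intros [k [[Hl Hne] Hk]] H. apply Hne. apply (nth_ext _ _ 0%nat 0%nat); auto. intros i Hi. rewrite <- Hk, H by lia. reflexivity.
        -- intro H. set (w := map (snd p) (seq 0 (length u))). exists (idx w). rewrite node_idx.
           assert (Hlw : length w = length u) by (unfold w; rewrite length_map, length_seq; reflexivity).
           assert (Hw : forall i, (i < length u)%nat -> nth i w 0%nat = snd p i).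
           { intros i Hi. unfold w. apply nth_map_seq; auto. }
           split; [split; auto|].
           ++ intro E. apply H. intros i Hi. rewrite <- Hw, E by auto. reflexivity.
           ++ intros i Hi. symmetry. apply Hw. lia.
      * apply (Suslin_union (boxes Sig) (fun k p => (length (node k) = length u /\ node k <> u) /\ forall i, (i < length (node k))%nat -> snd p i = nth i (node k) 0%nat)); [apply HT|].
        intro k. apply Suslin_base. exists (fun _ => length (node k) = length u /\ node k <> u), (node k).
        split; [apply sa_const; auto|]. tauto.
Qed.

(** A node of the tree of [x] guesses, paired entrywise, a witness y and a branch z of the Suslin
    scheme for the complement of [A]. It is kept as long as no box along z excludes (x, y), so
    infinite branches witness that [x] is not in [A]. *)
Lemma HI_hard : pi11_hard HI.
Proof.
  intros X Sig [d [_ [_ [_ Hd]]]] A [C [HC HA]].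
  assert (HS : sigma_algebra Sig).
  { pose proof (sa_sigma_gen (metric_open d)) as H. split; [|split; [|split]].
    - intros U V HUV HU. apply Hd. apply Hd in HU. eapply sa_ext; eauto.
    - apply Hd, H.
    - intros U HU. apply Hd. apply Hd in HU. apply sa_not; auto.
    - intros F HF. apply Hd. apply (sa_ex (sigma_gen (metric_open d)) F); auto. intro n. apply Hd, HF. }
  destruct (product_Suslin Sig C HS HC) as [F [HF HCF]].
  assert (HF' : forall s, exists r : (X -> Prop) * list nat, Sig (fst r) /\
     forall p, F s p <-> fst r (fst p) /\ forall i, (i < length (snd r))%nat -> snd p i = nth i (snd r) 0%nat).
  { intro s. destruct (HF s) as [A' [u Hu]]. exists (A', u). exact Hu. }
  destruct (choice _ HF') as [r Hr].
  set (p1 := fun k => fst (Cantor.of_nat k)). set (p2 := fun k => snd (Cantor.of_nat k)).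
  (* The condition [i < length s] postpones the test of entry [i] until it has been guessed. *)
  set (P := fun (x : X) (s : list nat) => forall m, (m <= length s)%nat ->
     fst (r (map p2 (firstn m s))) x /\
     forall i, (i < length (snd (r (map p2 (firstn m s)))))%nat -> (i < length s)%nat -> p1 (nth i s 0%nat) = nth i (snd (r (map p2 (firstn m s)))) 0%nat).
  assert (HP : forall x s u, P x (s ++ u) -> P x s).
  { intros x s u H m Hm. specialize (H m). rewrite length_app in H. specialize (H ltac:(lia)).
    rewrite firstn_app in H. replace (m - length s)%nat with 0%nat in H by lia. simpl in H. rewrite app_nil_r in H.
    destruct H as [H1 H2]. split; auto. intros i Hi His. rewrite <- H2 by lia. rewrite app_nth1 by auto. reflexivity. }
  exists (fun x => tree_SB (inf_tree (P x))). split.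
  - intros B HB. apply (inf_tree_borel Sig P HS) with (C := fun T => B (tree_SB T)); [|apply tree_SB_borel; auto].
    intro s. apply (sa_all Sig (fun m x => (m <= length s)%nat -> fst (r (map p2 (firstn m s))) x /\ _) HS). intro m.
    apply sa_imp; auto. apply sa_const; auto. apply sa_and; auto. apply Hr. apply sa_const; auto.
  - intro x. rewrite (HI_iff_well_founded (P x) (HP x)). unfold well_founded_tree. rewrite (inf_tree_ill_founded (P x) (HP x)).
    assert (Hx : ~ A x <-> exists z : nat -> nat, forall n, P x (map z (seq 0 n))).
    2:{ split. intros H1 H2. apply Hx in H2. auto. intro H. apply NNPP. intro H'. apply Hx in H'. auto. }
    rewrite HA.
    assert (Hfirst : forall (z : nat -> nat) m n, (m <= n)%nat -> map p2 (firstn m (map z (seq 0 n))) = map (fun k => p2 (z k)) (seq 0 m)).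
    { intros z m n Hmn. rewrite firstn_map_seq, map_map by auto. reflexivity. }
    split.
    + intros [y Hy]. apply HCF in Hy. destruct Hy as [z Hz].
      exists (fun k => Cantor.to_nat (y k, z k)). intros n m Hm. rewrite length_map, length_seq in *.
      rewrite (Hfirst _ m n Hm).
      replace (map (fun k => p2 (Cantor.to_nat (y k, z k))) (seq 0 m)) with (map z (seq 0 m)).
      2:{ apply map_ext. intro k. unfold p2. rewrite Cantor.cancel_of_to. reflexivity. }
      specialize (Hz m). apply (Hr (map z (seq 0 m))) in Hz. destruct Hz as [H1 H2]. split; auto.
      intros i Hi Hin. rewrite nth_map_seq by auto. unfold p1. rewrite Cantor.cancel_of_to. simpl. apply H2; auto.
    + intros [w Hw]. exists (fun k => p1 (w k)). apply HCF. exists (fun k => p2 (w k)). intro m. apply Hr. split.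
      * specialize (Hw m m). rewrite length_map, length_seq, Hfirst in Hw by auto. apply Hw; auto.
      (* [n] is large enough for the box at level [m] to be tested and for entry [i] to be read. *)
      * intros i Hi. simpl. set (n := S (Nat.max m i)). specialize (Hw n m). rewrite length_map, length_seq, Hfirst in Hw by (unfold n; lia).
        destruct (Hw ltac:(unfold n; lia)) as [_ H2]. rewrite <- (H2 i Hi) by (unfold n; lia). rewrite nth_map_seq by (unfold n; lia). reflexivity.
Qed.

(** * Non-separation *)

(** A countable list of the sets that fix one value, with the whole space and the empty set; it is
    closed under complements, as [sa_bi_Suslin] is to be applied to it. *)
Definition cyl (k : nat) (T : TrSpace) : Prop :=
  match Cantor.of_nat k with
  | (_, O) => True
  | (_, 1%nat) => False
  | (a, 2%nat) => T (node a) = true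
  | (a, _) => T (node a) = false
  end.

Lemma tr_borel_Suslin C : tr_borel C -> Suslin (fun R => exists k, forall T, R T <-> cyl k T) C.
Proof.
  intro HC. set (G := fun R : TrSpace -> Prop => exists k, forall T, R T <-> cyl k T).
  refine (proj1 (HC (fun C => Suslin G C /\ Suslin G (fun x => ~ C x)) _ _)).
  - apply sa_bi_Suslin.
    + exists (Cantor.to_nat (0, 0)%nat). intro T. unfold cyl. rewrite Cantor.cancel_of_to. tauto.
    + exists (Cantor.to_nat (0, 1)%nat). intro T. unfold cyl. rewrite Cantor.cancel_of_to. tauto.
  - intros B [s Hs]. split; apply Suslin_base.
    + exists (Cantor.to_nat (idx s, 2)%nat). intro T. unfold cyl. rewrite Cantor.cancel_of_to, node_idx. apply Hs.
    + exists (Cantor.to_nat (idx s, 3)%nat). intro T. unfold cyl. rewrite Cantor.cancel_of_to, node_idx, Hs.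
      destruct (T s); split; congruence.
Qed.

Lemma cyl_borel k : tr_borel (cyl k).
Proof.
  assert (H : forall s, tr_borel (fun T => T s = true)) by (intros s S HS HG; apply HG; exists s; reflexivity).
  unfold cyl. destruct (Cantor.of_nat k) as [a [|[|[|b]]]]; try (apply sa_const, sa_sigma_gen); auto.
  apply (sa_ext tr_borel (fun T => ~ T (node a) = true)); [apply sa_sigma_gen| |apply sa_not; [apply sa_sigma_gen|auto]].
  intro T. destruct (T (node a)); split; congruence.
Qed.

(** A point [S] of [TrSpace] is read as a Suslin scheme: [S (k :: s) = true] puts [cyl k] at [s].
    The tree of [P S] is ill-founded iff [S] lies in the set of its own scheme. For a separating
    [B], the points whose space is outside [B] form a Borel set, hence have a scheme, coded by [S0].
    The tree of [S0] is then ill-founded iff its space is outside [B], the opposite of what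
    separation demands. *)
Lemma not_separable : not_borel_separable embeds_l1 HI.
Proof.
  intros [B [HB [Hl1 HHI]]].
  set (P := fun (S : TrSpace) (s : list nat) => forall m k, S (k :: firstn m s) = true -> cyl k S).
  assert (HP : forall S s u, P S (s ++ u) -> P S s).
  { intros S s u H m k Hk. destruct (le_ge_dec m (length s)) as [Hm|Hm].
    - apply (H m k). rewrite firstn_app. replace (m - length s)%nat with 0%nat by lia. simpl. rewrite app_nil_r. exact Hk.
    - apply (H (length s) k). rewrite firstn_app, Nat.sub_diag, firstn_all. simpl. rewrite app_nil_r. rewrite firstn_all2 in Hk by lia. exact Hk. }
  assert (HK : tr_borel (fun S => ~ B (tree_SB (inf_tree (P S))))).
  { apply sa_not; [apply sa_sigma_gen|].
    apply (inf_tree_borel tr_borel P (sa_sigma_gen _)) with (C := fun T => B (tree_SB T)); [|apply tree_SB_borel; auto].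
    intro s. apply (sa_all tr_borel (fun m S => forall k, S (k :: firstn m s) = true -> cyl k S)); [apply sa_sigma_gen|]. intro m.
    apply (sa_all tr_borel (fun k S => S (k :: firstn m s) = true -> cyl k S)); [apply sa_sigma_gen|]. intro k.
    apply sa_imp; [apply sa_sigma_gen| |apply cyl_borel]. intros S HS HG. apply HG. exists (k :: firstn m s). reflexivity. }
  destruct (tr_borel_Suslin _ HK) as [F [HF HKF]]. destruct (choice _ HF) as [kap Hkap].
  set (S0 := fun l : list nat => match l with nil => false | k :: s => (k =? kap s)%nat end).
  assert (HS0 : ill_founded (inf_tree (P S0)) <-> ~ B (tree_SB (inf_tree (P S0)))).
  { rewrite (inf_tree_ill_founded (P S0) (HP S0)), (HKF S0). split; intros [z Hz]; exists z; intro n.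
    - apply Hkap. apply (Hz n n). rewrite firstn_all2 by (rewrite length_map, length_seq; auto). apply Nat.eqb_refl.
    - intros m k Hk. simpl in Hk. apply Nat.eqb_eq in Hk. subst k. apply Hkap.
      replace (firstn m (map z (seq 0 n))) with (map z (seq 0 (Nat.min m n))); [apply Hz|].
      destruct (le_ge_dec m n) as [Hm|Hm].
      + rewrite Nat.min_l, firstn_map_seq by auto. reflexivity.
      + rewrite Nat.min_r by auto. symmetry. apply firstn_all2. rewrite length_map, length_seq; auto. }
  destruct (classic (ill_founded (inf_tree (P S0)))) as [Hill|Hwf].
  - apply HS0; auto. apply Hl1. apply ill_founded_l1; auto.
  - assert (HBt : B (tree_SB (inf_tree (P S0)))) by (apply NNPP; intro H; apply Hwf, HS0; auto).
    apply (HHI _ HBt). apply HI_iff_well_founded; auto. apply HP.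
Qed.

Theorem theorem5p12 :
  (exists phi : TrSpace -> SB,
      borel_on_trees phi /\
      (forall theta, is_tree theta -> ill_founded theta -> embeds_l1 (phi theta)) /\
      (forall theta, is_tree theta -> well_founded_tree theta -> infinite_tree theta ->
         HI (phi theta))) /\
  pi11_hard HI /\
  not_borel_separable embeds_l1 HI.
Proof.
  split; [|split; [exact HI_hard|exact not_separable]].
  exists tree_SB. split; [|split].
  - intros B HB. exists (fun T => B (tree_SB T)). split; [apply tree_SB_borel; auto|]. tauto.
  - intros theta _ H. apply ill_founded_l1; auto.
  - intros theta HT Hwf Hinf. apply well_founded_HI; auto.
Qed.
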